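(* Fix constants $0<\epsilon<\tfrac13$ and $\delta>0$, and let $\lambda_n=\frac{1+\chi_n}{n}$, where $(\chi_n)$ is a sequence with $\epsilon\ge \chi_n\ge n^{-\frac13+\delta}$. Let $\Gamma_n$ be the random induced subgraph of $Q_2^n$ obtained by selecting each vertex independently with probability $\lambda_n$, and let $C_n^{(1)}$ be a largest component of $\Gamma_n$. (i) If $\chi_n=\epsilon$ for all $n$, then for every $\eta>0$, $$\lim_{n\to\infty}\mathbb{P}\Big(\Big|\,|C_n^{(1)}| - \alpha(\epsilon)\tfrac{1+\epsilon}{n}2^n\Big|\le \eta\,\alpha(\epsilon)\tfrac{1+\epsilon}{n}2^n\ \text{ and } C_n^{(1)} \text{ is the unique largest component}\Big)=1 .$$ (ii) If $\chi_n\to 0$ (and still $\chi_n\ge n^{-\frac13+\delta}$), then for every $\eta>0$, $$\lim_{n\to\infty}\mathbb{P}\Big(\Big|\,|C_n^{(1)}| - 2\chi_n\tfrac{1+\chi_n}{n}2^n\Big|\le \eta\, 2\chi_n\tfrac{1+\chi_n}{n}2^n\ \text{ and } C_n^{(1)} \text{ is the unique largest component}\Big)=1 .$$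
   Context: $Q_2^n$ is the binary $n$-cube: vertex set $\mathbb{F}_2^n$, two vertices adjacent iff they differ in exactly one coordinate. The random graph $\Gamma_n$ is the subgraph of $Q_2^n$ induced by a random vertex set in which each vertex of $\mathbb{F}_2^n$ is included independently with probability $\lambda_n$. A component of $\Gamma_n$ is a maximal connected induced subgraph of $\Gamma_n$. $\alpha(\epsilon)\in(0,1)$ denotes the probability that a Galton–Watson branching process with Poisson$(1+\epsilon)$ offspring distribution, started from one individual, survives forever. *)

(* Defs.v *)
From mathcomp Require Import all_boot.
From Stdlib Require Import Reals ClassicalEpsilon.

Set Implicit Arguments.
Unset Strict Implicit.
Unset Printing Implicit Defensive.

Definition cube (n : nat) : finType := {ffun 'I_n -> bool}.

Definition cube_adj (n : nat) : rel (cube n) :=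
  fun x y => #|[pred i : 'I_n | x i != y i]| == 1%N.

Definition induced_adj (n : nat) (S : {set cube n}) : rel (cube n) :=
  fun x y => [&& x \in S, y \in S & cube_adj x y].

(* The component of Gamma = Q_2^n[S] containing x (meaningful for x \in S). *)
Definition comp (n : nat) (S : {set cube n}) (x : cube n) : {set cube n} :=
  [set y | connect (induced_adj S) x y].

Definition giant_event (n : nat) (a eta : R) (S : {set cube n}) : Prop :=
  exists x, x \in S /\
    (forall y, y \in S -> (#|comp S y| <= #|comp S x|)%N) /\
    (forall y, y \in S -> #|comp S y| = #|comp S x| -> comp S y = comp S x) /\
    Rle (Rabs (Rminus (INR #|comp S x|) a)) (Rmult eta a).

Definition prob (n : nat) (lam : R) (E : {set cube n} -> Prop) : R :=
  \big[Rplus/R0]_(S : {set cube n})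
     (if excluded_middle_informative (E S)
      then Rmult (pow lam #|S|) (pow (Rminus R1 lam) #|~: S|) else R0).

Definition poisson_pgf (eps : R) (s : R) : R := exp (Rmult (Rplus R1 eps) (Rminus s R1)).

(* Probability that the Galton-Watson process with Poisson(1+eps) offspring,
   started from one individual, is still alive at generation k:
   1 - P(Z_k = 0) = 1 - f^{(k)}(0), f the offspring pgf. *)
Definition gw_alive (eps : R) (k : nat) : R :=
  Rminus R1 (Nat.iter k (poisson_pgf eps) R0).

Arguments prob : clear implicits.
Arguments giant_event : clear implicits.

(* Main.v *)
(* A component of size at least K is found by exploration.  A vertex has n
   neighbours, so the exploration is dominated by a branching process with
   Bin(n, p) offspring; conversely two vertices of the cube have at most two
   common neighbours, so K explored vertices spoil at most 2 K neighbours of any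
   vertex and the branching process with Bin(n - O(K), p) offspring is dominated.
   With K a little below chi n both processes survive with probability close to
   alpha (or 2 chi): this needs K chi^2 and K^2 chi / n large, that is, chi well
   above n^(-1/3).

   Reserving O(K log n) coordinates (a negligible proportion of n), a tree of K
   vertices continues with high probability into independent parallel subcubes, doubling
   its size in each of h rounds, up to any power L of n.  Hence the expected number
   of vertices in components of size at least L is about alpha p 2^n, and by
   Efron-Stein this number is concentrated, as it changes by at most 1 + n L when a
   vertex is added.  The same device shows that nearly every vertex of the cube is
   within distance two of such a component.

   Finally p is split as 1 - p = (1 - p1) (1 - p2).  If the p2-vertices failed to
   merge the large components of the p1-subgraph, these would split into two parts
   A and B, both large.  By isoperimetry there are 2^n / poly(n) disjoint paths with
   at most four inner vertices from A to B, and each is opened with probability at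
   least p2^4, which beats the number 2^(2^n / L) of choices of A.  One component
   thus has nearly all the vertices of components of size at least K, and so it is
   the unique largest one. *)
Require Import Defs.
From mathcomp Require Import all_boot.
From Stdlib Require Import ZArith Reals Lra ClassicalEpsilon.
From Coquelicot Require Coquelicot.
From mathcomp Require Import all_boot all_order all_algebra.
From mathcomp Require Import zify Rstruct.
From mathcomp Require ring lra.
Set Implicit Arguments. Unset Strict Implicit. Unset Printing Implicit Defensive.
Import Order.TTheory GRing.Theory Num.Theory.

Local Notation comp := Defs.comp.

(** Both regimes come from one finite estimate. Write pi for [alpha] or [2 * chi]. Besides crude
    bounds, all that is used of pi is a window: (1 - eta) pi and (1 + eta) pi lie on the two sides
    of the root of 1 - r = exp (- (1 + chi) r), even when chi is replaced by (1 - eta2) chi on the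
    lower side and by (1 + eta2) chi on the upper one. The room eta2 pays for the sprinkled part of
    p, for the reserved coordinates and for binomial instead of Poisson offspring.

    Trees of size K cannot be merged directly: as K <= n, the 2^(2^n / K) possible unions would
    outnumber what paths open with probability p2^4, a negative power of n, can beat. About 2^n /
    n^7 disjoint paths times p2^4 >= n^(-12) give an exponent of order 2^n / n^19, so trees boosted
    to L = n^24 suffice. These powers are deliberately crude; the delicate condition is y^12 <=
    chi^3 n, with y a small power of n, and it is the one that brings in the exponent -1/3. *)

Module Combinatorics.
Import mathcomp.algebra_tactics.ring mathcomp.algebra_tactics.lra.

(** * Random subsets of a finite type *)

Section Expectation.
Local Open Scope ring_scope.
Variables (R : realFieldType) (T : finType).
Implicit Types (p q : R) (l : seq T) (S D : {set T}) (f g : {set T} -> R).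

(* Expectation of f over the random subset of l that contains each entry
   independently with probability p (l is always duplicate-free below). *)
Fixpoint Ex p l f : R :=
  if l is v :: l' then p * Ex p l' (fun S => f (v |: S)) + (1 - p) * Ex p l' f
  else f set0.

Lemma eq_Ex_sub p l f g :
  (forall S, {subset S <= l} -> f S = g S) -> Ex p l f = Ex p l g.
Proof.
elim: l f g => [|v l IH] f g fg /=; first by apply: fg => x; rewrite inE.
congr (_ * _ + _ * _); apply: IH => S Sl; apply: fg => x.
  by rewrite !inE => /predU1P[->|/Sl ->]; rewrite ?eqxx ?orbT.
by move/Sl; rewrite inE => ->; rewrite orbT.
Qed.

Lemma eq_Ex p l f g : f =1 g -> Ex p l f = Ex p l g.
Proof. by move=> fg; apply: eq_Ex_sub => S _; apply: fg. Qed.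

Lemma ExD p l f g : Ex p l (fun S => f S + g S) = Ex p l f + Ex p l g.
Proof. by elim: l f g => //= v l IH f g; rewrite !IH; ring. Qed.

Lemma ExZ p l c f : Ex p l (fun S => c * f S) = c * Ex p l f.
Proof.
elim: l f => //= v l IH f.
rewrite (IH (fun S => f (v |: S))) (IH f).
ring.
Qed.

Lemma Ex_cst p l c : Ex p l (fun=> c) = c.
Proof. by elim: l => //= v l ->; ring. Qed.

Lemma ExB p l f g : Ex p l (fun S => f S - g S) = Ex p l f - Ex p l g.
Proof.
rewrite -[- Ex p l g]mulN1r -ExZ -ExD.
by apply: eq_Ex => S; rewrite mulN1r.
Qed.

Lemma Ex_sum p l (I : Type) (r : seq I) (P : pred I) (F : I -> {set T} -> R) :
  Ex p l (fun S => \sum_(i <- r | P i) F i S) = \sum_(i <- r | P i) Ex p l (F i).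
Proof.
elim: r => [|i r IH].
  rewrite big_nil -[RHS](Ex_cst p l 0).
  by apply: eq_Ex => S; rewrite big_nil.
rewrite big_cons; under eq_Ex => S do rewrite big_cons.
by case: (P i); rewrite ?ExD IH.
Qed.

Section Monotone.
Variables (p : R) (l : seq T).
Hypotheses (p0 : 0 <= p) (p1 : p <= 1).

Lemma le_Ex_sub f g :
  (forall S, {subset S <= l} -> f S <= g S) -> Ex p l f <= Ex p l g.
Proof.
elim: l f g => [|v l' IH] f g fg /=; first by apply: fg => x; rewrite inE.
apply: lerD; apply: ler_wpM2l => //; rewrite ?subr_ge0 //; apply: IH => S Sl; apply: fg => x.
  by rewrite !inE => /predU1P[->|/Sl ->]; rewrite ?eqxx ?orbT.
by move/Sl; rewrite inE => ->; rewrite orbT.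
Qed.

Lemma le_Ex f g : (forall S, f S <= g S) -> Ex p l f <= Ex p l g.
Proof. by move=> fg; apply: le_Ex_sub => S _; apply: fg. Qed.

Lemma Ex_ge0 f : (forall S, 0 <= f S) -> 0 <= Ex p l f.
Proof. by move=> f0; rewrite -(Ex_cst p l 0); apply: le_Ex. Qed.

End Monotone.

Definition mix D S S' : {set T} := (S :&: D) :|: (S' :\: D).

(* Resampling outside D replaces conditioning on S inside D. *)
Lemma Ex_mix p l D f : Ex p l f = Ex p l (fun S => Ex p l (fun S' => f (mix D S S'))).
Proof.
elim: l f => [|v l IH] f /=.
  by congr f; apply/setP => x; rewrite !inE andbF.
rewrite [X in _ = p * X + _]ExD [X in _ = _ + _ * X]ExD !ExZ.
case: (boolP (v \in D)) => vD.
- have E1 : forall S S', mix D (v |: S) (v |: S') = v |: mix D S S'.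
    by move=> S S'; apply/setP => x; rewrite !inE; case: eqP => // ->; rewrite vD.
  have E2 : forall S S', mix D (v |: S) S' = v |: mix D S S'.
    by move=> S S'; apply/setP => x; rewrite !inE; case: eqP => // ->; rewrite vD.
  have E3 : forall S S', mix D S (v |: S') = mix D S S'.
    by move=> S S'; apply/setP => x; rewrite !inE; case: eqP => // ->; rewrite vD.
  under [X in _ = _ * (_ * X + _) + _]eq_Ex => S do under eq_Ex => S' do rewrite E1.
  under [X in _ = _ * (_ + _ * X) + _]eq_Ex => S do under eq_Ex => S' do rewrite E2.
  under [X in _ = _ + _ * (_ * X + _)]eq_Ex => S do under eq_Ex => S' do rewrite E3.
  rewrite -(IH f) -(IH (fun S => f (v |: S))); ring.
- have E1 : forall S S', mix D (v |: S) (v |: S') = v |: mix D S S'.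
    by move=> S S'; apply/setP => x; rewrite !inE; case: eqP => // ->; rewrite (negbTE vD) andbF.
  have E2 : forall S S', mix D (v |: S) S' = mix D S S'.
    by move=> S S'; apply/setP => x; rewrite !inE; case: eqP => // ->; rewrite (negbTE vD) !andbF.
  have E3 : forall S S', mix D S (v |: S') = v |: mix D S S'.
    by move=> S S'; apply/setP => x; rewrite !inE; case: eqP => // ->; rewrite (negbTE vD) ?andbF.
  under [X in _ = _ * (_ * X + _) + _]eq_Ex => S do under eq_Ex => S' do rewrite E1.
  under [X in _ = _ * (_ + _ * X) + _]eq_Ex => S do under eq_Ex => S' do rewrite E2.
  under [X in _ = _ + _ * (_ * X + _)]eq_Ex => S do under eq_Ex => S' do rewrite E3.
  rewrite -(IH f) -(IH (fun S => f (v |: S))); ring.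
Qed.

Lemma Ex_sprinkle p p1 p2 l f : 1 - p = (1 - p1) * (1 - p2) ->
  Ex p l f = Ex p1 l (fun S1 => Ex p2 l (fun S2 => f (S1 :|: S2))).
Proof.
move=> pE; have {}pE : p = 1 - (1 - p1) * (1 - p2) by rewrite -pE; ring.
elim: l f => [|v l IH] f /=; first by rewrite setU0.
rewrite !ExD !ExZ.
under [X in _ = _ * (_ * X + _) + _]eq_Ex => S do under eq_Ex => S' do
  rewrite -setUUr.
under [X in _ = _ * (_ + _ * X) + _]eq_Ex => S do under eq_Ex => S' do
  rewrite -setUA.
under [X in _ = _ + _ * (_ * X + _)]eq_Ex => S do under eq_Ex => S' do
  rewrite setUCA.
rewrite -(IH f) -(IH (fun S => f (v |: S))) pE; ring.
Qed.

(* Efron-Stein, by averaging out one vertex at a time. *)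
Lemma var_Ex p l f c : 0 <= p <= 1 ->
  (forall v S, (f (v |: S) - f S) ^+ 2 <= c) ->
  Ex p l (fun S => f S ^+ 2) - Ex p l f ^+ 2 <= p * c * (size l)%:R.
Proof.
case/andP=> p0 p1; elim: l f => [|v l IH] f fc /=; first by rewrite subrr mulr0.
(* Averaging out v keeps the one-vertex bound, by convexity of the square; the variance of f is that
   of g plus p (1 - p) times the mean squared effect of v. *)
pose g S := p * f (v |: S) + (1 - p) * f S.
have gc w S : (g (w |: S) - g S) ^+ 2 <= c.
  rewrite /g setUCA; have := fc w (v |: S); have := fc w S.
  move: (f (w |: (v |: S))) (f (v |: S)) (f (w |: S)) (f S) => a b d e H1 H2.
  have : p * c + (1 - p) * c - (p * (a - b) ^+ 2 + (1-p) * (d - e) ^+ 2) >= 0.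
    by rewrite subr_ge0 lerD // ler_wpM2l // subr_ge0.
  have : p * (1 - p) * ((a - b) - (d - e)) ^+ 2 >= 0.
    by rewrite mulr_ge0 ?sqr_ge0 // mulr_ge0 // subr_ge0.
  move=> H3 H4; rewrite -subr_ge0.
  set X := (X in 0 <= X).
  suff -> : X = p * (1 - p) * ((a - b) - (d - e)) ^+ 2 +
     (p * c + (1 - p) * c - (p * (a - b) ^+ 2 + (1-p) * (d - e) ^+ 2)).
    exact: addr_ge0.
  by rewrite /X; ring.
have {}IH := IH g gc.
have Eg : Ex p l g = p * Ex p l (fun S => f (v |: S)) + (1 - p) * Ex p l f.
  by rewrite /g ExD !ExZ.
have Eg2 : Ex p l (fun S => g S ^+ 2) = p * Ex p l (fun S => f (v |: S) ^+ 2)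
    + (1 - p) * Ex p l (fun S => f S ^+ 2)
    - p * (1 - p) * Ex p l (fun S => (f (v |: S) - f S) ^+ 2).
  rewrite -!ExZ -ExD -ExB; apply: eq_Ex => S; rewrite /g; ring.
have D : p * (1 - p) * Ex p l (fun S => (f (v |: S) - f S) ^+ 2) <= p * c.
  have h : Ex p l (fun S => (f (v |: S) - f S) ^+ 2) <= c.
    by rewrite -[leRHS](Ex_cst p l); apply: le_Ex.
  have h0 : 0 <= Ex p l (fun S => (f (v |: S) - f S) ^+ 2).
    by apply: Ex_ge0 => // S; apply: sqr_ge0.
  rewrite -mulrA ler_wpM2l //; apply: le_trans h.
  by rewrite ler_piMl // gerBl.
rewrite -Eg mulrSr mulrDr mulr1; lra.
Qed.

(** Links the recursive expectation to the weighted sum over subsets that defines [prob]. *)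
Lemma Ex_sumE p l f : uniq l ->
  Ex p l f = \sum_(S : {set T} | S \subset l) p ^+ #|S| * (1 - p) ^+ (size l - #|S|) * f S.
Proof.
elim: l f => [|v l IH] f /=.
  move=> _; rewrite (big_pred1 set0); first by rewrite cards0 !expr0 !mul1r.
  move=> S /=; apply/idP/eqP => [/subsetP H|->]; last by apply/subsetP => x; rewrite inE.
  by apply/setP => x; rewrite inE; apply/negP => /H.
case/andP=> vl ul; rewrite !IH // [RHS](bigID (fun S : {set T} => v \in S)) /=; congr (_ + _).
- rewrite mulr_sumr [RHS](reindex_onto (fun S => v |: S) (fun S => S :\ v)) /=; last first.
    by move=> S /andP[_ vS]; rewrite setD1K.
  apply: eq_big => S.
    rewrite setU11 andbT; apply/idP/andP.
      move=> Sl; have vS : v \notin S by apply: contraNN vl => /(subsetP Sl).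
      split; last by rewrite setU1K.
      by apply/subsetP => x; rewrite !inE => /predU1P[->|/(subsetP Sl) ->]; rewrite ?eqxx ?orbT.
    case=> /subsetP Sl /eqP <-; apply/subsetP => x; rewrite !inE => /andP[xv].
    rewrite (negbTE xv) /= => xS; have := Sl x; rewrite !inE xS orbT => /(_ isT).
    by rewrite (negbTE xv).
  move=> Sl; have vS : v \notin S by apply: contraNN vl => /(subsetP Sl).
  by rewrite cardsU1 vS /= add1n subSS exprS !mulrA.
- rewrite mulr_sumr; apply: eq_big => S.
    apply/idP/andP.
      move=> /subsetP Sl; split; last by apply: contraNN vl => /Sl.
      by apply/subsetP => x /Sl; rewrite inE => ->; rewrite orbT.
    case=> /subsetP Sl vS; apply/subsetP => x xS; have := Sl _ xS.
    by rewrite inE => /predU1P[xv|//]; rewrite -xv xS in vS.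
  move=> /subsetP Sl; rewrite subSn ?exprS; first by rewrite mulrCA !mulrA; congr (_ * _); rewrite -!mulrA; congr (_ * _); rewrite mulrC.
  rewrite cardE; apply: uniq_leq_size; first exact: enum_uniq.
  by move=> x; rewrite mem_enum => /Sl.
Qed.

(* One Bernoulli(p) step: (BE p)^n h j is the expectation of h (j + Bin(n, p)). *)
Definition BE p (h : nat -> R) (j : nat) : R := p * h j.+1 + (1 - p) * h j.

(** Entries outside D average out and each entry in D is one Bernoulli step, so the size of the
    intersection is binomial. *)
Lemma Ex_card p l D h : uniq l ->
  Ex p l (fun S => h #|S :&: D|) = iter (count (mem D) l) (BE p) h 0%N.
Proof.
elim: l h => [|v l IH] h /=; first by rewrite set0I cards0.
case/andP=> vl ul.
case: (boolP (v \in D)) => vD /=; rewrite ?add1n ?add0n /=.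
- rewrite {1}/BE -[in RHS](IH h) //; congr (_ * _ + _).
  have sh k h' j : iter k (BE p) (fun i => h' i.+1) j = iter k (BE p) h' j.+1.
    by elim: k j => //= k IHk j; rewrite /BE !IHk.
  rewrite -sh -IH //; apply: eq_Ex_sub => S Sl; congr h.
  rewrite setIUl; have -> : [set v] :&: D = [set v].
    by apply/setIidPl; rewrite sub1set.
  rewrite cardsU1 inE; suff -> : v \in S = false by [].
  by apply: contraNF vl => /Sl.
- rewrite -IH //.
  have E S : (v |: S) :&: D = S :&: D.
    by apply/setP => x; rewrite !inE; case: eqP => // ->; rewrite (negbTE vD) !andbF.
  have -> : Ex p l (fun S => h #|(v |: S) :&: D|) = Ex p l (fun S => h #|S :&: D|).
    by apply: eq_Ex => S; rewrite E.
  by ring.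
Qed.

End Expectation.

(** * Events: independence, conditioning and tail bounds *)

Section Probability.
Local Open Scope ring_scope.
Variables (R : realFieldType) (T : finType) (p : R).
Implicit Types (S D : {set T}) (f g : {set T} -> R) (b c : {set T} -> bool).

Definition EE f := Ex p (enum T) f.
Definition Pr b := EE (fun S => (b S)%:R).

Definition dep D b := forall S, b (S :&: D) = b S.

Lemma dep_sub D D' b : D \subset D' -> dep D b -> dep D' b.
Proof.
move=> /setIidPr DD' bD S; rewrite -[LHS]bD -[RHS]bD; congr b.
by rewrite -setIA DD'.
Qed.

Lemma eq_Pr b c : b =1 c -> Pr b = Pr c.
Proof. by move=> bc; apply: eq_Ex => S; rewrite bc. Qed.

Lemma mixI D S S' : mix D S S' :&: D = S :&: D.
Proof. by apply/setP => x; rewrite !inE; case: (x \in D); rewrite ?andbT ?andbF ?orbF. Qed.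

Lemma mixC D S S' : mix D S S' :\: D = S' :\: D.
Proof. by apply/setP => x; rewrite !inE; case: (x \in D); rewrite ?andbT ?andbF ?orbF. Qed.

Lemma dep_mix D D' b S S' : dep D b -> [disjoint D & D'] -> b (mix D' S S') = b S'.
Proof.
move=> bD DD'; rewrite -bD -[RHS]bD; congr b; apply/setP => x; rewrite !inE.
by case: (boolP (x \in D)) => xD; rewrite ?andbT ?andbF // (disjointFr DD' xD) andbF.
Qed.

Lemma EE_cst a : EE (fun=> a) = a. Proof. exact: Ex_cst. Qed.

Lemma PrN b : Pr (fun S => ~~ b S) = 1 - Pr b.
Proof.
rewrite -[in RHS](EE_cst 1) /Pr /EE -ExB; apply: eq_Ex => S.
by case: (b S); rewrite ?subrr ?subr0.
Qed.

Lemma EE_sumE f :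
  EE f = \sum_(S : {set T}) p ^+ #|S| * (1 - p) ^+ #|~: S| * f S.
Proof.
rewrite /EE Ex_sumE ?enum_uniq //; apply: eq_big => S.
  by apply/subsetP => x; rewrite mem_enum.
by move=> _; congr (_ * _ ^+ _ * _); rewrite -cardT; have := cardsC S; lia.
Qed.

Section Ge01.
Hypothesis p01 : 0 <= p <= 1.
Let p0 : 0 <= p. Proof. by case/andP: p01. Qed.
Let p1 : p <= 1. Proof. by case/andP: p01. Qed.

Lemma le_EE f g : (forall S, f S <= g S) -> EE f <= EE g.
Proof. exact: le_Ex. Qed.

Lemma EE_ge0 f : (forall S, 0 <= f S) -> 0 <= EE f.
Proof. exact: Ex_ge0. Qed.

Lemma Pr_ge0 b : 0 <= Pr b.
Proof. by apply: EE_ge0 => S; rewrite ler0n. Qed.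

Lemma le_Pr b c : (forall S, b S -> c S) -> Pr b <= Pr c.
Proof. by move=> bc; apply: le_EE => S; rewrite ler_nat; case: (b S) (bc S) => // ->. Qed.

Lemma Pr_le1 b : Pr b <= 1.
Proof. by rewrite -[leRHS](EE_cst 1); apply: le_EE => S; rewrite lern1 leq_b1. Qed.

Lemma Pr_or b c : Pr (fun S => b S || c S) <= Pr b + Pr c.
Proof.
rewrite /Pr /EE -ExD; apply: le_EE => S.
by case: (b S) (c S) => [] []; rewrite -natrD ler_nat.
Qed.

Lemma Pr_exists (I : finType) (P : pred I) (b : I -> {set T} -> bool) :
  Pr (fun S => [exists i in P, b i S]) <= \sum_(i in P) Pr (b i).
Proof.
rewrite /Pr /EE -Ex_sum; apply: le_EE => S.
case: existsP => [[i /andP[Pi bi]]|_]; last by apply: sumr_ge0 => i _; rewrite ler0n.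
by rewrite (bigD1 i) //= bi lerDl; apply: sumr_ge0 => j _; rewrite ler0n.
Qed.

(** Resampling outside D leaves b as it is at S, so the integrand factors into the indicator of b at
    S and the probability of c given S inside D. *)
Lemma Pr_cond D b c (q : R) : dep D b ->
  (forall S, b S -> q <= Pr (fun S' => c (mix D S S'))) ->
  Pr b * q <= Pr (fun S => b S && c S).
Proof.
move=> bD H; rewrite {2}/Pr /EE (Ex_mix _ _ D) mulrC /Pr /EE -ExZ.
apply: le_EE => S.
have -> : Ex p (enum T) (fun S' => (b (mix D S S') && c (mix D S S'))%:R)
   = (b S)%:R * Pr (fun S' => c (mix D S S')).
  rewrite /Pr /EE -ExZ; apply: eq_Ex => S'.
  by rewrite -bD mixI bD -mulnb natrM.
by case: (boolP (b S)) => bS; rewrite ?mulr1 ?mul1r ?mulr0 ?mul0r // H.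
Qed.

Lemma Markov f a : 0 < a -> (forall S, 0 <= f S) -> Pr (fun S => a <= f S) <= EE f / a.
Proof.
move=> a0 f0; rewrite ler_pdivlMr // mulrC /Pr /EE -ExZ; apply: le_EE => S.
by case: (boolP (a <= f S)) => H; rewrite ?mulr1 ?mulr0.
Qed.

Lemma Chebyshev f (v a : R) : 0 < a ->
  (forall x S, (f (x |: S) - f S) ^+ 2 <= v) ->
  Pr (fun S => a <= `|f S - EE f|) <= p * v * #|T|%:R / a ^+ 2.
Proof.
move=> a0 fc; have := var_Ex (enum T) p01 fc; rewrite -cardT => V.
apply: le_trans (_ : EE (fun S => (f S - EE f) ^+ 2) / a ^+ 2 <= _).
  apply: le_trans (Markov _ _); rewrite ?exprn_gt0 //; last by move=> S; apply: sqr_ge0.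
  apply: le_Pr => S H; rewrite -[leRHS]real_normK ?num_real //.
  by rewrite lerXn2r // nnegrE ?(ltW a0).
rewrite ler_pM2r ?invr_gt0 ?exprn_gt0 //; apply: le_trans V.
rewrite le_eqVlt; apply/orP; left; apply/eqP; transitivity (EE (fun S => f S ^+ 2 - (2 * EE f * f S - EE f ^+ 2))).
  by apply: eq_Ex => S; ring.
rewrite /EE ExB ExB ExZ Ex_cst; ring.
Qed.

End Ge01.

Lemma Pr_indep D D' b c : [disjoint D & D'] -> dep D b -> dep D' c ->
  Pr (fun S => b S && c S) = Pr b * Pr c.
Proof.
move=> DD' bD cD; rewrite {1}/Pr /EE (Ex_mix _ _ D).
rewrite mulrC /Pr /EE -ExZ; apply: eq_Ex => S; rewrite mulrC -ExZ; apply: eq_Ex => S'.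
rewrite -mulnb natrM -bD mixI bD; congr (_ * (_ : bool)%:R).
have cD' : dep (~: D) c by apply: dep_sub cD; rewrite -disjoints_subset disjoint_sym.
by rewrite -cD' -setDE mixC setDE cD'.
Qed.

Lemma Pr_all (I : eqType) (s : seq I) (D : I -> {set T}) (b : I -> {set T} -> bool) :
  uniq s -> {in s &, forall i j, i != j -> [disjoint D i & D j]} ->
  {in s, forall i, dep (D i) (b i)} ->
  Pr (fun S => all (b^~ S) s) = \prod_(i <- s) Pr (b i).
Proof.
move=> us dis bD.
suff [_ //] : dep (\bigcup_(i <- s) D i) (fun S => all (b^~ S) s) /\
  Pr (fun S => all (b^~ S) s) = \prod_(i <- s) Pr (b i).
elim: s us dis bD => [|i s IH] /=; first by rewrite !big_nil /dep => *; split => //; exact: EE_cst.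
case/andP=> is_ us dis bD.
have [||dA EA] := IH us.
- by move=> j k js ks; apply: dis; rewrite inE ?js ?ks orbT.
- by move=> j js; apply: bD; rewrite inE js orbT.
rewrite !big_cons -EA; split.
  move=> S /=; congr (_ && _).
    by apply: (dep_sub (D := D i)); [apply: subsetUl | apply: bD; rewrite inE eqxx].
  exact: (dep_sub (b := fun S => all (b^~ S) s) (subsetUr _ _) dA S).
apply: (Pr_indep _ _ dA); last by apply: bD; rewrite inE eqxx.
rewrite disjoint_sym; elim: s is_ dis {IH us bD dA EA} => [|j s IH].
  by rewrite big_nil -setI_eq0 set0I eqxx.
rewrite inE negb_or => /andP[ij is_] dis.
rewrite big_cons -setI_eq0 setIUl setU_eq0 !setI_eq0; apply/andP; split.
  by apply: dis; rewrite ?inE ?eqxx ?orbT // eq_sym.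
by apply: IH => // k l ks ls; apply: dis; [move: ks|move: ls]; rewrite !inE => /orP[]->; rewrite ?orbT.
Qed.

Lemma Pr_all_le (I : eqType) (s : seq I) (D : I -> {set T}) (b : I -> {set T} -> bool) (q : R) :
  0 <= p <= 1 ->
  uniq s -> {in s &, forall i j, i != j -> [disjoint D i & D j]} ->
  {in s, forall i, dep (D i) (b i)} ->
  {in s, forall i, Pr (b i) <= q} ->
  Pr (fun S => all (b^~ S) s) <= q ^+ size s.
Proof.
move=> p01 us dis bD bq; rewrite (Pr_all us dis bD).
elim: s bq {us dis bD} => [|i s IH] bq; first by rewrite big_nil.
rewrite big_cons /= exprS; apply: ler_pM.
- exact: Pr_ge0.
- by apply: prodr_ge0 => j _; apply: Pr_ge0.
- by apply: bq; rewrite inE eqxx.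
- by apply: IH => j js; apply: bq; rewrite inE js orbT.
Qed.

Lemma Pr_mem x : Pr (fun S => x \in S) = p.
Proof.
have E : Pr (fun S => x \in S) = EE (fun S => (#|S :&: [set x]| == 1%N)%:R).
  apply: eq_Ex => S; congr (_ : bool)%:R; case: (boolP (x \in S)) => xS.
    by rewrite (setIidPr _) ?sub1set // cards1.
  rewrite (_ : S :&: _ = set0) ?cards0 //; apply/setP => y; rewrite !inE.
  by case: eqP => [->|_]; rewrite ?(negbTE xS) ?andbF.
rewrite E /EE (Ex_card p [set x] (fun k => (k == 1%N)%:R)) ?enum_uniq //.
have -> : count (mem [set x]) (enum T) = 1%N.
  by rewrite enumT -(cards1 x) cardE size_filter.
by rewrite /= /BE /=; ring.
Qed.

Lemma dep_mem x : dep [set x] (fun S => x \in S).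
Proof. by move=> S; rewrite !inE eqxx andbT. Qed.

Lemma Pr_mem_and x b : dep (~: [set x]) b -> Pr (fun S => (x \in S) && b S) = p * Pr b.
Proof.
move=> bx; rewrite -[X in X * _](Pr_mem x); apply: Pr_indep (dep_mem x) bx.
by rewrite -setI_eq0 setICr.
Qed.

Lemma Pr_sub (A : {set T}) : Pr (fun S => A \subset S) = p ^+ #|A|.
Proof.
rewrite (_ : Pr _ = Pr (fun S => all (fun x => x \in S) (enum A))); last first.
  apply: eq_Pr => S; apply/subsetP/allP => H x; first by rewrite mem_enum; apply: H.
  by move=> xA; apply: H; rewrite mem_enum.
rewrite (Pr_all (D := fun x => [set x])) ?enum_uniq //.
- by rewrite (eq_bigr (fun=> p)) => [|x _]; rewrite ?Pr_mem // big_const_seq count_predT -cardE iter_mulr_1.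
- by move=> x y _ _ xy; rewrite disjoints1 inE.
- by move=> x _; apply: dep_mem.
Qed.

Lemma Pr_meet0 (A : {set T}) : Pr (fun S => S :&: A == set0) = (1 - p) ^+ #|A|.
Proof.
rewrite (_ : Pr _ = Pr (fun S => all (fun x => x \notin S) (enum A))); last first.
  apply: eq_Pr => S; rewrite setI_eq0 disjoint_sym disjoint_subset.
  apply/subsetP/allP => H x; first by rewrite mem_enum => /H.
  by move=> xA; have := H x; rewrite mem_enum; apply.
rewrite (Pr_all (D := fun x => [set x])) ?enum_uniq //.
- rewrite (eq_bigr (fun=> 1 - p)) => [|x _]; rewrite ?PrN ?Pr_mem //.
  by rewrite big_const_seq count_predT -cardE iter_mulr_1.
- by move=> x y _ _ xy; rewrite disjoints1 inE.
- by move=> x _ S /=; rewrite dep_mem.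
Qed.

End Probability.

(** * Exploration and branching processes *)

Section Reach.
Variables (T : finType) (e : rel T).
Implicit Types (A V X : {set T}).

(** Only the vertices entered have to lie in V. This lets A be the set of active vertices of an
    exploration and V, disjoint from it, the pool still unexplored. *)
Definition reach A V : {set T} :=
  [set y | [exists a in A, connect (fun u v => e u v && (v \in V)) a y]].
Definition nb x : {set T} := [set y | e x y].

Lemma reach0 A V : A \subset reach A V.
Proof. by apply/subsetP => x xA; rewrite inE; apply/existsP; exists x; rewrite xA connect0. Qed.

Lemma reach_step A V x y : x \in reach A V -> e x y -> y \in V -> y \in reach A V.
Proof.
rewrite !inE => /existsP[a /andP[aA ax]] xy yV; apply/existsP; exists a; rewrite aA.
by apply: connect_trans ax (connect1 _); rewrite xy.
Qed.

Lemma reach_min A V X : A \subset X ->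
  (forall x y, x \in X -> e x y -> y \in V -> y \in X) -> reach A V \subset X.
Proof.
move=> AX clX; apply/subsetP => y; rewrite inE => /existsP[a /andP[/(subsetP AX) aX]].
case/connectP => s; elim: s a aX => [|z s IH] a aX /=; first by move=> _ ->.
by case/andP=> /andP[az zV] zs yE; apply: (IH z) => //; apply: clX az zV.
Qed.

Lemma reachS A A' V V' : A \subset reach A' V' -> V \subset V' -> reach A V \subset reach A' V'.
Proof.
move=> AA VV; apply: reach_min => // x y xr xy /(subsetP VV) yV.
exact: reach_step xr xy yV.
Qed.

Lemma reach_subU A V : reach A V \subset A :|: V.
Proof. by apply: reach_min => [|x y _ _ yV]; rewrite ?subsetUl // inE yV orbT. Qed.

Lemma reach_empty V : reach set0 V = set0.
Proof. by apply/eqP; rewrite -subset0; apply: reach_min => // x y; rewrite inE. Qed.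

(** One step of the exploration: the neighbours of a in the pool leave it and become active, and a
    is the only vertex lost from the reachable set. *)
Lemma card_reach_explore A V a : a \in A -> [disjoint A & V] ->
  #|reach A V| = #|reach ((A :\ a) :|: (nb a :&: V)) (V :\: nb a)|.+1.
Proof.
move=> aA AV; set A' := _ :|: _; set V' := _ :\: _.
have aV : a \notin V by rewrite (disjointFr AV).
have aN : a \notin reach A' V'.
  apply: contra aV => /(subsetP (reach_subU _ _)); rewrite !inE eqxx /=.
  by case/orP => /andP[].
rewrite -[RHS]add1n -[1%N in RHS]/(true : nat) -{1}aN -cardsU1; congr #|pred_of_set _|.
apply/eqP; rewrite eqEsubset; apply/andP; split.
  apply: reach_min => [|x y].
    apply/subsetP => x xA; rewrite !in_setU1; case: eqP => //= /eqP xa.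
    by apply: (subsetP (reach0 _ _)); rewrite !inE xa xA.
  rewrite !in_setU1 => /predU1P[->|xr] xy yV; apply/orP; right.
    by apply: (subsetP (reach0 _ _)); rewrite !inE xy yV orbT.
  case: (boolP (e a y)) => ay; first by apply: (subsetP (reach0 _ _)); rewrite !inE ay yV orbT.
  by apply: reach_step xr xy _; rewrite !inE ay yV.
rewrite subUset sub1set (subsetP (reach0 _ _) _ aA) /=.
apply: reachS; last exact: subsetDl.
rewrite subUset; apply/andP; split; first exact: subset_trans (subsetDl _ _) (reach0 _ _).
apply/subsetP => x; rewrite !inE -/(x \in reach A V) => /andP[ax xV].
have := reach_step (subsetP (reach0 A V) _ aA) ax xV; by rewrite inE.
Qed.

End Reach.

Section Exploration.
Local Open Scope ring_scope.
Variables (R : realFieldType) (T : finType) (e : rel T) (p : R).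
Hypothesis p01 : 0 <= p <= 1.
Let p0 : 0 <= p. Proof. by case/andP: p01. Qed.
Let p1 : p <= 1. Proof. by case/andP: p01. Qed.

Lemma iter_BE_shift k (g : nat -> R) c j :
  iter k (BE p) (fun i => g (c + i)%N) j = iter k (BE p) g (c + j)%N.
Proof. by elim: k j => //= k IH j; rewrite /BE !IH addnS. Qed.

Lemma EE_card (D : {set T}) (g : nat -> R) c :
  EE p (fun S => g (c + #|S :&: D|)%N) = iter #|D| (BE p) g c.
Proof.
rewrite /EE (Ex_card p D (fun i => g (c + i)%N)) ?enum_uniq // iter_BE_shift addn0.
by rewrite enumT cardE size_filter.
Qed.

(** The functions s^i are eigenfunctions of [BE p], with eigenvalue 1 - p + p s, the generating
    function of one Bernoulli trial. Both the upper and the lower bound on survival have this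
    shape. *)
Lemma iter_BE_exp k (a b c s u : R) j :
  iter k (BE p) (fun i => a - b * s ^+ i + c * u ^+ i) j =
  a - b * (1 - p + p * s) ^+ k * s ^+ j + c * (1 - p + p * u) ^+ k * u ^+ j.
Proof.
elim: k j => [|k IH] j; first by rewrite /= !expr0; ring.
by rewrite iterS {1}/BE !IH !exprS; ring.
Qed.

Lemma le_iter_BE k (g h : nat -> R) : (forall i, g i <= h i) ->
  forall j, iter k (BE p) g j <= iter k (BE p) h j.
Proof.
move=> gh; elim: k => //= k IH j.
by rewrite /BE lerD // ler_wpM2l // subr_ge0.
Qed.

Lemma iter_BE_ge0 k (g : nat -> R) : (forall i, 0 <= g i) ->
  forall j, 0 <= iter k (BE p) g j.
Proof.
move=> g0; elim: k => //= k IH j.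
by rewrite /BE addr_ge0 // mulr_ge0 // subr_ge0.
Qed.

Lemma iter_BE_nd k (g : nat -> R) : (forall i, g i <= g i.+1) ->
  forall j, iter k (BE p) g j <= iter k (BE p) g j.+1.
Proof.
move=> gh; elim: k => //= k IH j.
by rewrite /BE lerD // ler_wpM2l // subr_ge0.
Qed.

Lemma iter_BE_le k k' (g : nat -> R) j : (forall i, g i <= g i.+1) -> (k <= k')%N ->
  iter k (BE p) g j <= iter k' (BE p) g j.
Proof.
move=> gh /subnK <-; elim: (k' - k)%N => // m IH; apply: le_trans IH _.
rewrite addSn iterS {2}/BE; have := iter_BE_nd (m + k) gh j.
move: (iter _ _ _ _) (iter _ _ _ _) => x y xy.
have h : 0 <= p * (x - y) by rewrite mulr_ge0 // subr_ge0.
by rewrite -subr_ge0 (_ : _ - _ = p * (x - y)) //; ring.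
Qed.

(* The random walk of a branching process with Bin(n, p) offspring, started
   with j active individuals: probability of lasting at least k steps. *)
Fixpoint gw_last n k j : R :=
  match k, j with
  | 0, _ => 1
  | k'.+1, 0 => 0
  | k'.+1, j'.+1 => iter n (BE p) (gw_last n k') j'
  end.

Lemma gw_last_ge0 n k j : 0 <= gw_last n k j.
Proof.
elim: k j => [|k IH] [|j] //=; rewrite ?ler01 //.
exact: iter_BE_ge0.
Qed.

Lemma gw_last_nd n k j : gw_last n k j <= gw_last n k j.+1.
Proof.
elim: k j => [|k IH] [|j] //=; last exact: iter_BE_nd.
exact: (gw_last_ge0 n k.+1 1).
Qed.

(* The right-hand side is a supersolution of the recursion defining gw_last:
   s^j bounds extinction, and th^k u^j the event of dying out only after k steps. *)
Lemma gw_last_le n k j (s u th : R) : 0 <= s -> s <= u -> u <= 1 -> 0 <= th ->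
  s <= (1 - p + p * s) ^+ n -> (1 - p + p * u) ^+ n <= th * u ->
  gw_last n k j <= 1 - s ^+ j + th ^+ k * u ^+ j.
Proof.
move=> s0 su u1 th0 Hs Hu; elim: k j => [|k IH] j.
  rewrite /= expr0 mul1r; have : s ^+ j <= u ^+ j by rewrite lerXn2r // nnegrE // (le_trans s0).
  lra.
case: j => [|j] /=; first by rewrite !expr0 subrr add0r mulr1 exprn_ge0.
apply: le_trans (le_iter_BE n IH j) _.
have E i : 1 - s ^+ i + th ^+ k * u ^+ i = 1 - 1 * s ^+ i + th ^+ k * u ^+ i by rewrite mul1r.
have -> : iter n (BE p) (fun i => 1 - s ^+ i + th ^+ k * u ^+ i) j =
  iter n (BE p) (fun i => 1 - 1 * s ^+ i + th ^+ k * u ^+ i) j.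
  by apply/eqP; rewrite eq_le !le_iter_BE // => i; rewrite E.
rewrite iter_BE_exp mul1r; apply: lerD.
  by rewrite lerD2l lerN2 exprS ler_wpM2r // exprn_ge0.
rewrite [th ^+ k.+1]exprSr [u ^+ j.+1]exprS -!mulrA ler_wpM2l ?exprn_ge0 // mulrA ler_wpM2r //.
by rewrite exprn_ge0 // (le_trans s0).
Qed.

Implicit Types (A U S : {set T}).

Definition reaches k (A U : {set T}) (S : {set T}) : bool := (k <= #|reach e A (S :&: U)|)%N.

Lemma dep_reaches k A U : dep U (reaches k A U).
Proof. by move=> S; rewrite /reaches -setIA setIid. Qed.

(** Processing a inspects S on its unexplored neighbours only; everything else is still fresh. *)
Lemma reaches_mix k A U a S S' : a \in A -> [disjoint A & U] ->
  reaches k.+1 A U (mix (nb e a :&: U) S S') =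
  reaches k ((A :\ a) :|: (S :&: (nb e a :&: U))) (U :\: nb e a) S'.
Proof.
move=> aA AU; rewrite /reaches (card_reach_explore e aA); last first.
  by rewrite disjoint_sym; apply: disjointWl (subsetIr _ _) _; rewrite disjoint_sym.
rewrite ltnS; congr (_ <= #|pred_of_set (reach _ (_ :|: _) _)|)%N.
  by apply/setP => x; rewrite !inE; case: (e a x); case: (x \in U); rewrite ?andbT ?andbF ?orbF.
by apply/setP => x; rewrite !inE; case: (e a x); case: (x \in U); rewrite ?andbT ?andbF ?orbF.
Qed.

Lemma Pr_reaches_explore k A U a : a \in A -> [disjoint A & U] ->
  Pr p (reaches k.+1 A U) =
  EE p (fun S => Pr p (reaches k ((A :\ a) :|: (S :&: (nb e a :&: U))) (U :\: nb e a))).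
Proof.
move=> aA AU; rewrite {1}/Pr /EE (Ex_mix _ _ (nb e a :&: U)); apply: eq_Ex => S.
by apply: eq_Ex => S'; rewrite reaches_mix.
Qed.

Lemma card_active (A U D S : {set T}) a : a \in A -> [disjoint A & U] -> D \subset U ->
  #|(A :\ a) :|: (S :&: D)| = (#|A|.-1 + #|S :&: D|)%N.
Proof.
move=> aA AU DU; rewrite cardsU [#|A|](cardsD1 a) aA /= (_ : (A :\ a) :&: _ = set0) ?cards0 ?subn0 //.
apply/eqP; rewrite setI_eq0; apply: disjointWl (subsetDl _ _) _.
by rewrite disjoint_sym; apply: disjointWl (subset_trans (subsetIr _ _) DU) _; rewrite disjoint_sym.
Qed.

Lemma disjoint_active (A U S : {set T}) a : [disjoint A & U] ->
  [disjoint (A :\ a) :|: (S :&: (nb e a :&: U)) & U :\: nb e a].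
Proof.
move=> AU; rewrite disjoint_subset; apply/subsetP => x; rewrite !inE.
case/orP => [/andP[_ xA]|/andP[_ /andP[-> _]] //].
by rewrite (disjointFr AU xA) andbF.
Qed.

(** Each step adds at most Bin(n, p) active vertices, and [gw_last] is monotone both in the active
    vertices and in the number of trials. *)
Lemma explore_ub n k A U : (forall x, #|nb e x| <= n)%N -> [disjoint A & U] ->
  Pr p (reaches k A U) <= gw_last n k #|A|.
Proof.
move=> deg; elim: k A U => [|k IH] A U AU; first exact: Pr_le1.
have [->|[a aA]] := set_0Vmem A.
  rewrite cards0 /= (_ : Pr _ _ = 0) //; rewrite -(EE_cst T p 0).
  by apply: eq_Ex => S; rewrite /reaches reach_empty cards0.
rewrite (Pr_reaches_explore k aA AU).
have -> : #|A| = #|A|.-1.+1 by rewrite prednK //; apply/card_gt0P; exists a.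
apply: le_trans (_ : EE p (fun S => gw_last n k (#|A|.-1 + #|S :&: (nb e a :&: U)|)) <= _).
  apply: le_EE => // S; rewrite -(card_active _ aA AU (subsetIr _ _)); apply: IH.
  exact: disjoint_active.
rewrite EE_card /=; apply: iter_BE_le; first exact: gw_last_nd.
exact: leq_trans (subset_leq_card (subsetIl _ _)) (deg a).
Qed.

(* With codegrees at most 2, k explored vertices have used up at most 2 k
   neighbours of any other vertex, so d fresh ones always remain. *)
Lemma explore_lb d k A U (s : R) : 0 <= s <= 1 -> (1 - p + p * s) ^+ d <= s ->
  (forall x y, x != y -> #|nb e x :&: nb e y| <= 2)%N ->
  [disjoint A & U] ->
  (forall x, x \in A :|: U -> d + 2 * k <= #|nb e x :&: U|)%N ->
  1 - s ^+ #|A| <= Pr p (reaches k A U).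
Proof.
case/andP=> s0 s1 Hs codeg; elim: k A U => [|k IH] A U AU deg.
  by rewrite (_ : Pr _ _ = 1) ?gerBl ?exprn_ge0 // -[RHS](EE_cst T p 1); apply: eq_Ex => S.
have [->|[a aA]] := set_0Vmem A.
  by rewrite cards0 expr0 subrr Pr_ge0.
rewrite (Pr_reaches_explore k aA AU); set D := nb e a :&: U.
apply: le_trans (_ : EE p (fun S => 1 - s ^+ (#|A|.-1 + #|S :&: D|)) <= _); last first.
  apply: le_EE => // S; rewrite -(card_active _ aA AU (subsetIr _ _)); apply: IH.
    exact: disjoint_active.
  move=> x xAU; have xa : x != a.
    move: xAU; rewrite !inE; case: eqP => [->|//]; rewrite (disjointFr AU aA) /= !andbF.
    by rewrite orbF.
  have xAU' : x \in A :|: U.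
    move: xAU; rewrite !inE; case/orP => [/orP[/andP[_ ->]//|]|/andP[_ ->]]; rewrite ?orbT //.
    by case/andP=> _ /andP[_ ->]; rewrite orbT.
  have := deg _ xAU'; have := codeg _ _ xa.
  have : (#|nb e x :&: U| <= #|nb e x :&: (U :\: nb e a)| + #|nb e x :&: nb e a|)%N.
    rewrite -cardsUI; apply: leq_trans (leq_addr _ _); apply/subset_leq_card/subsetP => y.
    by rewrite !inE => /andP[-> ->]; case: (e a y).
  lia.
rewrite (EE_card D (fun i => 1 - s ^+ i)).
have -> : iter #|D| (BE p) (fun i => 1 - s ^+ i) #|A|.-1 =
  iter #|D| (BE p) (fun i => 1 - 1 * s ^+ i + 0 * s ^+ i) #|A|.-1.
  by apply/eqP; rewrite eq_le !le_iter_BE // => i; rewrite mul1r mul0r addr0.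
rewrite iter_BE_exp !mul0r addr0 mul1r lerD2l lerN2.
have -> : s ^+ #|A| = s * s ^+ #|A|.-1.
  by rewrite -exprS prednK //; apply/card_gt0P; exists a.
rewrite ler_wpM2r ?exprn_ge0 //; apply: le_trans Hs.
have h0 : 0 <= 1 - p + p * s by rewrite addr_ge0 ?mulr_ge0 // subr_ge0.
have h1 : 1 - p + p * s <= 1 by rewrite -lerBrDl opprB addrCA subrr addr0 ler_piMr.
rewrite ler_wiXn2l //; apply: leq_trans (_ : (d + 2 * k.+1) <= _)%N; first exact: leq_addr.
by apply: deg; rewrite inE aA.
Qed.

End Exploration.

(** * Growing components in the cube *)

Section Cube.
Variable n : nat.
Implicit Types (x y z : cube n) (i j : 'I_n).

Definition flip x i : cube n := [ffun j => (j == i) (+) x j].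

Lemma flipE x i j : flip x i j = (j == i) (+) x j. Proof. by rewrite ffunE. Qed.

Lemma flipK i : involutive (flip^~ i).
Proof. by move=> x; apply/ffunP => j; rewrite !flipE addbA addbb. Qed.

Lemma flip_inj x : injective (flip x).
Proof.
move=> i j /ffunP/(_ i); rewrite !flipE eqxx => /addIb; by case: eqP.
Qed.

Lemma cube_adjP x y : reflect (exists i, y = flip x i) (cube_adj x y).
Proof.
rewrite /cube_adj -cardsE; apply: (iffP cards1P) => [[i Ei]|[i ->]]; exists i.
  apply/ffunP => j; rewrite flipE; have := Ei => /setP/(_ j); rewrite !inE => <-.
  by case: (x j) (y j) => [] [].
apply/setP => j; rewrite !inE flipE.
by case: (j == i) (x j) => [] [].
Qed.

Lemma cube_adj_flip x i : cube_adj x (flip x i).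
Proof. by apply/cube_adjP; exists i. Qed.

Lemma cube_adj_sym : symmetric (@cube_adj n).
Proof. by move=> x y; apply/cube_adjP/cube_adjP => [] [i ->]; exists i; rewrite flipK. Qed.

Lemma nb_cubeE x : nb (@cube_adj n) x = [set flip x i | i : 'I_n].
Proof.
apply/setP => y; rewrite inE; apply/cube_adjP/imsetP => [[i ->]|[i _ ->]]; first by exists i.
by exists i.
Qed.

Lemma card_nb_cube x : #|nb (@cube_adj n) x| = n.
Proof. by rewrite nb_cubeE card_imset ?card_ord //; apply: flip_inj. Qed.

(** Let x and y differ at i. A common neighbour must flip i from x or from y, since otherwise its
    value at i would equal both x i and y i. *)
Lemma codeg_cube x y : x != y ->
  #|nb (@cube_adj n) x :&: nb (@cube_adj n) y| <= 2.
Proof.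
move=> xy; have [i xyi] : exists i, x i != y i.
  by apply/existsP; apply: contraNT xy; rewrite negb_exists => /forallP H; apply/eqP/ffunP => i; apply/eqP; rewrite -[_ == _]negbK.
apply: leq_trans (_ : #|[set flip x i; flip y i]| <= 2); last by rewrite cards2; case: eqP.
apply/subset_leq_card/subsetP => z; rewrite !inE => /andP[/cube_adjP[j zj] /cube_adjP[k zk]].
case: (eqVneq j i) => [<-|ji]; first by rewrite zj eqxx.
case: (eqVneq k i) => [<-|ki]; first by rewrite zk eqxx orbT.
have := congr1 (fun f : cube n => f i) (etrans (esym zj) zk).
rewrite /= !flipE eq_sym (negbTE ji) eq_sym (negbTE ki) /= => E.
by rewrite E eqxx in xyi.
Qed.

(** The subcube through x in the first k directions. Coordinates are used up from the left, so
    flipping any direction from k on leads to a disjoint, hence independent, copy. *)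
Definition coset k x : {set cube n} := [set y : cube n | [forall i : 'I_n, (k <= i) ==> (y i == x i)]].

Lemma cosetP k x y : reflect (forall i : 'I_n, k <= i -> y i = x i) (y \in coset k x).
Proof.
rewrite inE; apply: (iffP forallP) => H i; first by move=> ki; apply/eqP; move: (H i); rewrite ki.
by apply/implyP => /H ->.
Qed.

Lemma coset_refl k x : x \in coset k x. Proof. exact/cosetP. Qed.

Lemma coset_eq k x y : y \in coset k x -> coset k y = coset k x.
Proof.
move=> /cosetP yx; apply/setP => z; apply/cosetP/cosetP => H i ki; first by rewrite H ?yx.
by rewrite H ?yx.
Qed.

Lemma coset_le k k' x : k <= k' -> coset k x \subset coset k' x.
Proof. by move=> kk'; apply/subsetP => y /cosetP H; apply/cosetP => i ki; rewrite H // (leq_trans kk'). Qed.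

Lemma flip_coset k x (i : 'I_n) : i < k -> flip x i \in coset k x.
Proof. by move=> ik; apply/cosetP => j kj; rewrite flipE; case: eqP => // ji; rewrite ji leqNgt ik in kj. Qed.

Lemma coset_flip_disjoint k x (i j : 'I_n) : k <= i -> i != j ->
  [disjoint coset k (flip x i) & coset k (flip x j)].
Proof.
move=> ki ij; rewrite disjoint_subset; apply/subsetP => y /cosetP/(_ i ki); rewrite flipE eqxx => yi.
by apply/cosetP => /(_ i ki); rewrite flipE (negbTE ij) yi; case: (x i).
Qed.

Lemma flip_in_coset k x y i : y \in coset k x -> flip y i \in coset k (flip x i).
Proof. by move=> /cosetP H; apply/cosetP => j kj; rewrite !flipE H. Qed.

Lemma coset_flip_notin k k' x y (i : 'I_n) : k <= i -> k' <= i ->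
  y \in coset k (flip x i) -> y \notin coset k' x.
Proof.
move=> ki k'i /cosetP/(_ i ki); rewrite flipE eqxx => yi.
by apply/cosetP => /(_ i k'i); rewrite yi; case: (x i).
Qed.

Lemma coset_flip_sub k k' x (i : 'I_n) : k <= k' -> i < k' -> coset k (flip x i) \subset coset k' x.
Proof.
move=> kk' ik'; apply/subsetP => y /cosetP H; apply/cosetP => j k'j.
rewrite H ?(leq_trans kk') // flipE; case: eqP => // ji; by rewrite ji leqNgt ik' in k'j.
Qed.

Lemma card_ord_itv a b : b <= n -> size [seq i : 'I_n <- enum 'I_n | a <= i < b] = b - a.
Proof.
move=> bn; rewrite -(size_map (@nat_of_ord n)) -(size_iota a (b - a)).
apply/perm_size/uniq_perm; rewrite ?iota_uniq ?map_inj_uniq ?filter_uniq ?enum_uniq //.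
  by rewrite -enumT enum_uniq.
  exact: ord_inj.
move=> j; rewrite mem_iota; apply/mapP/idP => [[i]|H].
  by rewrite mem_filter => /andP[H _] ->; lia.
have jn : j < n by lia.
by exists (Ordinal jn) => //; rewrite mem_filter mem_enum andbT /=; lia.
Qed.

Lemma deg_coset k x : k <= n -> k <= #|nb (@cube_adj n) x :&: coset k x|.
Proof.
move=> kn; rewrite -[X in X <= _]subn0 -(card_ord_itv 0 kn).
rewrite -(size_map (flip x)) -(card_uniqP _); last first.
  by rewrite (map_inj_uniq (@flip_inj x)); apply/filter_uniq/enum_uniq.
apply/subset_leq_card/subsetP => y /mapP[i]; rewrite mem_filter => /andP[/= ik _] ->.
by rewrite !in_setI nb_cubeE imset_f //= flip_coset.
Qed.

End Cube.

(** * Boosting a tree through parallel subcubes *)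

Section Boost.
Local Open Scope ring_scope.
Variables (R : realFieldType) (n : nat) (p s q c : R) (w d K : nat).
Hypothesis p01 : 0 <= p <= 1.
Hypothesis s01 : 0 <= s <= 1.
Hypothesis hs : (1 - p + p * s) ^+ d <= s.
Hypothesis dw : (d + 3 * K + 1 <= w)%N.
Hypothesis c01 : 0 <= c <= 1.
Hypothesis hc : c <= (1 - (1 - p) ^+ K) * q.
Hypothesis hq : q <= (1 - s) * (1 - 2 * (1 - c) ^+ K).

Notation adj := (@cube_adj n).
Notation creaches := (reaches adj).
Implicit Types (x y : cube n) (S Z : {set cube n}).

Let hq' : q <= 1 - s.
Proof.
apply: le_trans hq _; case/andP: s01 => s0 s1; case/andP: c01 => c0 c1.
rewrite ler_piMr ?subr_ge0 // lerBlDr lerDl mulr_ge0 // exprn_ge0 // subr_ge0 //.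
Qed.

(** Z holds vertices examined earlier. Of the w neighbours inside the coset, Z and x spoil at most K
    + 1 and the exploration needs d + 2 K, whence the bound on w. *)
Lemma boost_base x Z : (w <= n)%N -> Z \subset coset w x -> (#|Z| <= K)%N ->
  1 - s <= Pr p (creaches K [set x] ((coset w x :\: Z) :\ x)).
Proof.
move=> wn Zx ZK; rewrite -[s]expr1 -(cards1 x).
apply: (explore_lb _ _ hs) => //.
- exact: codeg_cube.
- by rewrite disjoints1 !inE eqxx.
move=> y yU; have yc : y \in coset w x.
  by move: yU; rewrite in_setU in_set1 in_setD1 in_setD => /orP[/eqP->|/and3P[_ _ ->] //]; exact: coset_refl.
have := deg_coset y wn; rewrite (coset_eq yc) => deg.
have : (#|nb adj y :&: coset w x| <= #|nb adj y :&: ((coset w x :\: Z) :\ x)| + #|Z| + 1)%N.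
  apply: leq_trans (_ : #|(nb adj y :&: ((coset w x :\: Z) :\ x)) :|: Z :|: [set x]| <= _)%N.
    apply/subset_leq_card/subsetP => z; rewrite in_setI => /andP[zy zc].
    rewrite !(in_setU, in_setI, in_setD1, in_setD, in_set1) zy zc andbT /=.
    by case: (z \in Z) (z == x) => [] [].
  rewrite -(cards1 x); apply: leq_trans (leq_card_setU _ _) _; rewrite leq_add2r.
  exact: leq_card_setU.
move: deg dw ZK; move: #|_ :&: coset w x| #|_ :&: (_ :\ x)| #|Z| => a1 a2 a3; clear; lia.
Qed.

Definition shift Z (i : 'I_n) : {set cube n} := [set flip t i | t in Z].

Section Step.
Variables (m k1 : nat).
Hypothesis wk1 : (w <= k1)%N.
Hypothesis IH : forall x Z, Z \subset coset w x -> x \notin Z -> (#|Z| <= K)%N ->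
  q <= Pr p (creaches m [set x] ((coset k1 x :\: Z) :\ x)).

(** The continuation avoids the whole translate of Z, so it is independent of which translated
    vertices are selected. *)
Definition succ x Z i S : bool :=
  [exists y in shift Z i, (y \in S) &&
    creaches m [set y] (coset k1 (flip x i) :\: shift Z i) S].

Lemma shift_sub k x Z i : Z \subset coset k x -> shift Z i \subset coset k (flip x i).
Proof. by move=> /subsetP Zx; apply/subsetP => y /imsetP[t /Zx tx ->]; apply: flip_in_coset. Qed.

Lemma dep_succ x Z i : Z \subset coset w x -> dep (coset k1 (flip x i)) (succ x Z i).
Proof.
move=> Zx S; apply: eq_existsb => y; case: (boolP (y \in shift Z i)) => //= yZ.
rewrite in_setI (subsetP (coset_le _ wk1)) ?andbT; last exact: (subsetP (shift_sub i Zx)).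
congr (_ && _); exact: (dep_sub (subsetDl _ _) (@dep_reaches _ adj m _ _)).
Qed.

Lemma Pr_succ x Z i : Z \subset coset w x -> #|Z| = K -> c <= Pr p (succ x Z i).
Proof.
move=> Zx ZK; apply: le_trans hc _.
have cZ : #|shift Z i| = K by rewrite card_imset //; apply: inv_inj; apply: flipK.
rewrite -{1}cZ -Pr_meet0 -PrN.
apply: le_trans (_ : Pr p (fun S => ~~ (S :&: shift Z i == set0) && succ x Z i S) <= _); last first.
  by apply: (le_Pr p01) => S /andP[].
apply: (Pr_cond p01 (D := shift Z i)) => [S|S /set0Pn[y]]; first by rewrite -setIA setIid.
rewrite in_setI => /andP[yS yZ].
have yc : y \in coset w (flip x i) by apply: (subsetP (shift_sub i Zx)).
(* The other translated vertices have been examined; they form the set that the growth from y must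
   avoid. *)
have := IH (x := y) (Z := shift Z i :\ y).
rewrite (coset_eq yc) (coset_eq (subsetP (coset_le _ wk1) _ yc)).
rewrite (subset_trans (subsetDl _ _) (shift_sub i Zx)) !inE eqxx /=.
have -> : (coset k1 (flip x i) :\: (shift Z i :\ y)) :\ y = coset k1 (flip x i) :\: shift Z i.
  apply/setP => z; rewrite !(in_setD1, in_setD); case: eqP => // ->; by rewrite yZ.
have h : (#|shift Z i :\ y| <= K)%N by rewrite -cZ subset_leq_card // subsetDl.
move=> /(_ isT isT h) H; apply: le_trans H _; apply: (le_Pr p01) => S' H.
apply/existsP; exists y; rewrite yZ /= !inE yS yZ /=.
by rewrite (dep_mix _ _ (@dep_reaches _ adj m _ _)) // disjoint_sym disjoint_subset; apply/subsetP => z; rewrite !inE => ->.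
Qed.

(** Both branches hang on the base tree Z0 by edges in directions i and j, and they lie in disjoint
    cosets, so their sizes add up. *)
Lemma glue x Z Z0 S (i j : 'I_n) :
  Z \subset coset w x -> (k1 <= i)%N -> (k1 <= j)%N ->
  (i < k1 + 2 * K)%N -> (j < k1 + 2 * K)%N -> i != j ->
  Z0 \subset reach adj [set x] (S :&: ((coset w x :\: Z) :\ x)) ->
  Z0 \subset coset w x ->
  succ x Z0 i S -> succ x Z0 j S ->
  creaches (2 * m) [set x] ((coset (k1 + 2 * K) x :\: Z) :\ x) S.
Proof.
move=> Zx ki kj ik jk ij Z0r Z0x.
set U := (coset (k1 + 2 * K) x :\: Z) :\ x.
have sub (l : 'I_n) : (k1 <= l)%N -> (l < k1 + 2 * K)%N -> coset k1 (flip x l) \subset U.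
  move=> kl lk; apply/subsetP => y yl.
  have yw : y \notin coset w x by apply: coset_flip_notin yl => //; apply: leq_trans kl.
  rewrite in_setD1 in_setD (subsetP (coset_flip_sub _ _ lk) _ yl) ?leq_addr // andbT.
  apply/andP; split; first by apply: contraNneq yw => ->; apply: coset_refl.
  by apply: contraNN yw; apply/subsetP.
have wk2 : (w <= k1 + 2 * K)%N by apply: leq_trans wk1 (leq_addr _ _).
have branch (l : 'I_n) : (k1 <= l)%N -> (l < k1 + 2 * K)%N -> succ x Z0 l S ->
    exists A : {set cube n}, [/\ A \subset reach adj [set x] (S :&: U), A \subset coset k1 (flip x l) & (m <= #|A|)%N].
  move=> kl lk /existsP[y /andP[yZ /andP[yS ym]]].
  have yc : y \in coset k1 (flip x l).
    by apply: (subsetP (coset_le _ wk1)); apply: (subsetP (shift_sub l Z0x)).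
  exists (reach adj [set y] (S :&: (coset k1 (flip x l) :\: shift Z0 l))); split; last exact: ym.
    apply: reachS; last by apply: setIS; apply: subset_trans (subsetDl _ _) (sub _ kl lk).
    rewrite sub1set; case/imsetP: yZ => t tZ yt.
    apply: (@reach_step _ _ _ _ t); last first.
    - by rewrite in_setI yS (subsetP (sub _ kl lk)).
    - by rewrite yt cube_adj_flip.
    apply: (subsetP (reachS _ _) _ (subsetP Z0r _ tZ)); first exact: reach0.
    by apply: setIS; apply: setSD; apply: setSD; apply: coset_le.
  apply: subset_trans (reach_subU _ _ _) _; rewrite subUset sub1set yc /=.
  exact: subset_trans (subsetIr _ _) (subsetDl _ _).
move=> /(branch _ ki ik)[A [Ar Ac Am]] /(branch _ kj jk)[B [Br Bc Bm]].
rewrite /reaches; apply: leq_trans (_ : #|A :|: B| <= _)%N; last first.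
  by apply: subset_leq_card; rewrite subUset Ar.
rewrite cardsU (_ : A :&: B = set0) ?cards0; first by move: Am Bm; move: #|A| #|B|; clear; lia.
apply/eqP; rewrite setI_eq0; apply: disjointWl Ac _; apply: disjointWr Bc _.
exact: coset_flip_disjoint.
Qed.

(** One successful direction in each of two blocks gives two distinct directions. *)
Definition block b : seq 'I_n :=
  [seq i : 'I_n <- enum 'I_n | k1 + b * K <= i < k1 + b.+1 * K]%N.

Lemma block_fail x Z0 b : (k1 + b.+1 * K <= n)%N ->
  Z0 \subset coset w x -> #|Z0| = K ->
  Pr p (fun S => all (fun i => ~~ succ x Z0 i S) (block b)) <= (1 - c) ^+ K.
Proof.
move=> bn Z0x Z0K; have -> : K = size (block b) by rewrite card_ord_itv //; clear; lia.
apply: (Pr_all_le (D := fun i => coset k1 (flip x i)) (b := fun i S => ~~ succ x Z0 i S)) => //.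
- by rewrite filter_uniq ?enum_uniq.
- move=> i j; rewrite mem_filter => /andP[/andP[ki _] _] _ ij.
  by apply: coset_flip_disjoint ij; apply: leq_trans (leq_addr _ _) ki.
- by move=> i _ S; rewrite dep_succ.
- by move=> i _; rewrite PrN lerD2l lerN2 Pr_succ.
Qed.

(* K vertices are grown in the base coset; each of 2 K fresh directions i then
   continues from a translate by i of this tree with probability at least c, and
   the translated cosets are disjoint, hence independent. *)
Lemma boost_step x Z : (k1 + 2 * K <= n)%N ->
  Z \subset coset w x -> x \notin Z -> (#|Z| <= K)%N ->
  q <= Pr p (creaches (2 * m) [set x] ((coset (k1 + 2 * K) x :\: Z) :\ x)).
Proof.
move=> kn Zx xZ ZK; set D0 := (coset w x :\: Z) :\ x.
have wn : (w <= n)%N by move: wk1 kn; clear; lia.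
have h0 : 0 <= 1 - 2 * (1 - c) ^+ K \/ 1 - 2 * (1 - c) ^+ K <= 0 by case: (ltrP (1 - 2 * (1 - c) ^+ K) 0) => h; [right; apply: ltW|left].
(* If the second factor of [hq] is not positive, then q <= 0 and the bound is trivial. *)
case: h0 => h0; last first.
  apply: le_trans hq _; apply: le_trans (Pr_ge0 p01 _).
  by rewrite mulr_ge0_le0 // subr_ge0; case/andP: s01.
apply: le_trans hq _.
apply: le_trans (_ : Pr p (creaches K [set x] D0) * (1 - 2 * (1 - c) ^+ K) <= _).
  by rewrite ler_wpM2r // boost_base.
apply: le_trans (_ : Pr p (fun S => creaches K [set x] D0 S &&
   creaches (2 * m) [set x] ((coset (k1 + 2 * K) x :\: Z) :\ x) S) <= _); last first.
  by apply: (le_Pr p01) => S /andP[].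
apply: (Pr_cond p01 (@dep_reaches _ adj K _ D0)) => S HS.
set A := reach adj [set x] (S :&: D0).
(* Exactly K vertices are kept, as [Pr_succ] requires. *)
pose Z0 := [set y in take K (enum A)].
have Z0K : #|Z0| = K.
  rewrite cardsE (card_uniqP _) ?take_uniq ?enum_uniq // size_takel // -cardE; exact: HS.
have Z0A : Z0 \subset A.
  by apply/subsetP => y; rewrite inE => /mem_take; rewrite mem_enum.
have Z0x : Z0 \subset coset w x.
  apply: subset_trans Z0A _; apply: subset_trans (reach_subU _ _ _) _.
  rewrite subUset sub1set coset_refl /=; apply: subset_trans (subsetIr _ _) _.
  exact: subset_trans (subsetDl _ _) (subsetDl _ _).
pose F b S' := all (fun i => ~~ succ x Z0 i S') (block b).
apply: le_trans (_ : 1 - Pr p (fun S' => F 0%N S' || F 1%N S') <= _).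
  rewrite lerD2l lerN2; apply: le_trans (Pr_or p01 _ _) _.
  by rewrite mulr2n mulrDl mul1r lerD // block_fail //; move: kn; clear; lia.
rewrite -PrN; apply: (le_Pr p01) => S'; rewrite negb_or => /andP[].
rewrite -!has_predC => /hasP[i ib] /negPn si /hasP[j jb] /negPn sj.
move: ib jb; rewrite !mem_filter => /andP[ib _] /andP[jb _].
have ki : (k1 <= i)%N by move: ib; clear; lia.
have kj : (k1 <= j)%N by move: jb; clear; lia.
have disj (l : 'I_n) : (k1 <= l)%N -> [disjoint coset k1 (flip x l) & D0].
  move=> kl; rewrite disjoint_subset; apply/subsetP => y yl; change (y \notin D0).
  have : y \notin coset w x by apply: coset_flip_notin yl => //; apply: leq_trans kl.
  by apply: contraNN; rewrite in_setD1 in_setD => /and3P[].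
have ik : (i < k1 + 2 * K)%N by move: ib; clear; lia.
have jk : (j < k1 + 2 * K)%N by move: jb; clear; lia.
have ij : i != j by apply/eqP => ij; move: ib jb; rewrite ij; clear; lia.
have Z0r : Z0 \subset reach adj [set x] (mix D0 S S' :&: D0) by rewrite mixI.
have si' : succ x Z0 i (mix D0 S S') by rewrite (dep_mix _ _ (dep_succ i Z0x)) // disj.
have sj' : succ x Z0 j (mix D0 S S') by rewrite (dep_mix _ _ (dep_succ j Z0x)) // disj.
exact: (glue Zx ki kj ik jk ij Z0r Z0x si' sj').
Qed.

End Step.

(** The bound q does not decay with the rounds, because [hc] and [hq] make it reproduce itself: c
    accounts for one translate being hit and growing with probability q, and two blocks of K
    directions fail with probability at most 2 (1 - c)^K. A round costs 2 K coordinates. *)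
Lemma boost r x Z : (w + 2 * r * K <= n)%N ->
  Z \subset coset w x -> x \notin Z -> (#|Z| <= K)%N ->
  q <= Pr p (creaches (2 ^ r * K) [set x] ((coset (w + 2 * r * K) x :\: Z) :\ x)).
Proof.
elim: r x Z => [|r IH] x Z wn Zx xZ ZK.
  by rewrite muln0 mul0n addn0 mul1n; apply: le_trans hq' _; apply: boost_base => //; move: wn; clear; lia.
have E : (w + 2 * r.+1 * K = (w + 2 * r * K) + 2 * K)%N by clear; lia.
rewrite E in wn *; rewrite expnS -mulnA; apply: boost_step => //.
  exact: leq_addr.
by move=> y Y *; apply: IH => //; move: wn; clear; lia.
Qed.

End Boost.

(** * Components and the vertices in large ones *)

Section Components.
Variable n : nat.
Implicit Types (x y z v : cube n) (S : {set cube n}).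
Notation adj := (@cube_adj n).

(** A walk never has to re-enter x, so x can leave the pool; this gives the disjointness that the
    exploration lemmas ask for. *)
Lemma comp_reach S x : x \in S -> comp S x = reach adj [set x] (S :\ x).
Proof.
move=> xS; apply/eqP; rewrite eqEsubset; apply/andP; split.
  have key s u : u \in reach adj [set x] (S :\ x) -> path (induced_adj S) u s ->
      last u s \in reach adj [set x] (S :\ x).
    elim: s u => //= z s IH u ur /andP[/and3P[uS zS uz]]; apply: IH.
    have [->|zx] := eqVneq z x; first by apply: (subsetP (reach0 _ _ _)); rewrite inE.
    by apply: reach_step ur uz _; rewrite in_setD1 zx.
  apply/subsetP => y; rewrite inE => /connectP[s xs ->]; apply: key xs.
  by apply: (subsetP (reach0 _ _ _)); rewrite inE.
apply: reach_min => [|u z]; first by rewrite sub1set inE connect0.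
rewrite !inE => xu uz /andP[_ zS]; have xu' := xu; apply: connect_trans xu' (connect1 _).
rewrite /induced_adj uz zS !andbT.
case/connectP: xu => s; case/lastP: s => [_ ->|s t] //.
by rewrite rcons_path last_rcons => /andP[_ /and3P[_ tS _]] ->.
Qed.

Lemma connect_induced_sym S : connect_sym (induced_adj S).
Proof.
by apply: sym_connect_sym => x y; rewrite /induced_adj cube_adj_sym andbCA.
Qed.

Lemma comp_sym S x y : (y \in comp S x) = (x \in comp S y).
Proof. by rewrite !inE connect_induced_sym. Qed.

Lemma comp_refl S x : x \in comp S x. Proof. by rewrite inE connect0. Qed.

Lemma comp_eq S x y : y \in comp S x -> comp S y = comp S x.
Proof.
rewrite inE => xy; apply/setP => z; rewrite !inE.
by rewrite -(same_connect (connect_induced_sym S) xy).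
Qed.

Lemma comp_subS S x : x \in S -> comp S x \subset S.
Proof.
move=> xS; rewrite comp_reach //; apply: subset_trans (reach_subU _ _ _) _.
by rewrite subUset sub1set xS subsetDl.
Qed.

Lemma comp_step S x y z : y \in comp S x -> y \in S -> z \in S -> adj y z -> z \in comp S x.
Proof.
rewrite !inE => xy yS zS yz; apply: connect_trans xy (connect1 _).
by rewrite /induced_adj yS zS.
Qed.

Lemma comp_min S x (X : {set cube n}) : x \in X ->
  (forall y z, y \in X -> y \in S -> z \in S -> adj y z -> z \in X) -> comp S x \subset X.
Proof.
move=> xX cl; apply/subsetP => y; rewrite inE => /connectP[s].
elim: s x xX => [|z s IH] x xX /=; first by move=> _ ->.
by case/andP=> /and3P[xS zS xz] zs yE; apply: (IH z) => //; apply: cl xX xS zS xz.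
Qed.

Lemma compS S S' x : S \subset S' -> comp S x \subset comp S' x.
Proof.
move=> /subsetP SS; apply: comp_min; first exact: comp_refl.
by move=> y z yx /SS yS /SS zS; apply: comp_step.
Qed.

Definition large L S : {set cube n} := [set x in S | L <= #|comp S x|].

Lemma largeP L S x : reflect (x \in S /\ L <= #|comp S x|) (x \in large L S).
Proof. by rewrite inE; apply: andP. Qed.

Lemma largeS L S S' : S \subset S' -> large L S \subset large L S'.
Proof.
move=> SS; apply/subsetP => x /largeP[xS Lx]; apply/largeP; split; first exact: (subsetP SS).
exact: leq_trans Lx (subset_leq_card (compS _ SS)).
Qed.

Lemma large_comp L S x y : x \in large L S -> y \in comp S x -> y \in large L S.
Proof.
move=> /largeP[xS Lx] yx; apply/largeP; split; last by rewrite (comp_eq yx).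
exact: (subsetP (comp_subS xS)).
Qed.

Lemma large_reaches L S x (D : {set cube n}) : x \in S -> reaches adj L [set x] (D :\ x) S ->
  x \in large L S.
Proof.
move=> xS H; apply/largeP; split => //; apply: leq_trans H _; rewrite comp_reach //.
apply: subset_leq_card; apply: reachS; first exact: reach0.
by apply/subsetP => y; rewrite !inE => /and3P[-> -> _].
Qed.

Lemma reaches_large L S x : x \in large L S -> reaches adj L [set x] ([set: cube n] :\ x) S.
Proof.
move=> /largeP[xS]; rewrite comp_reach // /reaches => H; apply: leq_trans H _.
apply: subset_leq_card; apply: reachS; first exact: reach0.
by apply/subsetP => y; rewrite !inE => /andP[-> ->].
Qed.

Lemma reaches_le k k' (A U S : {set cube n}) : k <= k' -> reaches adj k' A U S -> reaches adj k A U S.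
Proof. exact: leq_trans. Qed.

(* Adding one vertex v only promotes vertices of the at most n small
   components adjacent to v. *)
Lemma large_lipschitz L S v : #|large L (v |: S)| <= #|large L S| + (1 + n * L).
Proof.
pose small z : {set cube n} := if (z \in S) && (#|comp S z| < L) then comp S z else set0.
have H : large L (v |: S) \subset large L S :|: (v |: \bigcup_(z in nb adj v) small z).
  apply/subsetP => x /largeP[xvS Lx]; rewrite !in_setU in_set1.
  have [//|xv] := eqVneq x v; first by rewrite orbT.
  have xS : x \in S by move: xvS; rewrite in_setU1 (negbTE xv).
  case: (leqP L #|comp S x|) => small_x.
    by rewrite (introT (largeP _ _ _)).
  suff [z /andP[zx zv]] : exists z, (z \in comp S x) && adj v z.
    apply/orP; right; apply/orP; right; apply/bigcupP; exists z; first by rewrite inE.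
    rewrite /small (subsetP (comp_subS xS)) // (comp_eq zx) small_x /=; exact: comp_refl.
  apply/existsP; apply: contraLR small_x; rewrite negb_exists -leqNgt => /forallP no.
  apply: leq_trans Lx _; apply: subset_leq_card; apply: comp_min; first exact: comp_refl.
  move=> y z yx yvS; have yS := subsetP (comp_subS xS) _ yx.
  rewrite in_setU1 => /predU1P[->|zS] yz; last exact: comp_step yz.
  by have := no y; rewrite yx cube_adj_sym yz.
apply: leq_trans (subset_leq_card H) _; apply: leq_trans (leq_card_setU _ _) _.
rewrite leq_add2l; apply: leq_trans (leq_card_setU _ _) _; rewrite cards1 leq_add2l.
rewrite -[X in _ <= X * L](card_nb_cube v) -sum_nat_const.
apply: leq_trans (_ : \sum_(z in nb adj v) #|small z| <= _).
  elim/big_ind2: _ => [|A a B b Aa Bb|//]; first by rewrite cards0.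
  by apply: leq_trans (leq_card_setU _ _) _; rewrite leq_add.
apply: leq_sum => z _; rewrite /small; case: ifP => [/andP[_ /ltnW]//|_]; by rewrite cards0.
Qed.

End Components.

Section LargeProbability.
Local Open Scope ring_scope.
Variables (R : realFieldType) (n : nat).
Implicit Types (x y : cube n) (S : {set cube n}).
Notation adj := (@cube_adj n).

Lemma Pr_large_ub (p : R) K x : 0 <= p <= 1 ->
  Pr p (fun S => x \in large K S) <= p * gw_last p n K 1.
Proof.
move=> p01; apply: le_trans (_ : Pr p (fun S => (x \in S) && reaches adj K [set x] ([set: cube n] :\ x) S) <= _).
  by apply: (le_Pr p01) => S xl; rewrite (reaches_large xl) andbT; case/largeP: xl.
rewrite Pr_mem_and; last first.
  by apply: dep_sub (dep_reaches _ _ _ _); rewrite setTD.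
apply: ler_wpM2l; first by case/andP: p01.
rewrite -(cards1 x); apply: (explore_ub p01); first by move=> y; rewrite card_nb_cube.
by rewrite disjoints1 !inE eqxx.
Qed.

Lemma EE_large (p : R) L :
  EE p (fun S => #|large L S|%:R) = \sum_(x : cube n) Pr p (fun S => x \in large L S).
Proof.
rewrite /Pr /EE -Ex_sum; apply: eq_Ex => S.
by rewrite -natr_sum -sum1_card big_mkcond /=; congr (_%:R); apply: eq_bigr => x _; case: (x \in _).
Qed.

Lemma card_cube : #|cube n| = (2 ^ n)%N.
Proof. by rewrite card_ffun card_bool card_ord. Qed.

Lemma large_concentration (p a : R) L : 0 <= p <= 1 -> 0 < a ->
  Pr p (fun S : {set cube n} => a <= `|#|large L S|%:R - EE p (fun S => #|large L S|%:R)|)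
  <= p * (1 + n%:R * L%:R) ^+ 2 * 2 ^+ n / a ^+ 2.
Proof.
move=> p01 a0; rewrite -natrX -card_cube; apply: (Chebyshev p01 a0) => v S.
have l1 := large_lipschitz L S v.
have l2 : (#|large L S| <= #|large L (v |: S)|)%N.
  by apply/subset_leq_card/largeS; apply: subsetUr.
by rewrite -natrB // -natrM nat1r -!natrX ler_nat leq_exp2r // leq_subLR -add1n.
Qed.

Section LowerBound.
Variables (p s q c : R) (w d K : nat).
Hypothesis p01 : 0 <= p <= 1.
Hypothesis s01 : 0 <= s <= 1.
Hypothesis hs : (1 - p + p * s) ^+ d <= s.
Hypothesis dw : (d + 3 * K + 1 <= w)%N.
Hypothesis c01 : 0 <= c <= 1.
Hypothesis hc : c <= (1 - (1 - p) ^+ K) * q.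
Hypothesis hq : q <= (1 - s) * (1 - 2 * (1 - c) ^+ K).
Variables (h L : nat).
Hypothesis LK : (L <= 2 ^ h * K)%N.

(** A local form of membership in a large component: it depends on the coset of x only, so it is
    independent over disjoint cosets. *)
Definition grows x S : bool :=
  (x \in S) && reaches adj L [set x] (coset (w + 2 * h * K) x :\ x) S.

Lemma dep_grows x : dep (coset (w + 2 * h * K) x) (grows x).
Proof.
move=> S; rewrite /grows in_setI coset_refl andbT; congr (_ && _).
exact: (dep_sub (subsetDl _ _) (@dep_reaches _ adj L _ _)).
Qed.

Lemma Pr_grows x : (w + 2 * h * K <= n)%N -> p * q <= Pr p (grows x).
Proof.
move=> wn; rewrite Pr_mem_and; last first.
  by apply: dep_sub (dep_reaches _ _ _ _); apply/subsetP => y; rewrite !inE => /andP[].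
apply: ler_wpM2l; first by case/andP: p01.
apply: le_trans (_ : Pr p (reaches adj (2 ^ h * K) [set x] ((coset (w + 2 * h * K) x :\: set0) :\ x)) <= _).
  by apply: (boost p01 s01 hs dw c01 hc hq wn); rewrite ?sub0set ?inE ?cards0.
rewrite setD0; apply: (le_Pr p01) => S; exact: reaches_le LK.
Qed.

Lemma grows_large x S : grows x S -> x \in large L S.
Proof. by case/andP => xS; apply: large_reaches. Qed.

Lemma Pr_large_lb x : (w + 2 * h * K <= n)%N -> p * q <= Pr p (fun S => x \in large L S).
Proof.
move=> wn; apply: le_trans (Pr_grows x wn) _.
by apply: (le_Pr p01) => S; apply: grows_large.
Qed.

Lemma EE_large_lb : (w + 2 * h * K <= n)%N ->
  2 ^+ n * (p * q) <= EE p (fun S : {set cube n} => #|large L S|%:R).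
Proof.
move=> wn; rewrite EE_large -natrX -card_cube mulr_natl -sumr_const.
by apply: ler_sum => x _; apply: Pr_large_lb.
Qed.

Definition covered x S : bool := [exists i, exists j, flip (flip x i) j \in large L S].

(** Flipping one direction from each of two fresh blocks leads to K^2 vertices with pairwise
    disjoint cosets, and each of them grows independently with probability at least p q. *)
Lemma Pr_uncovered x : (w + 2 * h * K + 2 * K <= n)%N ->
  Pr p (fun S => ~~ covered x S) <= (1 - p * q) ^+ (K * K).
Proof.
set k := (w + 2 * h * K)%N => kn.
have wn : (w + 2 * h * K <= n)%N by apply: leq_trans kn; apply: leq_addr.
pose B b : seq 'I_n := block n K k b.
pose s2 := [seq (i, j) | i <- B 0%N, j <- B 1%N].
have sB b : (k + b.+1 * K <= n)%N -> size (B b) = K.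
  by move=> bn; rewrite card_ord_itv //; clear; lia.
have -> : (K * K)%N = size s2.
  by rewrite size_allpairs !sB //; move: kn; clear; lia.
pose X (ij : 'I_n * 'I_n) := flip (flip x ij.1) ij.2.
have inB b i : i \in B b -> (k + b * K <= i < k + b.+1 * K)%N.
  by rewrite mem_filter => /andP[].
apply: le_trans (_ : Pr p (fun S => all (fun ij => ~~ grows (X ij) S) s2) <= _).
  apply: (le_Pr p01) => S; rewrite /covered => /existsPn H; apply/allP => ij _.
  have /existsPn/(_ ij.2) := H ij.1; apply: contraNN; exact: grows_large.
apply: (Pr_all_le (D := fun ij => coset k (X ij)) (b := fun ij S => ~~ grows (X ij) S)) => //.
- apply: allpairs_uniq; try exact/filter_uniq/enum_uniq.
  by move=> [? ?] [? ?].
- move=> _ _ /allpairsP[[i j] [/= /inB iB /inB jB ->]] /allpairsP[[i' j'] [/= /inB iB' /inB jB' ->]] ne.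
  rewrite /X /=; case: (eqVneq i i') => [ii|ii'].
    rewrite -ii; apply: coset_flip_disjoint; first by move: jB; clear; lia.
    by apply: contra_neq ne => ->; rewrite ii.
  have ki : (k <= i)%N by move: iB; clear; lia.
  have ij : (i == j) = false by apply/eqP => E; move: iB jB; rewrite E; clear; lia.
  have ij' : (i == j') = false by apply/eqP => E; move: iB jB'; rewrite E; clear; lia.
  rewrite disjoint_subset; apply/subsetP => y /cosetP/(_ i ki).
  rewrite !flipE eqxx ij /= => yi; apply/cosetP => /(_ i ki).
  by rewrite !flipE (negbTE ii') ij' yi /=; case: (x i).
- by move=> ij _ S; rewrite dep_grows.
- by move=> ij _; rewrite PrN lerD2l lerN2 Pr_grows.
Qed.

End LowerBound.
End LargeProbability.

(** * Isoperimetry and sprinkling *)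

(** Take a maximal disjoint subfamily. Every F z meets one of its members in one of at most m
    points, and each point is in at most d sets. *)
Lemma greedy_disjoint (I T : finType) (Z : {set I}) (F : I -> {set T}) (m d : nat) :
  (forall z, z \in Z -> 0 < #|F z| <= m) ->
  (forall y, #|[set z in Z | y \in F z]| <= d) ->
  exists Z0 : {set I}, [/\ Z0 \subset Z,
    {in Z0 &, forall z z', z != z' -> [disjoint F z & F z']} & #|Z| <= #|Z0| * (m * d)].
Proof.
move=> Fm Fd.
pose P (Z0 : {set I}) := (Z0 \subset Z) &&
  [forall z in Z0, forall z' in Z0, (z != z') ==> [disjoint F z & F z']].
have P0 : exists Z0, P Z0.
  by exists set0; rewrite /P sub0set; apply/forall_inP => z; rewrite inE.
have [Z0 /maxsetP[/andP[Z0Z dis] mx]] := ex_maxset P0.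
have {}dis : {in Z0 &, forall z z', z != z' -> [disjoint F z & F z']}.
  by move=> z z' zZ z'Z zz'; apply: (implyP (forall_inP (forall_inP dis z zZ) z' z'Z)).
exists Z0; split => //.
have cov : Z \subset \bigcup_(z0 in Z0) \bigcup_(y in F z0) [set z in Z | y \in F z].
  apply/subsetP => z zZ.
  suff [z0 z0Z /pred0Pn[y /andP[/= yz yz0]]] : exists2 z0, z0 \in Z0 & ~~ [disjoint F z & F z0].
    by apply/bigcupP; exists z0 => //; apply/bigcupP; exists y => //; rewrite inE zZ.
  case: (boolP (z \in Z0)) => [zZ0|zZ0].
    exists z => //; have /andP[/card_gt0P[y yz] _] := Fm z zZ.
    by apply/pred0Pn; exists y; rewrite /= yz.
  apply/exists_inP; apply: contraNT zZ0; rewrite negb_exists => /forallP H.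
  have {}H z0 : z0 \in Z0 -> [disjoint F z & F z0].
    by move=> z0Z; move: (H z0); rewrite z0Z /= negbK.
  rewrite -(mx (z |: Z0)) ?setU11 ?subsetUr //.
  rewrite /P subUset sub1set zZ Z0Z /=; apply/forall_inP => z1 z1Z; apply/forall_inP => z2 z2Z.
  apply/implyP; move: z1Z z2Z; rewrite !in_setU1 => /predU1P[->|z1Z] /predU1P[->|z2Z].
  - by rewrite eqxx.
  - by move=> _; apply: H.
  - by move=> _; rewrite disjoint_sym; apply: H.
  - exact: dis.
apply: leq_trans (subset_leq_card cov) _.
have card_bigcup (J : finType) (Q : {set J}) (E : J -> {set I}) (k : nat) :
    (forall j, j \in Q -> #|E j| <= k) -> #|\bigcup_(j in Q) E j| <= #|Q| * k.
  move=> Ek; rewrite -sum_nat_const; apply: leq_trans (leq_sum _ Ek).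
  elim/big_ind2: _ => [|A a B b Aa Bb|//]; first by rewrite cards0.
  by apply: leq_trans (leq_card_setU _ _) _; rewrite leq_add.
apply: (card_bigcup) => z0 z0Z; apply: leq_trans (card_bigcup _ _ _ d _) _ => //.
by rewrite leq_mul2r; have /andP[_ ->] := Fm z0 (subsetP Z0Z _ z0Z); rewrite orbT.
Qed.

Section Isoperimetry.
Variable n : nat.
Implicit Types (x y : cube n) (X : {set cube n}).

Definition exit X (i : 'I_n) : {set cube n} := [set x in X | flip x i \notin X].

Definition flips x (l : seq 'I_n) : cube n := foldl (@flip n) x l.

Lemma flipsE x l j : uniq l -> flips x l j = (j \in l) (+) x j.
Proof.
elim: l x => //= i l IH x /andP[il ul]; rewrite IH // flipE inE.
by case: eqP => [->|_] //=; rewrite (negbTE il).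
Qed.

Lemma card_exit_flips X l :
  #|[set x in X | flips x l \notin X]| <= \sum_(i <- l) #|exit X i|.
Proof.
elim: l => [|i l IH]; first by rewrite (_ : finset _ = set0) ?cards0 //; apply/setP => x; rewrite !inE; case: (x \in X).
rewrite big_cons; apply: leq_trans (_ : #|exit X i :|: (fun x : cube n => flip x i) @^-1: [set x in X | flips x l \notin X]| <= _).
  apply/subset_leq_card/subsetP => x; rewrite !inE /= => /andP[-> ->].
  by case: (flip x i \in X).
apply: leq_trans (leq_card_setU _ _) _; rewrite leq_add2l; apply: leq_trans IH.
by rewrite card_preimset //; apply: inv_inj; apply: flipK.
Qed.

(* Average over all translates: x in X and x + z outside X forces the path
   flipping the coordinates of z one at a time to leave X. *)
Lemma isoperimetry X : #|X| * #|~: X| <= 2 ^ n * \sum_i #|exit X i|.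
Proof.
pose diff (xy : cube n * cube n) : {set 'I_n} := [set i | xy.1 i != xy.2 i].
rewrite -cardsX -sum1_card (partition_big diff predT) //=.
have -> : 2 ^ n = #|{set 'I_n}| by rewrite -cardsT -powersetT card_powerset cardsT card_ord.
rewrite -sum_nat_const; apply: leq_sum => A _.
rewrite sum1_card.
apply: leq_trans (_ : \sum_(i <- enum A) #|exit X i| <= _); last first.
  rewrite big_enum /= [leqRHS](bigID (mem A)) /=; exact: leq_addr.
apply: leq_trans (card_exit_flips _ _).
have inj : {in [pred i in setX X (~: X) | diff i == A] &, injective fst}.
  move=> [x y] [x' y'] /andP[_ /eqP/setP d1] /andP[_ /eqP/setP d2] /= xx'; rewrite -xx' in d2 *.
  congr pair; apply/ffunP => j; have := d1 j; have := d2 j; rewrite !inE /=.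
  by move=> <-; case: (x j) (y j) (y' j) => [] [] [].
rewrite -(card_in_image inj); apply/subset_leq_card/subsetP => x /imageP[[x' y]].
rewrite !inE /= => /andP[/andP[xX yX] /eqP dA] ->; rewrite xX /=.
suff -> : flips x' (enum A) = y by [].
apply/ffunP => j; rewrite flipsE ?enum_uniq // mem_enum -dA inE /=.
by case: (x' j) (y j) => [] [].
Qed.

(** The larger of X and its complement fills at least half of the cube, so twice the product of
    their sizes is at least 2^n b. *)
Lemma isoperimetry_min X b : b <= #|X| -> b <= #|~: X| -> b <= 2 * \sum_i #|exit X i|.
Proof.
move=> bX bC; have := isoperimetry X; move: (\sum_i _) => B H.
have := cardsC X; rewrite card_cube => E.
have n0 : 0 < 2 ^ n by rewrite expn_gt0.
rewrite -(leq_pmul2l n0) mulnCA.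
apply: leq_trans (_ : 2 * (#|X| * #|~: X|) <= _); last by rewrite leq_mul2l.
case: (leqP #|X| #|~: X|) => XC.
  apply: leq_trans (_ : (2 * #|~: X|) * b <= _).
    by rewrite leq_mul2r -E; apply/orP; right; lia.
  by rewrite -mulnA leq_mul2l [X in _ <= X]mulnC leq_mul2l bX !orbT.
apply: leq_trans (_ : (2 * #|X|) * b <= _).
  by rewrite leq_mul2r -E; apply/orP; right; lia.
by rewrite -mulnA leq_mul2l leq_mul2l bC !orbT.
Qed.

End Isoperimetry.

(** * Short paths between two sets of vertices *)

Section Paths.
Variable n : nat.
Implicit Types (x y : cube n) (A B S : {set cube n}).
Notation adj := (@cube_adj n).

(** [None] stands for a degenerate middle edge, at a vertex near both sets. *)
Definition oflip x (o : option 'I_n) : cube n := if o is Some i then flip x i else x.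

Lemma oflipK o : involutive (oflip^~ o).
Proof. by case: o => [i|] x //=; rewrite flipK. Qed.

Definition near A : {set cube n} := [set x | [exists i, exists j, flip (flip x i) j \in A]].

Definition mid A x : cube n :=
  if [pick i | [exists j, flip (flip x i) j \in A]] is Some i then flip x i else x.

Lemma mid_oflip A x : exists o, mid A x = oflip x o.
Proof. by rewrite /mid; case: pickP => [i _|_]; [exists (Some i)|exists None]. Qed.

Lemma mid_near A x S : A \subset S -> x \in near A -> x \in S -> mid A x \in S ->
  exists2 a, a \in A & x \in comp S a.
Proof.
move=> AS; rewrite inE => /existsP[i0 H0] xS; rewrite /mid.
case: pickP => [i /existsP[j ijA]|/(_ i0)]; last by rewrite H0.
move=> iS; exists (flip (flip x i) j) => //.
apply: (comp_step (y := flip x i)) => //.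
  apply: (comp_step (comp_refl _ _)) => //; first exact: (subsetP AS).
  by rewrite cube_adj_sym cube_adj_flip.
by rewrite cube_adj_sym cube_adj_flip.
Qed.

(** A path is coded by its middle edge alone; [mid] supplies the inner vertices next to A and to
    B. *)
Definition paths A B : {set cube n * option 'I_n} :=
  [set z | (z.1 \in near A) && (oflip z.1 z.2 \in near B)].

Definition inner A B (z : cube n * option 'I_n) : {set cube n} :=
  [set z.1; mid A z.1; oflip z.1 z.2; mid B (oflip z.1 z.2)].

Lemma inner_connects A B S z : A \subset S -> B \subset S -> z \in paths A B ->
  inner A B z \subset S -> exists a b, [/\ a \in A, b \in B & b \in comp S a].
Proof.
move=> AS BS; rewrite inE => /andP[zA zB] zS.
have inS y : y \in inner A B z -> y \in S by apply: (subsetP zS).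
have x1 : z.1 \in S by apply: inS; rewrite !inE eqxx.
have x2 : mid A z.1 \in S by apply: inS; rewrite !inE eqxx ?orbT.
have x3 : oflip z.1 z.2 \in S by apply: inS; rewrite !inE eqxx ?orbT.
have x4 : mid B (oflip z.1 z.2) \in S by apply: inS; rewrite !inE eqxx ?orbT.
have [a aA xa] := mid_near AS zA x1 x2; have [b bB xb] := mid_near BS zB x3 x4.
exists a, b; split => //; rewrite comp_sym.
rewrite -(comp_eq xb) (_ : comp S (oflip z.1 z.2) = comp S a); last first.
  rewrite -(comp_eq xa); apply: comp_eq; case: z.2 x3 => [i|] /= x3; last exact: comp_refl.
  by apply: (comp_step (comp_refl _ _)) => //; apply: cube_adj_flip.
exact: comp_refl.
Qed.

Lemma card_inner A B z : 0 < #|inner A B z| <= 4.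
Proof.
apply/andP; split; first by apply/card_gt0P; exists z.1; rewrite !inE eqxx.
by rewrite /inner -!setUA !cardsU1 cards1; do 3!case: (_ \notin _).
Qed.

(** At most two optional flips lead from an inner vertex back to z.1, and z.2 is a third choice
    among n + 1. *)
Lemma inner_degree A B y : #|[set z in paths A B | y \in inner A B z]| <= n.+1 ^ 3.
Proof.
pose O := option 'I_n.
pose g (o : O * O * O) := (oflip (oflip y o.1.1) o.1.2, o.2).
apply: leq_trans (_ : #|[set g o | o in [set: O * O * O]]| <= _); last first.
  apply: leq_trans (leq_imset_card _ _) _.
  by rewrite cardsT !card_prod card_option card_ord; lia.
apply/subset_leq_card/subsetP => -[x o]; rewrite in_set => /andP[_ H].
suff [o1 [o2 E]] : exists o1 o2, x = oflip (oflip y o1) o2.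
  by apply/imsetP; exists (o1, o2, o); rewrite ?inE // /g /= -E.
have [a Ea] := mid_oflip A x; have [b Eb] := mid_oflip B (oflip x o).
move: H; rewrite /inner /= Ea Eb !inE => /orP[/orP[/orP[]|]|] /eqP ->.
- by exists None, None.
- by exists a, None; rewrite /= oflipK.
- by exists o, None; rewrite /= oflipK.
- by exists b, o; rewrite !oflipK.
Qed.

Lemma sub_near A : 0 < n -> A \subset near A.
Proof.
move=> n0; apply/subsetP => x xA; rewrite inE; apply/existsP; exists (Ordinal n0).
by apply/existsP; exists (Ordinal n0); rewrite flipK.
Qed.

(** If the two neighbourhoods X and Y share t / 2 vertices, these are degenerate paths. Otherwise
    isoperimetry is applied to the difference of X and Y: an edge leaving it either enters Y, and is
    a path, or ends outside both. *)
Lemma many_paths A B t : 0 < n -> t <= #|A| -> t <= #|B| ->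
  t <= 4 * (#|paths A B| + n * #|~: (near A :|: near B)|).
Proof.
move=> n0 tA tB; set X := near A; set Y := near B.
have tX : t <= #|X| by apply: leq_trans tA (subset_leq_card (sub_near _ n0)).
have tY : t <= #|Y| by apply: leq_trans tB (subset_leq_card (sub_near _ n0)).
case: (leqP t (2 * #|X :&: Y|)) => XY.
  apply: leq_trans XY _; apply: leq_trans (_ : 4 * #|paths A B| <= _); last by rewrite leq_mul2l leq_addr.
  apply: leq_trans (_ : 2 * #|paths A B| <= _); last by rewrite leq_mul2r orbT.
  have inj : injective (fun x : cube n => (x, None : option 'I_n)) by move=> x y [].
  rewrite leq_mul2l /= -(card_imset _ inj).
  apply/subset_leq_card/subsetP => z /imsetP[x]; rewrite inE => /andP[xX xY] ->.
  by rewrite inE /= xX xY.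
set D := X :\: Y.
have tD : t - #|X :&: Y| <= #|D| by have := cardsID Y X; rewrite -/D; lia.
have tC : t - #|X :&: Y| <= #|~: D|.
  apply: leq_trans (leq_subr _ _) _; apply: leq_trans tY _; apply/subset_leq_card/subsetP => y yY.
  by rewrite in_setC in_setD yY.
have := isoperimetry_min tD tC; set E := \sum_i _ => tE.
suff EZ : E <= #|paths A B| + n * #|~: (X :|: Y)| by lia.
pose Q : {set cube n * option 'I_n} := \bigcup_i [set (x, Some i) | x in exit D i].
have -> : E = \sum_i #|exit D i :&: [set x | flip x i \in Y]| + \sum_i #|exit D i :\: [set x | flip x i \in Y]|.
  by rewrite -big_split /=; apply: eq_bigr => i _; rewrite cardsID.
apply: leq_add; last first.
  rewrite -[X in X * _](card_ord n) -sum_nat_const; apply: leq_sum => i _.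
  rewrite -(card_imset _ (inv_inj (flipK i))).
  apply/subset_leq_card/subsetP => _ /imsetP[x + ->]; rewrite in_setD inE => /andP[nY].
  rewrite inE => /andP[_]; rewrite in_setD (negbTE nY) /= => nX.
  by rewrite in_setC in_setU negb_or nX nY.
pose f (z : 'I_n * cube n) := (z.2, Some z.1).
have injf : injective f by move=> [i x] [j y] [-> ->].
rewrite (eq_bigr (fun i => \sum_(x in exit D i :&: [set x | flip x i \in Y]) 1)); last first.
  by move=> i _; rewrite sum1_card.
rewrite pair_big_dep /= sum1dep_card -(card_imset _ injf).
apply/subset_leq_card/subsetP => _ /imsetP[[i x] + ->]; rewrite inE /= => xi.
move: xi; rewrite in_setI => /andP[]; rewrite /exit inE in_setD => /andP[/andP[_ xX] _].
by rewrite !inE /= -/X -/Y => iY; move: xX; rewrite inE => ->.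
Qed.

(* A is a smallest union of classes comp S x :&: U of total size at least t. *)
Lemma balanced_split (S U : {set cube n}) t : 0 < t -> 3 * t <= #|U| ->
  (forall x, x \in U -> #|comp S x :&: U| + t < #|U|) ->
  exists A, [/\ A \subset U, (forall x, x \in A -> comp S x :&: U \subset A),
    t <= #|A| & t <= #|U :\: A|].
Proof.
move=> t0 tU small.
pose P A := [&& A \subset U, [forall x in A, comp S x :&: U \subset A] & t <= #|A|].
have PU : P U.
  by rewrite /P subxx /= (leq_trans _ tU) ?leq_pmull // andbT; apply/forall_inP => x _; apply: subsetIr.
case: (arg_minnP (fun A : {set cube n} => #|A|) PU) => A /and3P[AU clA tA] mn.
exists A; split => //; first by move=> x; apply: (forall_inP clA).
rewrite leqNgt; apply/negP => UA.
have [x xA] : exists x, x \in A by apply/card_gt0P; apply: leq_trans tA.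
have xU := subsetP AU _ xA; set C := comp S x :&: U.
have CA : C \subset A by apply: (forall_inP clA).
have cardA : #|U| = #|A| + #|U :\: A| by rewrite -(cardsID A U) (setIidPr AU).
have AC : #|A| = #|C| + #|A :\: C| by rewrite -(cardsID C A) (setIidPr CA).
have C0 : 0 < #|C| by apply/card_gt0P; exists x; rewrite inE comp_refl.
have sm := small _ xU; rewrite -/C in sm.
(* Without the class C of x, A is still a union of classes, so minimality makes the rest small. *)
have ACt : #|A :\: C| < t.
  rewrite ltnNge; apply/negP => h; have := mn (A :\: C); rewrite AC -/C.
  have -> : P (A :\: C).
    rewrite /P h (subset_trans (subsetDl _ _) AU) andbT /=; apply/forall_inP => y.
    rewrite inE => /andP[yC yA]; apply/subsetP => z zy.
    rewrite inE (subsetP (forall_inP clA y yA) _ zy) andbT; apply: contra yC.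
    move: zy; rewrite !in_setI => /andP[zy zU] /andP[zx _].
    by rewrite (subsetP AU _ yA) andbT -(comp_eq zx) comp_sym.
  by move=> /(_ isT); lia.
(* A small C would give fewer than 3 t vertices in U. A large C is itself a candidate, so A is no
   larger than C, and then C leaves out fewer than t vertices, against [small]. *)
case: (leqP t #|C|) => tC; last by lia.
have := mn C; have -> : P C; last by move=> /(_ isT); lia.
rewrite /P tC subsetIr andbT /=; apply/forall_inP => y; rewrite inE => /andP[yx yU].
by rewrite (comp_eq yx).
Qed.

End Paths.

Section Sprinkling.
Local Open Scope ring_scope.
Variables (R : realFieldType) (n : nat) (p : R).
Hypothesis p01 : 0 <= p <= 1.
Implicit Types (x y : cube n) (A B S : {set cube n}).

(** The constant 16 is the 4 of [many_paths] times the at most four inner vertices, which enter the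
    loss when passing to disjoint paths. *)
Lemma Pr_separated S1 A B t M z : (0 < n)%N -> A \subset S1 -> B \subset S1 ->
  (t <= #|A|)%N -> (t <= #|B|)%N -> (#|~: (near A :|: near B)| <= M)%N ->
  (16 * n.+1 ^ 3 * z + 4 * n * M <= t)%N ->
  Pr p (fun S2 => [forall a in A, forall b in B, b \notin comp (S1 :|: S2) a]) <= (1 - p ^+ 4) ^+ z.
Proof.
move=> n0 AS BS tA tB tM tz.
have [Z0 [Z0Z dis cZ]] := greedy_disjoint (fun z _ => card_inner A B z) (inner_degree A B).
have zZ : (z <= #|Z0|)%N.
  have := many_paths n0 tA tB => H1.
  have H2 : (n * #|~: (near A :|: near B)| <= n * M)%N by rewrite leq_mul2l tM orbT.
  have d0 : (0 < 16 * n.+1 ^ 3)%N by rewrite muln_gt0 expn_gt0.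
  rewrite -(leq_pmul2l d0); move: cZ H1 H2 tz.
  move: #|paths A B| #|~: _| #|Z0| (n.+1 ^ 3)%N => a1 a2 a3 a4.
  clear; nia.
have [p0 p1] := andP p01.
have p4 : 0 <= 1 - p ^+ 4 <= 1 by rewrite subr_ge0 exprn_ile1 //= gerBl exprn_ge0.
apply: le_trans (_ : (1 - p ^+ 4) ^+ #|Z0| <= _); last first.
  by case/andP: p4 => h0 h1; apply: ler_wiXn2l.
apply: le_trans (_ : Pr p (fun S2 => all (fun z => ~~ (inner A B z \subset S2)) (enum Z0)) <= _).
  apply: (le_Pr p01) => S2 /forall_inP sep; apply/allP => zz; rewrite mem_enum => zZ0.
  apply/negP => zS; have [] := @inner_connects n A B (S1 :|: S2) zz.
  - by apply: subset_trans AS _; apply: subsetUl.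
  - by apply: subset_trans BS _; apply: subsetUl.
  - exact: (subsetP Z0Z).
  - by apply: subset_trans zS _; apply: subsetUr.
  move=> a [b [aA bB ab]]; by move/forall_inP: (sep a aA) => /(_ b bB); rewrite ab.
rewrite cardE; apply: (Pr_all_le (D := inner A B) (b := fun z S2 => ~~ (inner A B z \subset S2))) => //.
- exact: enum_uniq.
- by move=> z1 z2; rewrite !mem_enum; apply: dis.
- by move=> z1 _ S2; rewrite subsetI subxx andbT.
move=> z1 _; rewrite PrN Pr_sub lerD2l lerN2; apply: ler_wiXn2l => //.
by have /andP[] := card_inner A B z1.
Qed.

(* Union bound over the sets A that are unions of large components of S1; there
   are at most 2 ^ (2 ^ n / L) of them. *)
Lemma Pr_not_merged S1 L t M z : (0 < n)%N -> (0 < L)%N -> (0 < t)%N ->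
  (3 * t <= #|large L S1|)%N ->
  (#|[set x | ~~ covered L x S1]| <= M)%N ->
  (16 * n.+1 ^ 3 * z + 4 * n * M <= t)%N ->
  Pr p (fun S2 => [forall x in large L S1,
     (#|comp (S1 :|: S2) x :&: large L S1| + t < #|large L S1|)%N])
  <= 2 ^+ (2 ^ n %/ L) * (1 - p ^+ 4) ^+ z.
Proof.
move=> n0 L0 t0; set U := large L S1 => tU cM tz.
have US : U \subset S1 by apply/subsetP => x /largeP[].
have [p0 p1] := andP p01.
pose Q := [set A : {set cube n} | [&& A \subset U, [forall x in A, comp S1 x \subset A],
   t <= #|A| & t <= #|U :\: A|]%N].
pose sep A S2 := [forall a in A, forall b in U :\: A, b \notin comp (S1 :|: S2) a].
apply: le_trans (_ : Pr p (fun S2 => [exists A in Q, sep A S2]) <= _).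
  apply: (le_Pr p01) => S2 /forall_inP small.
  have [A [AU clA tA tC]] := balanced_split t0 tU small.
  apply/exists_inP; exists A.
    rewrite inE AU tA tC andbT /= andbT; apply/forall_inP => x xA.
    apply: subset_trans (clA x xA); rewrite subsetI (compS _ (subsetUl _ _)) /=.
    by apply/subsetP => y; apply: large_comp; apply: (subsetP AU).
  apply/forall_inP => a aA; apply/forall_inP => b; rewrite in_setD => /andP[bA bU].
  by apply: contra bA => ba; apply: (subsetP (clA a aA)); rewrite inE ba.
apply: le_trans (Pr_exists p01 _ _) _.
have sepA A : A \in Q -> Pr p (sep A) <= (1 - p ^+ 4) ^+ z.
  rewrite inE => /and4P[AU _ tA tC].
  apply: (Pr_separated n0 _ _ tA tC (M := M)) => //.
  - exact: subset_trans AU US.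
  - exact: subset_trans (subsetDl _ _) US.
  (* A and its complement in U exhaust the large vertices, so a vertex near neither is uncovered. *)
  apply: leq_trans cM; apply/subset_leq_card/subsetP => x; rewrite !inE negb_or.
  case/andP => /existsPn nA /existsPn nB; rewrite /covered; apply/existsPn => i; apply/existsPn => j.
  have /existsPn/(_ j) := nA i; have /existsPn/(_ j) := nB i; rewrite in_setD.
  by case: (_ \in A) => //=.
apply: le_trans (ler_sum _ sepA) _; rewrite sumr_const -[leLHS]mulr_natl.
have p4 : 0 <= (1 - p ^+ 4) ^+ z by rewrite exprn_ge0 // subr_ge0 exprn_ile1.
rewrite ler_wpM2r //.
(* A set in Q is the union of the S1-components it contains, and each of these has at least L
   vertices. *)
pose P := [set comp S1 x | x in U].
have cP : (#|P| <= 2 ^ n %/ L)%N.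
  rewrite leq_divRL // -card_cube -sum_nat_const.
  have tP : trivIset P.
    apply/trivIsetP => _ _ /imsetP[x _ ->] /imsetP[y _ ->]; apply: contraNT => /pred0Pn[w /andP[/= wx wy]].
    by rewrite -(comp_eq wx) (comp_eq wy).
  apply: leq_trans (max_card (mem (cover P))); rewrite -(eqP tP).
  by apply: leq_sum => _ /imsetP[x /largeP[_ Lx] ->].
rewrite -natrX ler_nat; apply: leq_trans (_ : 2 ^ #|P| <= _)%N; last by rewrite leq_exp2l.
rewrite -card_powerset; apply: leq_trans (leq_imset_card (@cover (cube n)) _).
apply/subset_leq_card/subsetP => A; rewrite inE => /and4P[AU /forall_inP clA _ _].
apply/imsetP; exists [set comp S1 x | x in A].
  by rewrite powersetE; apply: imsetS.
rewrite cover_imset; apply/eqP; rewrite eqEsubset; apply/andP; split.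
  by apply/subsetP => x xA; apply/bigcupP; exists x => //; apply: comp_refl.
by apply/bigcupsP => x; apply: clA.
Qed.

End Sprinkling.

(** * The giant component *)

Section Giant.
Local Open Scope ring_scope.
Variables (R : realFieldType) (n : nat).
Implicit Types (S : {set cube n}).

Definition has_giant (K : nat) (b1 b2 : R) S : bool :=
  [exists x in S, b1 <= #|comp S x|%:R] && (#|large K S|%:R <= b2).

Variables (p p1 p2 s q c eta v : R) (w d K h L t M z : nat).
Hypothesis p01 : 0 <= p <= 1.
Hypothesis p101 : 0 <= p1 <= 1.
Hypothesis p201 : 0 <= p2 <= 1.
Hypothesis pE : 1 - p = (1 - p1) * (1 - p2).
Hypothesis s01 : 0 <= s <= 1.
Hypothesis hs : (1 - p1 + p1 * s) ^+ d <= s.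
Hypothesis dw : (d + 3 * K + 1 <= w)%N.
Hypothesis c01 : 0 <= c <= 1.
Hypothesis hc : c <= (1 - (1 - p1) ^+ K) * q.
Hypothesis hq : q <= (1 - s) * (1 - 2 * (1 - c) ^+ K).
Hypothesis LK : (L <= 2 ^ h * K)%N.
Hypothesis wn : (w + 2 * h * K + 2 * K <= n)%N.
Hypothesis hv : gw_last p n K 1 <= v.
Hypotheses (eta0 : 0 < eta) (p0 : 0 < p) (p10 : 0 < p1) (q0 : 0 < q) (v0 : 0 < v).
Hypotheses (n0 : (0 < n)%N) (L0 : (0 < L)%N) (t0 : (0 < t)%N) (M0 : (0 < M)%N).

Let N : R := 2 ^+ n.
Hypothesis ht : t%:R <= eta * (N * (p1 * q)).
Hypothesis ht3 : 3 * t%:R <= (1 - eta) * (N * (p1 * q)).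
Hypothesis htz : (16 * n.+1 ^ 3 * z + 4 * n * M <= t)%N.

Let N0 : 0 < N. Proof. by rewrite exprn_gt0. Qed.

Let Pr_few_large :
  Pr p1 (fun S => ~~ ((1 - eta) * (N * (p1 * q)) <= #|large L S|%:R)) <=
  p1 * (1 + n%:R * L%:R) ^+ 2 * N / (eta * (N * (p1 * q))) ^+ 2.
Proof.
have wn' : (w + 2 * h * K <= n)%N by apply: leq_trans wn; apply: leq_addr.
have El := EE_large_lb p101 s01 hs dw c01 hc hq LK wn'.
apply: le_trans (large_concentration n L p101 _); last by rewrite !mulr_gt0.
apply: (le_Pr p101) => S; rewrite -ltNge => lt; rewrite distrC ler_normr; apply/orP; left.
rewrite lerBrDr; apply: le_trans El; rewrite -/N; move: lt.
by rewrite mulrBl mul1r; lra.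
Qed.

Let Pr_many_uncovered :
  Pr p1 (fun S => ~~ (#|[set x : cube n | ~~ covered L x S]| <= M)%N) <=
  N * (1 - p1 * q) ^+ (K * K) / M%:R.
Proof.
apply: le_trans (_ : Pr p1 (fun S => M%:R <= (#|[set x : cube n | ~~ covered L x S]|%:R : R)) <= _).
  by apply: (le_Pr p101) => S; rewrite -ltnNge ler_nat => /ltnW.
have M0' : 0 < M%:R :> R by rewrite ltr0n.
apply: le_trans (Markov p101 M0' (fun S => ler0n _ _)) _.
rewrite ler_pM2r ?invr_gt0 ?ltr0n //.
have -> : EE p1 (fun S => #|[set x : cube n | ~~ covered L x S]|%:R) =
   \sum_(x : cube n) Pr p1 (fun S => ~~ covered L x S).
  rewrite /Pr /EE -Ex_sum; apply: eq_Ex => S.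
  by rewrite -natr_sum -sum1_card big_mkcond /=; congr (_%:R); apply: eq_bigr => x _; rewrite inE; case: (covered _ _ _).
rewrite /N -natrX -card_cube mulr_natl -sumr_const.
by apply: ler_sum => x _; apply: (Pr_uncovered p101 s01 hs dw c01 hc hq LK).
Qed.

(** A bad p1-set S1 is charged to the first two terms. For a good one, merging leaves a component
    with all but t of the large vertices, and t is at most eta N p1 q; this turns 1 - eta into 1 - 2
    eta. *)
Let Pr_no_giant :
  Pr p (fun S => ~~ [exists x in S, (1 - 2 * eta) * (N * (p1 * q)) <= #|comp S x|%:R]) <=
  p1 * (1 + n%:R * L%:R) ^+ 2 * N / (eta * (N * (p1 * q))) ^+ 2 +
  N * (1 - p1 * q) ^+ (K * K) / M%:R + 2 ^+ (2 ^ n %/ L) * (1 - p2 ^+ 4) ^+ z.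
Proof.
set e4 := 2 ^+ (2 ^ n %/ L) * _.
apply: le_trans (lerD (lerD Pr_few_large Pr_many_uncovered) (lexx e4)).
rewrite -[e4](EE_cst (cube n) p1) /Pr /EE (Ex_sprinkle _ _ pE) -!ExD; apply: le_EE => // S1.
have e40 : 0 <= e4.
  case/andP: p201 => a b; rewrite mulr_ge0 ?exprn_ge0 // subr_ge0 exprn_ile1 //.
case: (boolP ((1 - eta) * _ <= _)) => G1 /=; last first.
  apply: le_trans (Pr_le1 p201 _) _; rewrite -addrA lerDl addr_ge0 //; exact: ler0n.
case: (boolP (_ <= M)%N) => G2 /=; last first.
  by apply: le_trans (Pr_le1 p201 _) _; rewrite add0r lerDl.
rewrite !add0r.
have tU : (3 * t <= #|large L S1|)%N by rewrite -(ler_nat R) natrM; apply: le_trans ht3 G1.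
apply: le_trans (Pr_not_merged p201 n0 L0 t0 tU G2 htz).
apply: (le_Pr p201) => S2; apply: contraNT; rewrite negb_forall => /existsP[x].
rewrite negb_imply -leqNgt => /andP[xU xt]; apply/existsP; exists x.
have xS : x \in S1 :|: S2 by case/largeP: xU => xS _; rewrite inE xS.
rewrite xS /=; have {xt} : (#|large L S1| <= #|comp (S1 :|: S2) x| + t)%N.
  by apply: leq_trans xt _; rewrite leq_add2r subset_leq_card // subsetIl.
rewrite -(ler_nat R) natrD; move: G1 ht; rewrite !mulrBl !mul1r; lra.
Qed.

Let Pr_too_many :
  Pr p (fun S => ~~ (#|large K S|%:R <= (1 + eta) * (N * (p * v)))) <=
  p * (1 + n%:R * K%:R) ^+ 2 * N / (eta * (N * (p * v))) ^+ 2.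
Proof.
have Eu : EE p (fun S => #|large K S|%:R) <= N * (p * v).
  rewrite EE_large /N -natrX -card_cube mulr_natl -sumr_const; apply: ler_sum => x _.
  by apply: le_trans (Pr_large_ub K x p01) _; rewrite ler_pM2l.
apply: le_trans (large_concentration n K p01 _); last by rewrite !mulr_gt0.
apply: (le_Pr p01) => S; rewrite -ltNge => lt; rewrite ler_normr; apply/orP; left.
move: lt Eu; rewrite mulrDl mul1r; lra.
Qed.

Lemma Pr_has_giant :
  1 - (p1 * (1 + n%:R * L%:R) ^+ 2 * N / (eta * (N * (p1 * q))) ^+ 2 +
       N * (1 - p1 * q) ^+ (K * K) / M%:R + 2 ^+ (2 ^ n %/ L) * (1 - p2 ^+ 4) ^+ z +
       p * (1 + n%:R * K%:R) ^+ 2 * N / (eta * (N * (p * v))) ^+ 2) <=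
  Pr p (has_giant K ((1 - 2 * eta) * (N * (p1 * q))) ((1 + eta) * (N * (p * v)))).
Proof.
rewrite lerBlDr -lerBlDl; apply: le_trans (lerD Pr_no_giant Pr_too_many).
rewrite -PrN; apply: le_trans (Pr_or p01 _ _); apply: (le_Pr p01) => S.
by rewrite negb_and.
Qed.

End Giant.

(** * From the two size bounds to the unique largest component *)

Section Bridge.
Local Open Scope ring_scope.
Implicit Types (n K : nat).
Notation R := Rdefinitions.R.

Lemma probE n (lam : R) E (b : {set cube n} -> bool) :
  (forall S, reflect (E S) (b S)) -> prob n lam E = Pr lam b.
Proof.
move=> Eb; rewrite /prob /Pr EE_sumE; apply: eq_bigr => S _.
case: excluded_middle_informative => H; last by rewrite (introF (Eb S) H) mulr0.
rewrite (introT (Eb S) H).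
by rewrite mulr1 !RpowE.
Qed.

(** Another component either has fewer than K <= b1 vertices or shares the total b2 < 2 b1 with the
    giant; in both cases it is strictly smaller. *)
Lemma giant_event_of n K (b1 b2 a eta : R) (S : {set cube n}) :
  K%:R <= b1 -> b2 < 2 * b1 -> (1 - eta) * a <= b1 -> b2 <= (1 + eta) * a ->
  has_giant K b1 b2 S -> giant_event n a eta S.
Proof.
move=> Kb b12 ab1 ab2 /andP[/exists_inP[x xS xb] lb].
have Kx : (K <= #|comp S x|)%N by rewrite -(ler_nat R); apply: le_trans Kb xb.
have cl y : y \in S -> (K <= #|comp S y|)%N -> comp S y \subset large K S.
  by move=> yS Ky; apply/subsetP => u; apply: large_comp; apply/largeP.
have other y : y \in S -> comp S y != comp S x -> (#|comp S y| < #|comp S x|)%N.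
  move=> yS yx; case: (ltnP #|comp S y| K) => Ky; first exact: leq_trans Ky Kx.
  have dis : comp S y :&: comp S x = set0.
    apply/eqP; rewrite setI_eq0; apply: contraNT yx => /pred0Pn[u /andP[/= uy ux]].
    by rewrite -(comp_eq uy) (comp_eq ux).
  have : (#|comp S y| + #|comp S x| <= #|large K S|)%N.
    by rewrite -cardsUI dis cards0 addn0 subset_leq_card // subUset !cl.
  rewrite -(ler_nat R) natrD -(ltr_nat R); lra.
exists x; split => //; split; first move=> y yS.
  by case: (eqVneq (comp S y) (comp S x)) => [->//|/(other _ yS)/ltnW].
split.
  move=> y yS E; apply/eqP; apply: contraT => /(other _ yS); by rewrite E ltnn.
have xl : (#|comp S x|%:R : R) <= #|large K S|%:R by rewrite ler_nat subset_leq_card // cl.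
apply/RleP; rewrite INRE RabsE RmultE RminusE ler_norml.
apply/andP; split; lra.
Qed.

Lemma prob_ge n K (lam b1 b2 a eta : R) : 0 <= lam <= 1 ->
  K%:R <= b1 -> b2 < 2 * b1 -> (1 - eta) * a <= b1 -> b2 <= (1 + eta) * a ->
  Pr lam (has_giant K b1 b2 : {set cube n} -> bool) <= prob n lam (giant_event n a eta) <= 1.
Proof.
move=> l01 Kb b12 ab1 ab2.
pose b S : bool := excluded_middle_informative (giant_event n a eta S).
have Eb S : reflect (giant_event n a eta S) (b S).
  by rewrite /b; case: excluded_middle_informative => H; constructor.
rewrite (probE lam Eb) Pr_le1 // andbT; apply: (le_Pr l01) => S /giant_event_of H.
by apply/Eb; apply: H.
Qed.

End Bridge.

End Combinatorics.
Import Combinatorics.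

Section StdlibBound.
Local Open Scope R_scope.

Lemma one_sub_pow_le_exp (x : R) (k : nat) : 0 <= x <= 1 -> (1 - x) ^ k <= exp (- (x * INR k)).
Proof.
move=> [x0 x1]; elim: k => [|k IH]; first by rewrite /= Rmult_0_r Ropp_0 exp_0; apply: Rle_refl.
rewrite S_INR (_ : - (x * (INR k + 1)) = - x + - (x * INR k)); last by lra.
rewrite exp_plus /=; apply: Rmult_le_compat => //; try (apply: pow_le); try lra.
have := exp_ineq1_le (- x); lra.
Qed.

Lemma Rle01 (x : R) : 0 <= x <= 1 -> (0 <= x <= 1)%R.
Proof. by move=> [a b]; apply/andP; split; apply/RleP. Qed.

Lemma two_pow_le_exp (k : nat) : 2 ^ k <= exp (INR k).
Proof.
elim: k => [|k IH]; first by rewrite /= exp_0; apply: Rle_refl.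
rewrite S_INR exp_plus (Rmult_comm (exp _)) /=; apply: Rmult_le_compat => //; try (apply: pow_le); try lra.
have := exp_ineq1_le 1; lra.
Qed.

(** Here s bounds extinction at p1 from above, while s', u and th certify through [gw_last_le] that
    v bounds survival up to size K at p. The errors are, in order: few large vertices, many
    uncovered ones, no merging, many vertices in components of size K. *)
Lemma prob_giant_bound (n w d K h L t M z : nat) (p p1 p2 s q c eta v s' u th a eta' : R) :
  0 < p <= 1 -> 0 < p1 <= 1 -> 0 <= p2 <= 1 -> 1 - p = (1 - p1) * (1 - p2) ->
  0 <= s <= 1 -> (1 - p1 + p1 * s) ^ d <= s -> (d + 3 * K + 1 <= w)%N ->
  0 <= c <= 1 -> c <= (1 - (1 - p1) ^ K) * q -> q <= (1 - s) * (1 - 2 * (1 - c) ^ K) ->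
  (L <= 2 ^ h * K)%N -> (w + 2 * h * K + 2 * K <= n)%N ->
  0 <= s' -> s' <= u -> u <= 1 -> 0 <= th -> s' <= (1 - p + p * s') ^ n ->
  (1 - p + p * u) ^ n <= th * u -> 1 - s' + th ^ K * u <= v ->
  0 < eta -> 0 < q -> 0 < v -> (0 < n)%N -> (0 < L)%N -> (0 < t)%N -> (0 < M)%N ->
  INR t <= eta * (2 ^ n * (p1 * q)) -> 3 * INR t <= (1 - eta) * (2 ^ n * (p1 * q)) ->
  (16 * n.+1 ^ 3 * z + 4 * n * M <= t)%N -> q <= 1 ->
  INR K <= (1 - 2 * eta) * (2 ^ n * (p1 * q)) ->
  (1 + eta) * (2 ^ n * (p * v)) < 2 * ((1 - 2 * eta) * (2 ^ n * (p1 * q))) ->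
  (1 - eta') * a <= (1 - 2 * eta) * (2 ^ n * (p1 * q)) ->
  (1 + eta) * (2 ^ n * (p * v)) <= (1 + eta') * a ->
  1 - ((1 + INR n * INR L) ^ 2 / (eta ^ 2 * (p1 * q ^ 2) * 2 ^ n) +
       2 ^ n * exp (- (p1 * q * (INR K * INR K))) / INR M +
       exp (2 ^ n / INR L - p2 ^ 4 * INR z) +
       (1 + INR n * INR K) ^ 2 / (eta ^ 2 * (p * v ^ 2) * 2 ^ n))
  <= prob n p (giant_event n a eta') <= 1.
Proof.
move=> hp hp1 hp2 pE hs1 hs dw hc1 hc hq LK wn s0 su u1 th0 hs' hu hv eta0 q0 v0 n0 L0 t0 M0.
move=> ht ht3 htz q1 Kb b12 ab1 ab2.
have N0 : 0 < 2 ^ n by apply: pow_lt; lra.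
have p01 : (0 <= p <= 1)%R by apply: Rle01; lra.
have p101 : (0 <= p1 <= 1)%R by apply: Rle01; lra.
have p201 : (0 <= p2 <= 1)%R by apply: Rle01; lra.
have s01 : (0 <= s <= 1)%R by apply: Rle01; lra.
have c01 : (0 <= c <= 1)%R by apply: Rle01; lra.
have G := @Pr_has_giant R n p p1 p2 s q c eta v w d K h L t M z p01 p101 p201 pE s01.
have {G} := G _ dw c01 _ _ LK wn.
move=> /(_ ltac:(by apply/RleP; rewrite -RpowE)).
move=> /(_ ltac:(by apply/RleP; rewrite -RpowE)).
move=> /(_ ltac:(by apply/RleP; rewrite -RpowE)).
have hg : (gw_last p n K 1 <= v)%R.
  apply: le_trans (@gw_last_le R p p01 n K 1 s' u th _ _ _ _ _ _) _.
  - exact/RleP.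
  - exact/RleP.
  - exact/RleP.
  - exact/RleP.
  - by apply/RleP; rewrite -RpowE.
  - by apply/RleP; rewrite -RpowE.
  by apply/RleP; rewrite !expr1 -RpowE.
move=> /(_ hg).
move=> /(_ ltac:(exact/RltP) ltac:(apply/RltP; exact: (proj1 hp)) ltac:(apply/RltP; exact: (proj1 hp1))).
move=> /(_ ltac:(exact/RltP) ltac:(exact/RltP) n0 L0 t0 M0).
move=> /(_ ltac:(by apply/RleP; rewrite -(INRE t) -RpowE)).
move=> /(_ ltac:(by apply/RleP; rewrite -(INRE t) -RpowE)).
move=> /(_ htz) /RleP G.
have /andP[/RleP B1 /RleP B2] := @prob_ge n K p ((1 - 2 * eta) * (2 ^ n * (p1 * q)))
   ((1 + eta) * (2 ^ n * (p * v))) a eta' p01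
   ltac:(by apply/RleP; rewrite -INRE) ltac:(exact/RltP) ltac:(exact/RleP) ltac:(exact/RleP).
split; last exact: B2.
apply: Rle_trans B1; move: G; rewrite -!RpowE -!INRE => G.
apply: Rle_trans G; apply: Rplus_le_compat_l; apply: Ropp_le_contravar.
have le_eq (a1 b1 : R) : a1 = b1 -> a1 <= b1 by move=> ->; apply: Rle_refl.
apply: Rplus_le_compat; [apply: Rplus_le_compat; [apply: Rplus_le_compat|]|].
- apply: le_eq; transitivity (p1 * (1 + INR n * INR L) ^ 2 * 2 ^ n / (eta * (2 ^ n * (p1 * q))) ^ 2); first by [].
  by field; do !split; lra.
- apply: (Rmult_le_compat_r); first by apply/Rlt_le/Rinv_0_lt_compat/lt_0_INR/ssrnat.ltP.
  apply: Rmult_le_compat_l; first exact: Rlt_le.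
  apply: Rle_trans (one_sub_pow_le_exp _ _) _.
    by split; [apply/Rlt_le/Rmult_lt_0_compat; lra|rewrite -[X in _ <= X]Rmult_1_l; apply: Rmult_le_compat; lra].
  by rewrite mult_INR; apply: Rle_refl.
- rewrite /Rminus exp_plus; apply: Rmult_le_compat.
  + by apply: pow_le; apply: (pos_INR 2).
  + apply: pow_le; have : p2 ^ 4 <= 1 by rewrite -(pow1 4); apply: pow_incr; lra.
    by move=> h4; apply: (proj2 (Rminus_ge_0_le _ _)) || exact: (Rge_le _ _ (Rge_minus _ _ (Rle_ge _ _ h4))).
  + apply: Rle_trans (two_pow_le_exp _) _.
    have H : INR (2 ^ n %/ L) <= 2 ^ n / INR L.
      have L0' : 0 < INR L by apply/lt_0_INR/ssrnat.ltP.
      apply: (Rmult_le_reg_r (INR L)) => //; rewrite -mult_INR.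
      rewrite /Rdiv Rmult_assoc Rinv_l ?Rmult_1_r; last lra.
      rewrite (_ : 2 ^ n = INR (2 ^ n)%N); last by rewrite RpowE INRE natrX.
      by apply/le_INR/ssrnat.leP/leq_trunc_div.
    case: H => [H|->]; [left; exact: exp_increasing|exact: Rle_refl].
  + apply: Rle_trans (one_sub_pow_le_exp _ _) (Rle_refl _).
    split; first by apply: pow_le; lra.
    by rewrite -(pow1 4); apply: pow_incr; lra.
- apply: le_eq; transitivity (p * (1 + INR n * INR K) ^ 2 * 2 ^ n / (eta * (2 ^ n * (p * v))) ^ 2); first by [].
  by field; do !split; lra.
Qed.

End StdlibBound.

(** * Choice of the parameters *)

Section RealInequalities.
Import Coquelicot.Coquelicot.
Local Open Scope R_scope.

Lemma floor_nat (r : R) : 0 <= r -> exists k : nat, INR k <= r < INR k + 1.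
Proof.
move=> r0; have [h1 h2] := archimed r.
have up1 : Z.lt 0 (up r) by apply: lt_IZR; lra.
exists (Z.to_nat (Z.sub (up r) 1)).
rewrite INR_IZR_INZ Z2Nat.id ?minus_IZR; last by lia.
lra.
Qed.

Lemma floor_half (r : R) : 2 <= r -> exists k : nat, r / 2 <= INR k <= r.
Proof. by move=> r2; have [k hk] := @floor_nat r ltac:(lra); exists k; lra. Qed.

Lemma div_le_of (a b c : R) : 0 < b -> a <= c * b -> a / b <= c.
Proof.
move=> b0 H; apply: (Rmult_le_reg_r b) => //; rewrite /Rdiv Rmult_assoc Rinv_l; lra.
Qed.

Lemma le_div_of (a b c : R) : 0 < b -> c * b <= a -> c <= a / b.
Proof.
move=> b0 H; apply: (Rmult_le_reg_r b) => //; rewrite /Rdiv Rmult_assoc Rinv_l; lra.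
Qed.

Lemma exp_le (a b : R) : a <= b -> exp a <= exp b.
Proof. by case=> [/exp_increasing|->]; lra. Qed.

Lemma exp_neg_le_inv (t : R) : 0 < t -> exp (- t) <= / t.
Proof.
move=> t0; rewrite exp_Ropp; apply: Rinv_le_contravar => //.
have := exp_ineq1_le t; lra.
Qed.

Lemma exp_neg_le_half (t : R) : 0 <= t <= 1 -> exp (- t) <= 1 - t / 2.
Proof.
move=> [t0 t1]; rewrite exp_Ropp.
apply: (Rmult_le_reg_r (exp t)); first exact: exp_pos.
rewrite Rinv_l; last by have := exp_pos t; lra.
have := exp_ineq1_le t; nra.
Qed.

Lemma one_sub_pow_le_half (x : R) (k : nat) : 0 <= x <= 1 -> x * INR k <= 1 ->
  (1 - x) ^ k <= 1 - x * INR k / 2.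
Proof.
move=> hx hk; apply: Rle_trans (one_sub_pow_le_exp _ hx) _; apply: exp_neg_le_half.
split=> //; apply: Rmult_le_pos; [lra|exact: pos_INR].
Qed.

Lemma exp_half_le_two : exp (1 / 2) <= 2.
Proof.
have h : exp (1 / 2) * exp (1 / 2) <= 3 by rewrite -exp_plus (_ : 1 / 2 + 1 / 2 = 1); [exact: exp_le_3|lra].
have := exp_pos (1 / 2); nra.
Qed.

Lemma exp_half_le_two_pow (k : nat) : exp (INR k / 2) <= 2 ^ k.
Proof.
elim: k => [|k IH]; first by rewrite /= (_ : 0 / 2 = 0) ?exp_0; lra.
rewrite S_INR (_ : (INR k + 1) / 2 = 1 / 2 + INR k / 2); last lra.
rewrite exp_plus /=; apply: Rmult_le_compat => //; try (apply: Rlt_le; apply: exp_pos).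
exact: exp_half_le_two.
Qed.

(** Comparing 1 - t with the exponential of a polynomial becomes a question about the sign of a
    polynomial, the other factor of the derivative being positive. *)
Lemma one_sub_exp_mvt (a b t : R) : 0 <= t -> exists c k, 0 <= c <= t /\ 0 < k /\
  (1 - t) * exp (t + a * t ^ 2 + b * t ^ 3) - 1 =
  k * ((1 - c) * (1 + 2 * a * c + 3 * b * c ^ 2) - 1) * t.
Proof.
move=> t0.
pose f x := (1 - x) * exp (x + a * x ^ 2 + b * x ^ 3).
pose df x := exp (x + a * x ^ 2 + b * x ^ 3) * ((1 - x) * (1 + 2 * a * x + 3 * b * x ^ 2) - 1).
have D x : is_derive f x (df x).
  by rewrite /f /df; auto_derive => //; rewrite /=; ring.
have [|x _|c [hc E]] := @MVT_gen f 0 t df.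
- by move=> x _; apply: D.
- by apply: derivable_continuous_pt; exists (df x); apply/is_derive_Reals.
rewrite Rmin_left // Rmax_right // in hc.
exists c, (exp (c + a * c ^ 2 + b * c ^ 3)); split => //; split; first exact: exp_pos.
have F0 : f 0 = 1 by rewrite /f (_ : 0 + _ + _ = 0) ?exp_0; ring.
by transitivity (f t - f 0); [rewrite F0|rewrite E /df; ring].
Qed.

Lemma mul_exp_le (u v w : R) : u * exp w <= v -> u <= v * exp (- w).
Proof.
move=> H; apply: (Rmult_le_reg_r (exp w)); first exact: exp_pos.
by rewrite Rmult_assoc -exp_plus (_ : - w + w = 0) ?exp_0; lra.
Qed.

Lemma mul_exp_ge (u v w : R) : v <= u * exp w -> v * exp (- w) <= u.
Proof.
move=> H; apply: (Rmult_le_reg_r (exp w)); first exact: exp_pos.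
by rewrite Rmult_assoc -exp_plus (_ : - w + w = 0) ?exp_0; lra.
Qed.

Lemma exp_neg_le_quadratic (t : R) : 0 <= t <= 1 / 2 -> exp (- (t + t ^ 2)) <= 1 - t.
Proof.
move=> [t0 t1]; rewrite -[X in X <= _]Rmult_1_l; apply: mul_exp_ge.
have [c [k [hc [k0 E]]]] := @one_sub_exp_mvt 1 0 t t0.
rewrite (_ : t + 1 * t ^ 2 + 0 * t ^ 3 = t + t ^ 2) in E; last ring.
have : 0 <= k * ((1 - c) * (1 + 2 * 1 * c + 3 * 0 * c ^ 2) - 1) * t; last lra.
apply: Rmult_le_pos => //; apply: Rmult_le_pos; first lra; nra.
Qed.

Lemma one_sub_le_exp_quadratic (t : R) : 0 <= t -> 1 - t <= exp (- (t + t ^ 2 / 2)).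
Proof.
move=> t0; rewrite -[X in _ <= X]Rmult_1_l; apply: mul_exp_le.
have [c [k [hc [k0 E]]]] := @one_sub_exp_mvt (1 / 2) 0 t t0.
rewrite (_ : t + 1 / 2 * t ^ 2 + 0 * t ^ 3 = t + t ^ 2 / 2) in E; last field.
have : 0 <= k * (1 - (1 - c) * (1 + 2 * (1 / 2) * c + 3 * 0 * c ^ 2)) * t; last lra.
apply: Rmult_le_pos => //; apply: Rmult_le_pos; first lra; nra.
Qed.

Lemma exp_neg_le_cubic (t : R) : 0 <= t <= 1 / 2 -> exp (- (t + t ^ 2 / 2 + t ^ 3)) <= 1 - t.
Proof.
move=> [t0 t1]; rewrite -[X in X <= _]Rmult_1_l; apply: mul_exp_ge.
have [c [k [hc [k0 E]]]] := @one_sub_exp_mvt (1 / 2) 1 t t0.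
rewrite (_ : t + 1 / 2 * t ^ 2 + 1 * t ^ 3 = t + t ^ 2 / 2 + t ^ 3) in E; last field.
have : 0 <= k * ((1 - c) * (1 + 2 * (1 / 2) * c + 3 * 1 * c ^ 2) - 1) * t; last lra.
apply: Rmult_le_pos => //; apply: Rmult_le_pos; first lra.
have : 0 <= c ^ 2 * (2 - 3 * c) by apply: Rmult_le_pos; nra.
nra.
Qed.

End RealInequalities.

Section Core.
Local Open Scope R_scope.

Lemma INR_expn (a b : nat) : INR (a ^ b)%N = INR a ^ b.
Proof. by rewrite RpowE !INRE GRing.natrX. Qed.

Lemma pow_exp (a : R) (k : nat) : exp a ^ k = exp (a * INR k).
Proof.
elim: k => [|k IH]; first by rewrite /= Rmult_0_r exp_0.
by rewrite /= IH -exp_plus -/(INR k.+1) S_INR; congr exp; ring.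
Qed.

Lemma exp_le_one_sub_pow (t : R) (k : nat) : 0 <= t < 1 ->
  exp (- (t / (1 - t) * INR k)) <= (1 - t) ^ k.
Proof.
move=> [t0 t1]; rewrite Ropp_mult_distr_l -pow_exp; apply: pow_incr; split; first exact/Rlt_le/exp_pos.
rewrite -[X in X <= _]Rmult_1_l; apply: mul_exp_ge.
have h : 1 + t / (1 - t) <= exp (t / (1 - t)) by exact: exp_ineq1_le.
have E : 1 + t / (1 - t) = / (1 - t) by field; lra.
rewrite E in h; have : (1 - t) * / (1 - t) = 1 by field; lra.
nra.
Qed.

(** The Poisson inequality has eta2 chi to spare, which covers the passage to a binomial since p is
    of order 1 / n. The contraction factor at 1 - chi/2 comes from p n chi/2 = chi^2/4 + (chi/2 +
    (chi/2)^2). *)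
Lemma upper_params (n : nat) (chi pi eta eta2 : R) (p := (1 + chi) / INR n) :
  2 <= INR n -> 0 < chi <= 1 / 3 -> 0 < eta -> 0 < pi -> (1 + eta) * pi <= 1 ->
  4 <= eta2 * (chi * INR n) -> eta2 <= 1 ->
  1 - (1 + eta) * pi <= exp (- ((1 + (1 + eta2) * chi) * ((1 + eta) * pi))) ->
  1 - (1 + eta) * pi <= (1 - p + p * (1 - (1 + eta) * pi)) ^ n /\
  (1 - p + p * (1 - chi / 2)) ^ n <= exp (- (chi ^ 2 / 4)) * (1 - chi / 2).
Proof.
move=> n2 hchi eta0 pi0 pi1 h4 e2 UP.
set r := (1 + eta) * pi in pi1 UP *.
have r0 : 0 < r by apply: Rmult_lt_0_compat; lra.
have px : p * INR n = 1 + chi by rewrite /p; field; lra.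
have p0 : 0 < p by apply: Rdiv_lt_0_compat; lra.
have p1 : p <= 2 / 3 by apply: div_le_of; lra.
split.
- have -> : 1 - p + p * (1 - r) = 1 - p * r by ring.
  have pr1 : p * r < 1 by nra.
  have pr0 : 0 <= p * r by nra.
  apply: Rle_trans UP _; apply: Rle_trans (@exp_le_one_sub_pow (p * r) n _); last by split; lra.
  apply: exp_le; apply: Ropp_le_contravar.
  have -> : p * r / (1 - p * r) * INR n = (p * INR n) * r / (1 - p * r) by field; lra.
  rewrite px; apply: div_le_of; first lra.
  have key : 1 + chi <= (1 + (1 + eta2) * chi) * (1 - p * r).
    have h1 : p * r <= p by nra.
    have h2 : p * INR n <= 4 / 3 by lra.
    have h3 : p * (1 + (1 + eta2) * chi) <= eta2 * chi.
      apply: (Rmult_le_reg_r (INR n)); first lra.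
      have -> : p * (1 + (1 + eta2) * chi) * INR n = (p * INR n) * (1 + (1 + eta2) * chi) by ring.
      rewrite px; nra.
    have h5 : 0 < 1 + (1 + eta2) * chi by nra.
    nra.
  nra.
have -> : 1 - p + p * (1 - chi / 2) = 1 - p * (chi / 2) by ring.
have h1 : 0 <= p * (chi / 2) <= 1 by split; nra.
apply: Rle_trans (one_sub_pow_le_exp _ h1) _.
have -> : - (p * (chi / 2) * INR n) = - (chi ^ 2 / 4) + - (chi / 2 + (chi / 2) ^ 2).
  have -> : p * (chi / 2) * INR n = (p * INR n) * (chi / 2) by ring.
  by rewrite px; field.
rewrite exp_plus; apply: Rmult_le_compat_l; first exact/Rlt_le/exp_pos.
by apply: exp_neg_le_quadratic; lra.
Qed.

(** Sprinkling costs a quarter of eta2. Dropping D coordinates is a relative loss of at most 4 chi /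
    y <= eta2 chi / 4, hence costs at most another half. *)
Lemma lower_params (n d D : nat) (chi r eta2 y p1 : R) :
  0 < INR n -> 0 < chi <= 1 / 3 -> 0 < r <= 1 -> 0 < eta2 <= 1 -> 16 / eta2 <= y ->
  (n <= d + D)%N -> INR D <= 4 * (chi * INR n) / y -> 0 < p1 <= 1 ->
  (1 + (1 - eta2 / 4) * chi) / INR n <= p1 ->
  exp (- ((1 + (1 - eta2) * chi) * r)) <= 1 - r ->
  (1 - p1 + p1 * (1 - r)) ^ d <= 1 - r.
Proof.
move=> n0 hchi hr he hy dD hD hp1 lp1 LOW.
have -> : 1 - p1 + p1 * (1 - r) = 1 - p1 * r by ring.
apply: Rle_trans (one_sub_pow_le_exp _ _) _; first by split; nra.
apply: Rle_trans LOW; apply: exp_le; apply: Ropp_le_contravar.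
have y0 : 0 < y by apply: Rlt_le_trans hy; apply: Rdiv_lt_0_compat; lra.
have hd : INR n - INR D <= INR d.
  have /le_INR : (n <= d + D)%coq_nat by apply/ssrnat.leP.
  rewrite plus_INR; lra.
have e16 : 16 <= eta2 * y.
  have := Rmult_le_compat_l eta2 _ _ (Rlt_le _ _ (proj1 he)) hy.
  rewrite (_ : eta2 * (16 / eta2) = 16); first by []; field; lra.
have d1 : INR n * (1 - 4 * chi / y) <= INR d.
  apply: Rle_trans hd; rewrite (_ : INR n * _ = INR n - 4 * (chi * INR n) / y); first lra; field; lra.
have hq : 4 * chi / y <= eta2 * chi / 4.
  apply: div_le_of => //; nra.
have q0 : 0 <= 4 * chi / y by apply: Rlt_le; apply: Rdiv_lt_0_compat; lra.
have pd : 1 + (1 - eta2) * chi <= p1 * INR d.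
  apply: Rle_trans (_ : (1 + (1 - eta2 / 4) * chi) / INR n * (INR n * (1 - 4 * chi / y)) <= _).
    have -> : (1 + (1 - eta2 / 4) * chi) / INR n * (INR n * (1 - 4 * chi / y)) =
      (1 + (1 - eta2 / 4) * chi) * (1 - 4 * chi / y) by field; lra.
    set w := 4 * chi / y in hq q0 *.
    have : (1 - eta2 / 4) * chi <= 1 by nra.
    nra.
  apply: Rmult_le_compat => //.
    by apply: Rlt_le; apply: Rdiv_lt_0_compat; nra.
  apply: Rmult_le_pos; first lra; nra.
nra.
Qed.

End Core.

Section Core.
Local Open Scope R_scope.

Lemma pow_ge_self (y : R) (k : nat) : 1 <= y -> y <= y ^ k.+1.
Proof.
move=> y1; have := pow_R1_Rle y k y1 => h /=; nra.
Qed.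

(** p2 takes a small share of chi / x, so that p1 stays supercritical, and p1 solves the sprinkling
    identity. *)
Lemma sprinkle_params (x chi eta eta2 : R) (p := (1 + chi) / x) (p2 := eta2 * chi / (4 * x))
    (p1 := (p - p2) / (1 - p2)) :
  2 <= x -> 0 < chi <= 1 / 3 -> 0 < eta2 <= eta -> eta <= 1 ->
  [/\ 0 < p <= 1, 0 < p1 <= 1, 0 < p2 <= 1, 1 - p = (1 - p1) * (1 - p2) &
   (1 + (1 - eta2 / 4) * chi) / x <= p1 /\ p1 <= p /\ (1 - eta) * p <= p1].
Proof.
move=> x2 hchi he he1.
have px : p * x = 1 + chi by rewrite /p; field; lra.
have p2x : p2 * x = eta2 * chi / 4 by rewrite /p2; field; lra.
have p0 : 0 < p by apply: Rdiv_lt_0_compat; lra.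
have p_1 : p <= 1 by apply: div_le_of; lra.
have p20 : 0 < p2 by apply: Rdiv_lt_0_compat; nra.
have p2p : p2 <= eta * p / 4.
  apply: (Rmult_le_reg_r x); first lra.
  rewrite p2x (_ : eta * p / 4 * x = eta * (p * x) / 4); last field.
  rewrite px; nra.
have p2h : p2 <= 1 / 2 by nra.
have lo : p - p2 <= p1 by apply: le_div_of; nra.
have hi : p1 <= p by apply: div_le_of; nra.
have E : (1 + (1 - eta2 / 4) * chi) / x = p - p2 by rewrite /p /p2; field; lra.
split; try lra.
- by split; nra.
- by rewrite /p1; field; lra.
Qed.

(** K is about chi x / y^2 and h just above y. Then h K is about chi x / y, negligible against chi
    x, while chi K^2 / x is at least chi^3 x / (4 y^4) >= y^8 / 4. *)
Lemma block_params (x y chi : R) : 32 <= y -> y <= x -> 0 < chi <= 1 / 3 -> y ^ 12 <= chi ^ 3 * x ->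
  exists K h : nat,
  [/\ INR K <= chi * x / y ^ 2, chi * x / y ^ 2 <= 2 * INR K, 1 <= INR K &
   y <= INR h /\ (2 * INR h + 5) * INR K + 1 <= 4 * (chi * x) / y /\ 32 * y <= chi * (INR K * INR K) / x].
Proof.
move=> y32 yx hchi hy.
have hcx : y ^ 12 <= chi * x by apply: Rle_trans hy _; apply: Rmult_le_compat_r; [lra|nra].
have y12 : y ^ 12 = y ^ 10 * y ^ 2 by ring.
have y2 : 0 < y ^ 2 by apply: pow_lt; lra.
have y10 : 2 <= y ^ 10 by have := @pow_ge_self y 9 ltac:(lra); lra.
have rK : 2 <= chi * x / y ^ 2.
  apply: le_div_of => //; apply: Rle_trans hcx; rewrite y12; apply: Rmult_le_compat_r; lra.
have [K [K1 K2]] := floor_half rK.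
have [h [h1 h2]] := @floor_nat y ltac:(lra).
exists K, h.+1; rewrite S_INR.
have Ky : INR K * y ^ 2 <= chi * x.
  have := Rmult_le_compat_r (y ^ 2) _ _ (Rlt_le _ _ y2) K2.
  by rewrite (_ : chi * x / y ^ 2 * y ^ 2 = chi * x) //; field; lra.
have Ky' : chi * x <= 2 * (INR K * y ^ 2).
  have := Rmult_le_compat_r (y ^ 2) _ _ (Rlt_le _ _ y2) K1.
  by rewrite (_ : chi * x / y ^ 2 / 2 * y ^ 2 = chi * x / 2); [lra|field; lra].
split; try lra; split; first lra; split.
  apply: le_div_of; first lra.
  have h3 : (2 * (INR h + 1) + 5) * y <= 3 * y ^ 2 by nra.
  have h4 : (2 * (INR h + 1) + 5) * y * INR K <= 3 * y ^ 2 * INR K.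
    by apply: Rmult_le_compat_r => //; lra.
  have h5 : y <= y ^ 12 by apply: (@pow_ge_self y 11); lra.
  lra.
apply: le_div_of; first lra.
have cx0 : 0 <= chi * x by nra.
have sq : (chi * x) * (chi * x) <= (2 * (INR K * y ^ 2)) * (2 * (INR K * y ^ 2)).
  by apply: Rmult_le_compat.
have sq2 : y ^ 12 * x <= 4 * y ^ 4 * (chi * (INR K * INR K)).
  apply: Rle_trans (_ : chi ^ 3 * x * x <= _); first by apply: Rmult_le_compat_r; lra.
  have -> : chi ^ 3 * x * x = chi * ((chi * x) * (chi * x)) by ring.
  have -> : 4 * y ^ 4 * (chi * (INR K * INR K)) = chi * ((2 * (INR K * y ^ 2)) * (2 * (INR K * y ^ 2))) by ring.
  by apply: Rmult_le_compat_l; lra.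
have y4 : 0 < y ^ 4 by apply: pow_lt; lra.
apply: (Rmult_le_reg_r (4 * y ^ 4)); first lra.
apply: Rle_trans (_ : y ^ 12 * x <= _); last lra.
have -> : 32 * y * x * (4 * y ^ 4) = 128 * y ^ 5 * x by ring.
apply: Rmult_le_compat_r; first lra.
have -> : y ^ 12 = y ^ 2 * y ^ 5 * y ^ 5 by ring.
have y5 : 0 < y ^ 5 by apply: pow_lt; lra.
have h5 : y <= y ^ 5 by apply: (@pow_ge_self y 4); lra.
have h6 : y <= y ^ 2 by apply: (@pow_ge_self y 1); lra.
apply: Rmult_le_compat_r; first lra.
by apply: Rle_trans (_ : 32 * 32 <= _); [lra|apply: Rmult_le_compat; lra].
Qed.

(** t is at least N / x^3, while M and z are about N / x^5 and N / x^7, so that n M and n^3 z are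
    both of order N / x^4. *)
Lemma count_params (n : nat) (N W eta B : R) (x := INR n) :
  10 ^ 6 <= x -> 0 < eta <= 1 / 20 -> 8 / eta <= x -> 10 ^ 6 <= B -> B * x ^ 60 <= N -> N <= 4 * x ^ 2 * W ->
  exists t M z : nat,
  [/\ (0 < t)%N, (0 < M)%N, INR t <= eta * W & 3 * INR t <= (1 - eta) * W] /\
  [/\ (16 * n.+1 ^ 3 * z + 4 * n * M <= t)%N, N / (2 * x ^ 5) <= INR M & N / (2 * x ^ 7) <= INR z] /\
  x <= (1 - 2 * eta) * W.
Proof.
move=> x6 he ex B6 hN hW.
have x0 : 0 < x by lra.
have pw k : 0 < x ^ k by apply: pow_lt.
have pw1 k : 1 <= x ^ k by apply: pow_R1_Rle; lra.
have N60 : 10 ^ 6 * x ^ 60 <= N by apply: Rle_trans hN; apply: Rmult_le_compat_r; [apply/Rlt_le|].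
have N0 : 0 < N by have := pw 60%N; lra.
have Nk k j : (60 = k + j)%N -> 10 ^ 6 * x ^ k <= N.
  move=> E; apply: Rle_trans N60; apply: Rmult_le_compat_l; first lra.
  by apply: Rle_pow; [lra|lia].
have eW : 2 * N / x ^ 3 <= eta * W.
  apply: div_le_of => //.
  have e8 : 8 <= eta * x.
    have := Rmult_le_compat_l eta _ _ (Rlt_le _ _ (proj1 he)) ex.
    by rewrite (_ : eta * (8 / eta) = 8) //; field; lra.
  have W0 : 0 < W.
    have : 0 < 4 * x ^ 2 by have := pw 2%N; lra.
    move=> h1; case: (Rlt_le_dec 0 W) => // W0; nra.
  have -> : eta * W * x ^ 3 = (eta * x) * (x ^ 2 * W) by ring.
  have : 8 * (x ^ 2 * W) <= eta * x * (x ^ 2 * W).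
    by apply: Rmult_le_compat_r => //; have := pw 2%N => pw2; apply: Rlt_le; apply: Rmult_lt_0_compat; lra.
  lra.
have N3 : 2 <= 2 * N / x ^ 3.
  by apply: le_div_of => //; have := Nk 3%N 57%N erefl; have := pw 3%N; lra.
have eW2 : 2 <= eta * W by lra.
have [t [t1 t2]] := floor_half eW2.
have N5 : 2 <= N / x ^ 5.
  by apply: le_div_of => //; have := Nk 5%N 55%N erefl; have := pw 5%N; lra.
have N7 : 2 <= N / x ^ 7.
  by apply: le_div_of => //; have := Nk 7%N 53%N erefl; have := pw 7%N; lra.
have [M [M1 M2]] := floor_half N5.
have [z [z1 z2]] := floor_half N7.
exists t, M, z.
have W0 : 0 < W by nra.
split; [split|split; [split|]].
- by apply/ssrnat.ltP/INR_lt; rewrite /=; lra.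
- by apply/ssrnat.ltP/INR_lt; rewrite /=; lra.
- lra.
- nra.
- apply/ssrnat.leP/INR_le; rewrite plus_INR (mult_INR _ z) (mult_INR 16) INR_expn (mult_INR _ M) (mult_INR 4) (S_INR n) -/x.
  have -> : INR 16 = 16 by rewrite /=; lra.
  have -> : INR 4 = 4 by rewrite /=; lra.
  apply: Rle_trans (_ : N / x ^ 3 <= _); last by move: t1 eW; rewrite /Rdiv; lra.
  have c3 : (x + 1) ^ 3 <= 8 * x ^ 3.
    by rewrite (_ : 8 * x ^ 3 = (2 * x) ^ 3); [apply: pow_incr; lra|ring].
  have h1 : 16 * (x + 1) ^ 3 * INR z <= 16 * (8 * x ^ 3) * (N / x ^ 7).
    by apply: Rmult_le_compat => //; try lra; apply: Rmult_le_pos; [lra|apply: pow_le; lra].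
  have h2 : 4 * x * INR M <= 4 * x * (N / x ^ 5) by apply: Rmult_le_compat_l; lra.
  apply: Rle_trans (Rplus_le_compat _ _ _ _ h1 h2) _.
  have -> : 16 * (8 * x ^ 3) * (N / x ^ 7) + 4 * x * (N / x ^ 5) = (132 / x) * (N / x ^ 3) by field; lra.
  rewrite -[X in _ <= X]Rmult_1_l; apply: Rmult_le_compat_r.
    by apply/Rlt_le/Rdiv_lt_0_compat.
  by apply: div_le_of; lra.
- by rewrite (_ : N / (2 * x ^ 5) = N / x ^ 5 / 2) //; field; lra.
- by rewrite (_ : N / (2 * x ^ 7) = N / x ^ 7 / 2) //; field; lra.
have : x <= W / 2; last nra.
have := Nk 3%N 57%N erefl => h3.
have : 4 * x ^ 2 * (2 * x) <= 4 * x ^ 2 * W.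
  have -> : 4 * x ^ 2 * (2 * x) = 8 * x ^ 3 by ring.
  have := pw 3%N; lra.
have p4 : 0 < 4 * x ^ 2 by have := pw 2%N; lra.
move=> h; have := Rmult_le_reg_l _ _ _ p4 h; lra.
Qed.

End Core.

Section Core.
Local Open Scope R_scope.

Section Errors.
Variables (x y N B eta eta2 tau : R).
Hypotheses (x6 : 10 ^ 6 <= x) (eta01 : 0 < eta <= 1 / 20) (eta2eta : 0 < eta2 <= eta) (tau01 : 0 < tau <= 1).
Hypothesis hB : 10 ^ 6 <= B * (eta ^ 2 * eta2 * tau).
Hypotheses (hy : B * x ^ 60 <= exp (y / 2)) (hN : B * x ^ 60 <= N).

Let pw k : 0 < x ^ k. Proof. by apply: pow_lt; lra. Qed.
Let B0 : 0 < B.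
Proof.
have h : 0 < eta ^ 2 * eta2 * tau by apply: Rmult_lt_0_compat; [apply: Rmult_lt_0_compat; [apply: pow_lt|]|]; lra.
case: (Rlt_le_dec 0 B) => // Bn; nra.
Qed.
Let N0 : 0 < N. Proof. by have := Rmult_lt_0_compat _ _ B0 (pw 60); lra. Qed.
Let hB1 : 10 ^ 6 <= B * (eta ^ 2 * tau).
Proof.
apply: Rle_trans hB _; apply: Rmult_le_compat_l; first lra.
have h : 0 < eta ^ 2 * tau by apply: Rmult_lt_0_compat; [apply: pow_lt|]; lra.
rewrite (_ : eta ^ 2 * eta2 * tau = (eta ^ 2 * tau) * eta2); last ring.
nra.
Qed.
Let hB2 : 10 ^ 6 <= B * (eta2 * tau).
Proof.
apply: Rle_trans hB _; apply: Rmult_le_compat_l; first lra.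
have h : 0 < eta2 * tau by apply: Rmult_lt_0_compat; lra.
rewrite (_ : eta ^ 2 * eta2 * tau = (eta2 * tau) * eta ^ 2); last ring.
have : eta ^ 2 <= 1 by nra.
nra.
Qed.
Let hB3 : 10 ^ 6 <= B * tau.
Proof.
apply: Rle_trans hB2 _; apply: Rmult_le_compat_l; first lra.
nra.
Qed.

(** The numerator is at most 4 x^50 and P Q^2 at least 1 / (16 x^3); N >= B x^60 outweighs both, and
    B absorbs the constants. *)
Lemma variance_error (l P Q : R) : 0 <= l <= x ^ 24 -> 1 / x <= P -> 1 / (4 * x) <= Q ->
  (1 + x * l) ^ 2 / (eta ^ 2 * (P * Q ^ 2) * N) <= tau / 4.
Proof.
move=> hl hP hQ.
have ix : 0 < 1 / x by apply: Rdiv_lt_0_compat; lra.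
have iq : 0 < 1 / (4 * x) by apply: Rdiv_lt_0_compat; lra.
have e2 : 0 < eta ^ 2 by apply: pow_lt; lra.
have PQ : 1 / (16 * x ^ 3) <= P * Q ^ 2.
  have -> : 1 / (16 * x ^ 3) = (1 / x) * (1 / (4 * x)) ^ 2 by field; lra.
  apply: Rmult_le_compat => //; try lra; last by apply: pow_incr; lra.
  by apply: pow_le; lra.
have PQ0 : 0 < P * Q ^ 2.
  by apply: Rlt_le_trans PQ; apply: Rdiv_lt_0_compat; have := pw 3; lra.
apply: div_le_of; first by apply: Rmult_lt_0_compat => //; apply: Rmult_lt_0_compat.
have top : (1 + x * l) ^ 2 <= 4 * x ^ 50.
  rewrite (_ : 4 * x ^ 50 = (2 * x ^ 25) ^ 2); last ring.
  apply: pow_incr; split; first by nra.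
  have : x * l <= x * x ^ 24 by apply: Rmult_le_compat_l; lra.
  have := pow_R1_Rle x 25 ltac:(lra).
  rewrite (_ : x * x ^ 24 = x ^ 25); last ring. lra.
apply: Rle_trans top _.
apply: Rle_trans (_ : tau / 4 * (eta ^ 2 * (1 / (16 * x ^ 3)) * (B * x ^ 60)) <= _); last first.
  apply: Rmult_le_compat_l; first lra.
  apply: Rmult_le_compat => //.
  - by apply: Rmult_le_pos; [lra|apply/Rlt_le/Rdiv_lt_0_compat; have := pw 3; lra].
  - by apply: Rmult_le_pos; [lra|apply/Rlt_le].
  - by apply: Rmult_le_compat_l; lra.
have -> : tau / 4 * (eta ^ 2 * (1 / (16 * x ^ 3)) * (B * x ^ 60)) =
  (B * (eta ^ 2 * tau)) / 64 * x ^ 7 * x ^ 50 by field; lra.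
apply: Rmult_le_compat_r; first exact/Rlt_le.
have := pow_R1_Rle x 7 ltac:(lra).
nra.
Qed.

Lemma exp_small : 0 <= y -> exp (- y) * (8 * x) <= eta.
Proof.
move=> y0.
have ey := exp_pos (- y).
have e1 : exp (- y) * (B * x ^ 60) <= 1.
  apply: Rle_trans (_ : exp (- y) * exp (y / 2) <= _).
    by apply: Rmult_le_compat_l hy; apply: Rlt_le.
  by rewrite -exp_plus -exp_0; apply: exp_le; lra.
have Be : 10 ^ 6 <= B * eta.
  apply: Rle_trans hB1 _; apply: Rmult_le_compat_l; first lra.
  rewrite -[X in _ <= X]Rmult_1_r (_ : eta ^ 2 * tau = eta * (eta * tau)); last ring.
  by apply: Rmult_le_compat_l; [lra|move: eta01 tau01; clear; nra].
have h60 : 8 * x <= eta * (B * x ^ 60).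
  rewrite (_ : eta * (B * x ^ 60) = (B * eta) * x ^ 59 * x); last ring.
  apply: Rmult_le_compat_r; first lra.
  have := pow_R1_Rle x 59 ltac:(lra); move: Be; clear; nra.
have := Rmult_le_compat_l _ _ _ (Rlt_le _ _ ey) h60.
have : eta * (exp (- y) * (B * x ^ 60)) <= eta * 1 by apply: Rmult_le_compat_l; lra.
lra.
Qed.

Lemma uncovered_error (e M : R) : y / 2 <= e -> N / (2 * x ^ 5) <= M ->
  N * exp (- e) / M <= tau / 4.
Proof.
move=> he hM; have p5 := pw 5.
have M0 : 0 < M by apply: Rlt_le_trans hM; apply: Rdiv_lt_0_compat; lra.
have NM : N <= 2 * x ^ 5 * M.
  have := Rmult_le_compat_l (2 * x ^ 5) _ _ ltac:(lra) hM.
  by rewrite (_ : 2 * x ^ 5 * (N / (2 * x ^ 5)) = N) //; field; lra.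
have ex : exp (- e) * (B * x ^ 60) <= 1.
  apply: Rle_trans (_ : exp (- e) * exp (y / 2) <= _).
    by apply: Rmult_le_compat_l hy; apply/Rlt_le/exp_pos.
  by rewrite -exp_plus -exp_0; apply: exp_le; lra.
have e0 := exp_pos (- e).
apply: div_le_of => //.
apply: Rle_trans (_ : (2 * x ^ 5 * M) * exp (- e) <= _); first by apply: Rmult_le_compat_r; lra.
have h : 2 * x ^ 5 * exp (- e) <= tau / 4.
  have h8 : 8 * x ^ 5 <= tau * (B * x ^ 60).
    have -> : tau * (B * x ^ 60) = (B * tau) * x ^ 55 * x ^ 5 by ring.
    apply: Rmult_le_compat_r; first lra.
    have := pow_R1_Rle x 55 ltac:(lra); nra.
  have := Rmult_le_compat_r _ _ _ (Rlt_le _ _ e0) h8; nra.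
have -> : 2 * x ^ 5 * M * exp (- e) = (2 * x ^ 5 * exp (- e)) * M by ring.
by apply: Rmult_le_compat_r; lra.
Qed.

(** As p2 >= x^(-3), the exponent p2^4 z is at least N / (2 x^19), well above the N / x^24 from the
    union bound. *)
Lemma merging_error (p2 z : R) : eta2 / (4 * x ^ 2) <= p2 -> N / (2 * x ^ 7) <= z -> 4 / eta2 <= x ->
  exp (N / x ^ 24 - p2 ^ 4 * z) <= tau / 4.
Proof.
move=> hp hz h4.
have e4 : 4 <= eta2 * x.
  have := Rmult_le_compat_l eta2 _ _ (Rlt_le _ _ (proj1 eta2eta)) h4.
  by rewrite (_ : eta2 * (4 / eta2) = 4) //; field; lra.
have hp3 : 1 / x ^ 3 <= p2.
  apply: Rle_trans hp; apply: div_le_of; first exact: pw.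
  rewrite (_ : eta2 / (4 * x ^ 2) * x ^ 3 = eta2 * x / 4); [lra|field; lra].
have i3 : 0 < 1 / x ^ 3 by apply: Rdiv_lt_0_compat; [lra|exact: pw].
have hp4 : 1 / x ^ 12 <= p2 ^ 4.
  rewrite (_ : 1 / x ^ 12 = (1 / x ^ 3) ^ 4); last by field; lra.
  by apply: pow_incr; lra.
have hpz : N / (2 * x ^ 19) <= p2 ^ 4 * z.
  have -> : N / (2 * x ^ 19) = (1 / x ^ 12) * (N / (2 * x ^ 7)) by field; lra.
  apply: Rmult_le_compat => //; apply/Rlt_le/Rdiv_lt_0_compat; try lra; try exact: pw.
  by have := pw 7; lra.
have h24 : N / x ^ 24 <= N / (4 * x ^ 19).
  have -> : N / x ^ 24 = (4 / x ^ 5) * (N / (4 * x ^ 19)) by field; lra.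
  rewrite -[X in _ <= X]Rmult_1_l; apply: Rmult_le_compat_r.
    by apply/Rlt_le/Rdiv_lt_0_compat => //; have := pw 19; lra.
  apply: div_le_of; first exact: pw.
  have : x * 1 <= x * x ^ 4 by apply: Rmult_le_compat_l; [lra|apply: pow_R1_Rle; lra].
  rewrite (_ : x ^ 5 = x * x ^ 4); [lra|ring].
have half : N / (2 * x ^ 19) = 2 * (N / (4 * x ^ 19)) by field; lra.
have u0 : 0 < N / (4 * x ^ 19) by apply: Rdiv_lt_0_compat => //; have := pw 19; lra.
apply: Rle_trans (_ : exp (- (N / (4 * x ^ 19))) <= _); first by apply: exp_le; lra.
apply: Rle_trans (exp_neg_le_inv u0) _.
rewrite (_ : / (N / (4 * x ^ 19)) = 4 * x ^ 19 / N); last by field; lra.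
apply: div_le_of => //.
apply: Rle_trans (_ : tau / 4 * (B * x ^ 60) <= _); last by apply: Rmult_le_compat_l; lra.
have -> : tau / 4 * (B * x ^ 60) = (B * tau) / 4 * x ^ 41 * x ^ 19 by field.
apply: Rmult_le_compat_r; first exact/Rlt_le.
have := pow_R1_Rle x 41 ltac:(lra); nra.
Qed.

End Errors.

(* Applied with y = x ^ g for a small power g, B constant, K = chi x / y^2
   vertices in the base tree, h = y boosting rounds and L = x^24. *)
Lemma giant_core (n : nat) (chi pi y eta eta2 eta' tau B : R) (x := INR n) :
  0 < eta <= 1 / 20 -> 5 * eta <= eta' -> 0 < eta2 <= eta -> 0 < tau <= 1 ->
  10 ^ 6 <= B * (eta ^ 2 * eta2 * tau) -> B <= y -> y <= x -> B * x ^ 60 <= exp (y / 2) ->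
  0 < chi <= 1 / 3 -> y ^ 12 <= chi ^ 3 * x -> chi / 2 <= pi -> (1 + 2 * eta) * pi <= 1 ->
  exp (- ((1 + (1 - eta2) * chi) * ((1 - eta) * pi))) <= 1 - (1 - eta) * pi ->
  1 - (1 + eta) * pi <= exp (- ((1 + (1 + eta2) * chi) * ((1 + eta) * pi))) ->
  1 - tau <= prob n ((1 + chi) / x) (giant_event n (pi * ((1 + chi) / x) * 2 ^ n) eta') <= 1.
Proof.
move=> he he' he2 htau hB hBy hyx hexp hchi hy hpi hpi1 LOW UP.
have small : 0 < eta ^ 2 * eta2 * tau.
  by apply: Rmult_lt_0_compat; [apply: Rmult_lt_0_compat; [apply: pow_lt|]|]; lra.
have B0 : 0 < B by case: (Rlt_le_dec 0 B) => // Bn; nra.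
have Be2 : 10 ^ 6 / eta2 <= B.
  apply: div_le_of; first lra.
  apply: Rle_trans hB _; apply: Rmult_le_compat_l; first lra.
  have : eta ^ 2 * tau <= 1 by nra.
  nra.
have ie2 : 1 <= / eta2 by rewrite -Rinv_1; apply: Rinv_le_contravar; lra.
have iee : / eta <= / eta2 by apply: Rinv_le_contravar; lra.
have y6 : 10 ^ 6 <= y by move: Be2; rewrite /Rdiv; lra.
have x6 : 10 ^ 6 <= x by lra.
have x0 : 0 < x by lra.
have n0 : (0 < n)%N by apply/ssrnat.ltP/INR_lt; rewrite /= -/x.
have N60 : B * x ^ 60 <= 2 ^ n.
  apply: Rle_trans hexp _; apply: Rle_trans (exp_half_le_two_pow n); apply: exp_le; rewrite -/x; lra.
have [K [h [K1 K2 K3 [h1 [h2 h3]]]]] := @block_params x y chi ltac:(lra) hyx hchi hy.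
have hcx : y <= chi * x.
  apply: Rle_trans (@pow_ge_self y 11 _) _; first lra.
  by apply: Rle_trans hy _; apply: Rmult_le_compat_r; [lra|nra].
have [hp hp1 hp2 pE [p1lo [p1p p1e]]] := @sprinkle_params x chi eta eta2 ltac:(lra) hchi he2 ltac:(lra).
set p := (1 + chi) / x in hp hp1 hp2 pE p1lo p1p p1e *.
set p2 := eta2 * chi / (4 * x) in hp1 hp2 pE p1lo p1p p1e *.
set p1 := (p - p2) / (1 - p2) in hp1 pE p1lo p1p p1e *.
have px : p * x = 1 + chi by rewrite /p; field; lra.
have p1x : 1 / x <= p1.
  by apply: Rle_trans p1lo; apply: Rmult_le_compat_r; [apply/Rlt_le/Rinv_0_lt_compat|nra].
(* r bounds survival at p1 from below; the second factor 1 - eta, in q, pays for the failure 2 (1 -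
   c)^K of a round. *)
set r := (1 - eta) * pi.
set q := (1 - eta) * r.
have pi0 : 0 < pi by lra.
have r01 : 0 < r <= 1 by rewrite /r; nra.
have q4 : chi / 4 <= q by rewrite /q /r; nra.
have qr : q <= r by rewrite /q; nra.
have rpi : r <= pi by rewrite /r; nra.
have q0 : 0 < q by lra.
have qx : 1 / (4 * x) <= q.
  by apply: div_le_of; [lra|have := Rmult_le_compat_r (4 * x) _ _ ltac:(lra) q4; lra].
have y0 : 0 < y by lra.
have y21 : 1 <= y ^ 2 by apply: pow_R1_Rle; lra.
have cx0 : 0 <= chi * x by lra.
have ycx0 : 0 <= chi * x / y ^ 2.
  by apply: Rmult_le_pos => //; apply/Rlt_le/Rinv_0_lt_compat; lra.
have Kcx : INR K <= chi * x.
  apply: Rle_trans K1 _; apply: div_le_of; first lra.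
  by rewrite -[X in X <= _]Rmult_1_r; apply: Rmult_le_compat_l; lra.
have cxx : chi * x <= x by rewrite -[X in _ <= X]Rmult_1_l; apply: Rmult_le_compat_r; lra.
have Kx : INR K <= x by lra.
have Kp1 : p1 * INR K <= 1.
  apply: Rle_trans (_ : p * (chi * x / y ^ 2) <= _).
    by apply: Rmult_le_compat; lra.
  rewrite (_ : p * _ = (p * x) * chi / y ^ 2); last by field; lra.
  rewrite px; apply: div_le_of; first lra.
  by move: hchi y21; clear; nra.
have Kp10 : 0 < p1 * INR K by apply: Rmult_lt_0_compat; lra.
(* As p1 K <= 1, one of K translated vertices is selected with probability at least p1 K / 2. *)
set c := p1 * INR K / 2 * q.
have c01 : 0 <= c <= 1.
  rewrite /c; split; first by apply: Rmult_le_pos; lra.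
  by rewrite -[X in _ <= X]Rmult_1_l; apply: Rmult_le_compat; lra.
have cK : y <= c * INR K.
  apply: Rle_trans (_ : (1 / x) * INR K / 2 * (chi / 4) * INR K <= _).
    have -> : 1 / x * INR K / 2 * (chi / 4) * INR K = (chi * (INR K * INR K) / x) / 8 by field; lra.
    lra.
  rewrite /c; apply: Rmult_le_compat_r; first lra.
  apply: Rmult_le_compat; try lra.
    by apply: Rmult_le_pos; [apply: Rmult_le_pos; [apply/Rlt_le/Rdiv_lt_0_compat|]|]; lra.
  by apply: Rmult_le_compat_r; [lra|apply: Rmult_le_compat_r; lra].
have expy : exp (- y) <= eta / 8 /\ exp (- y) <= eta * chi / 2.
  have e8 := @exp_small x y B eta eta2 tau x6 he he2 htau hB hexp (Rlt_le _ _ y0).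
  have ey := exp_pos (- y).
  have e81 : exp (- y) * (8 * 1) <= exp (- y) * (8 * x) by apply: Rmult_le_compat_l; lra.
  have e82 : exp (- y) * (8 * x) * chi <= eta * chi by apply: Rmult_le_compat_r; lra.
  have e83 : exp (- y) * 1 <= exp (- y) * (chi * x) by apply: Rmult_le_compat_l; lra.
  lra.
set s := 1 - r.
(* Coordinates withheld from d: 3 K + 1 for the base coset, 2 K for each of h rounds, 2 K for the
   directions of [covered]. *)
set D := ((2 * h + 5) * K + 1)%N.
have hD : INR D <= 4 * (chi * x) / y.
  rewrite /D plus_INR mult_INR plus_INR mult_INR.
  by rewrite (_ : INR 2 = 2) // (_ : INR 5 = 5); [exact: h2|rewrite /=; lra].
have Dn : (D <= n)%N.
  apply/ssrnat.leP/INR_le; apply: Rle_trans hD _; apply: div_le_of => //; rewrite -/x.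
  have : x * 4 <= x * y by apply: Rmult_le_compat_l; lra.
  lra.
set d := (n - D)%N.
have hs : (1 - p1 + p1 * s) ^ d <= s.
  apply: (@lower_params n d D chi r eta2 y p1) => //; rewrite -?/x //; try lra.
  by rewrite /d subnK.
have ep : 0 <= eta * pi by apply: Rmult_le_pos; lra.
have hpi2 : (1 + eta) * pi <= 1 by lra.
have e2x : 4 <= eta2 * (chi * x).
  have := Rmult_le_compat_l eta2 _ _ (Rlt_le _ _ (proj1 he2)) Be2.
  rewrite (_ : eta2 * (10 ^ 6 / eta2) = 10 ^ 6); last by field; lra.
  have : eta2 * B <= eta2 * (chi * x) by apply: Rmult_le_compat_l; lra.
  lra.
have [hs' hu] := @upper_params n chi pi eta eta2 ltac:(rewrite -/x; lra) hchi ltac:(lra) pi0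
   hpi2 e2x ltac:(lra) UP.
rewrite -/x -/p in hs' hu.
have Wlo : 2 ^ n <= 4 * x ^ 2 * (2 ^ n * (p1 * q)).
  have pq : 1 / (4 * x ^ 2) <= p1 * q.
    rewrite (_ : 1 / (4 * x ^ 2) = (1 / x) * (1 / (4 * x))); last by field; lra.
    apply: Rmult_le_compat => //; try (apply/Rlt_le/Rdiv_lt_0_compat; lra).
  have N0 : 0 < 2 ^ n by apply: pow_lt; lra.
  have := Rmult_le_compat_l (4 * x ^ 2 * 2 ^ n) _ _ ltac:(apply: Rmult_le_pos; [apply: Rmult_le_pos; [lra|apply: pow_le; lra]|lra]) pq.
  rewrite (_ : 4 * x ^ 2 * 2 ^ n * (1 / (4 * x ^ 2)) = 2 ^ n); [lra|field; lra].
have [t [M [z [[t0 M0 t1 t2] [[htz M1 z1] bx]]]]] := @count_params n (2 ^ n) (2 ^ n * (p1 * q)) eta B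
  x6 he ltac:(rewrite -/x; move: Be2; rewrite /Rdiv; lra) ltac:(lra) N60 Wlo.
rewrite -/x in M1 z1 bx.
have N0 : 0 < 2 ^ n by apply: pow_lt; lra.
set a := pi * p * 2 ^ n.
have a0 : 0 < a by rewrite /a; apply: Rmult_lt_0_compat => //; apply: Rmult_lt_0_compat; lra.
(* One factor 1 - eta compares p1 with p, the other two q with pi. *)
have Wa : (1 - eta) ^ 3 * a <= 2 ^ n * (p1 * q).
  rewrite /a /q /r (_ : (1 - eta) ^ 3 * (pi * p * 2 ^ n) = 2 ^ n * (((1 - eta) * p) * ((1 - eta) * ((1 - eta) * pi)))); last ring.
  apply: Rmult_le_compat_l; first lra.
  by apply: Rmult_le_compat_r; [rewrite -/r -/q; lra|].
have b1a : (1 - 5 * eta) * a <= (1 - 2 * eta) * (2 ^ n * (p1 * q)).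
  apply: Rle_trans (_ : (1 - 2 * eta) * ((1 - eta) ^ 3 * a) <= _); last by apply: Rmult_le_compat_l; lra.
  rewrite -Rmult_assoc; apply: Rmult_le_compat_r; first lra.
  have : 0 <= eta ^ 2 * (9 - 7 * eta + 2 * eta ^ 2) by apply: Rmult_le_pos; move: he; clear; nra.
  move: he; clear; nra.
(* The second eta pi covers the tail th^K u, extinction only after K steps. *)
set v := (1 + 2 * eta) * pi.
have b2a : (1 + eta) * (2 ^ n * (p * v)) <= (1 + 5 * eta) * a.
  rewrite (_ : (1 + eta) * (2 ^ n * (p * v)) = (1 + eta) * (1 + 2 * eta) * a); last by rewrite /v /a; ring.
  by apply: Rmult_le_compat_r; [lra|move: he; clear; nra].
set L := expn n 24.
have LE : INR L = x ^ 24 by rewrite INR_expn.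
have [] := @prob_giant_bound n (d + 3 * K + 1)%N d K h L t M z p p1 p2 s q c eta v
   (1 - (1 + eta) * pi) (1 - chi / 2) (exp (- (chi ^ 2 / 4))) a eta' hp hp1 ltac:(lra) pE
   ltac:(rewrite /s; lra) hs (leqnn _) c01.
- apply: Rle_trans (_ : (p1 * INR K / 2) * q <= _); first by rewrite /c; lra.
  apply: Rmult_le_compat_r; first lra.
  have hp1' : 0 <= p1 <= 1 by lra.
  have := one_sub_pow_le_half hp1' Kp1; lra.
- rewrite /s (_ : 1 - (1 - r) = r); last ring.
  rewrite /q Rmult_comm; apply: Rmult_le_compat_l; first lra.
  have := one_sub_pow_le_exp K c01.
  have : exp (- (c * INR K)) <= exp (- y) by apply: exp_le; lra.
  lra.
- apply/ssrnat.leP/INR_le; rewrite LE mult_INR INR_expn (_ : INR 2 = 2) //.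
  apply: Rle_trans (_ : 2 ^ h * 1 <= _); last by apply: Rmult_le_compat_l; [apply: pow_le; lra|lra].
  rewrite Rmult_1_r; apply: Rle_trans (exp_half_le_two_pow h).
  apply: Rle_trans (_ : exp (y / 2) <= _); last by apply: exp_le; lra.
  apply: Rle_trans hexp; apply: Rle_trans (_ : x ^ 60 <= _); first by apply: Rle_pow; [lra|lia].
  by rewrite -[X in X <= _]Rmult_1_l; apply: Rmult_le_compat_r; [apply: pow_le|]; lra.
- move: Dn; rewrite /d /D; clear; nia.
- lra.
- lra.
- lra.
- exact/Rlt_le/exp_pos.
- exact: hs'.
- exact: hu.
(* Since K <= chi n, a large K^2 chi / n forces a large K chi^2. *)
- have hth : exp (- (chi ^ 2 / 4)) ^ K <= exp (- y).
    rewrite pow_exp; apply: exp_le.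
    suff : y <= chi ^ 2 / 4 * INR K by lra.
    apply: Rle_trans (_ : 32 * y / 8 <= _); first lra.
    apply: Rle_trans (_ : (chi * (INR K * INR K) / x) / 8 <= _); first lra.
    have : chi * (INR K * INR K) / x <= chi ^ 2 * INR K.
      apply: div_le_of => //.
      rewrite (_ : chi ^ 2 * INR K * x = chi * (INR K * (chi * x))); last ring.
      by apply: Rmult_le_compat_l; [lra|apply: Rmult_le_compat_l; lra].
    have : 0 <= chi ^ 2 * INR K by apply: Rmult_le_pos; [apply: pow_le|]; lra.
    lra.
  have : exp (- (chi ^ 2 / 4)) ^ K * (1 - chi / 2) <= exp (- y) * 1.
    apply: Rmult_le_compat; try lra; apply: pow_le; exact/Rlt_le/exp_pos.
  have : eta * (chi / 2) <= eta * pi by apply: Rmult_le_compat_l; lra.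
  rewrite /v; lra.
- lra.
- lra.
- by rewrite /v; apply: Rmult_lt_0_compat; lra.
- exact: n0.
- by rewrite /L expn_gt0 n0.
- exact: t0.
- exact: M0.
- exact: t1.
- exact: t2.
- exact: htz.
- lra.
- lra.
- apply: Rle_lt_trans b2a _; apply: Rlt_le_trans (_ : 2 * ((1 - 5 * eta) * a) <= _); last lra.
  rewrite -Rmult_assoc; apply: Rmult_lt_compat_r => //; lra.
- by apply: Rle_trans b1a; apply: Rmult_le_compat_r; lra.
- by apply: Rle_trans b2a _; apply: Rmult_le_compat_r; lra.
move=> G1 G2; split; last exact: G2.
apply: Rle_trans G1; rewrite LE -/x.
have E1 := @variance_error x (2 ^ n) B eta eta2 tau x6 he he2 htau hB N60 (x ^ 24) p1 q
   ltac:(split; [apply: pow_le|]; lra) p1x qx.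
have E4 := @variance_error x (2 ^ n) B eta eta2 tau x6 he he2 htau hB N60 (INR K) p v
   ltac:(split; [lra|apply: Rle_trans Kx (@pow_ge_self x 23 _); lra]) ltac:(lra) ltac:(rewrite /v; lra).
have E2 := @uncovered_error x y (2 ^ n) B eta eta2 tau x6 he he2 htau hB hexp N60 (p1 * q * (INR K * INR K)) (INR M)
   ltac:(move: cK; rewrite /c; lra) M1.
have p2lo : eta2 / (4 * x ^ 2) <= p2.
  rewrite /p2; apply: le_div_of; first lra.
  rewrite (_ : eta2 / (4 * x ^ 2) * (4 * x) = eta2 / x); last by field; lra.
  apply: div_le_of => //.
  have := Rmult_le_compat_l eta2 1 (chi * x) ltac:(lra) ltac:(lra); lra.
have E3 := @merging_error x (2 ^ n) B eta eta2 tau x6 he he2 htau hB N60 p2 (INR z) p2lo z1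
   ltac:(move: Be2; rewrite /Rdiv; lra).
lra.
Qed.

End Core.

(** * Passage to the limit *)

Section Limit.
Local Open Scope R_scope.

Lemma Rpower_unbounded (g C : R) : 0 < g -> 0 < C ->
  exists N : nat, forall n : nat, (N <= n)%coq_nat -> C <= Rpower (INR n) g.
Proof.
move=> g0 C0.
have P0 : 0 < Rpower C (1 / g) by apply: exp_pos.
have [N [_ hN]] := @floor_nat (Rpower C (1 / g)) ltac:(lra).
exists N.+1 => n /le_INR; rewrite S_INR => hn.
have E : C = Rpower (Rpower C (1 / g)) g.
  by rewrite Rpower_mult (_ : 1 / g * g = 1) ?Rpower_1 //; field; lra.
rewrite {1}E; apply: Rle_Rpower_l; lra.
Qed.

Lemma ln_le_self (u : R) : 0 < u -> ln u <= u.
Proof. move=> u0; have := exp_ineq1_le (ln u); rewrite exp_ln //; lra. Qed.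

(** With u the square root of y, 60 ln x = (120 / g) ln u <= (120 / g) u, which the quadratic y / 2
    = u^2 / 2 dominates. *)
Lemma growth (g B : R) : 0 < g <= 1 -> 1 <= B ->
  exists N : nat, forall n : nat, (N <= n)%coq_nat ->
    let x := INR n in let y := Rpower x g in
    1 <= x /\ B <= y /\ y <= x /\ B * x ^ 60 <= exp (y / 2).
Proof.
move=> hg hB.
pose C := 2 * B + 480 / g.
have g480 : 0 < 480 / g by apply: Rdiv_lt_0_compat; lra.
have [N hN] := @Rpower_unbounded (g / 2) C ltac:(lra) ltac:(rewrite /C; lra).
exists (maxn N 1) => n hn x y.
have n1 : (1 <= n)%coq_nat by move: hn; lia.
have x1 : 1 <= x by have := le_INR _ _ n1; rewrite -/x /=; lra.
have hu := hN n ltac:(move: hn; lia); rewrite -/x in hu.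
set u := Rpower x (g / 2) in hu.
have u0 : 0 < u by apply: exp_pos.
have yE : y = u * u by rewrite /u -Rpower_plus /y; congr Rpower; lra.
have lx : ln x = 2 / g * ln u by rewrite /u ln_Rpower; field; lra.
have lu := ln_le_self u0.
have C1 : 2 * B <= C by rewrite /C; lra.
split => //; split; first by rewrite yE; nra.
split.
  by rewrite -[X in _ <= X]Rpower_1; [apply: Rle_Rpower; lra|lra].
rewrite -(exp_ln B) -?Rpower_pow; try lra.
rewrite /Rpower -exp_plus; apply: exp_le.
rewrite (_ : INR 60 = 60); last by rewrite /=; lra.
have lB : ln B <= B by apply: ln_le_self; lra.
rewrite lx yE.
have g2 : 0 < 2 / g by apply: Rdiv_lt_0_compat; lra.
have h1 : 60 * (2 / g * ln u) <= 120 / g * u.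
  rewrite (_ : 120 / g * u = 60 * (2 / g * u)); last by field; lra.
  by apply: Rmult_le_compat_l; [lra|apply: Rmult_le_compat_l; lra].
have h2 : 120 / g = 480 / g / 4 by field; lra.
move: h1 h2 hu C1 lB u0 hB; rewrite /C; move: (480 / g) (120 / g) (ln B) (60 * _) g480 => a b c d; clear; nra.
Qed.

Lemma giant_limit (eps delta : R) (chi pi : nat -> R) :
  0 < eps < 1 / 3 -> 0 < delta ->
  (exists N : nat, forall n : nat, (N <= n)%coq_nat ->
      chi n <= eps /\ Rpower (INR n) (- (1 / 3) + delta) <= chi n) ->
  (forall eta, 0 < eta <= 1 / 20 -> exists eta2, 0 < eta2 <= eta /\
    exists N : nat, forall n : nat, (N <= n)%coq_nat -> 0 < chi n ->
      chi n / 2 <= pi n /\ (1 + 2 * eta) * pi n <= 1 /\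
      exp (- ((1 + (1 - eta2) * chi n) * ((1 - eta) * pi n))) <= 1 - (1 - eta) * pi n /\
      1 - (1 + eta) * pi n <= exp (- ((1 + (1 + eta2) * chi n) * ((1 + eta) * pi n)))) ->
  forall eta : R, 0 < eta ->
  Un_cv (fun n : nat => prob n ((1 + chi n) / INR n)
    (giant_event n (pi n * ((1 + chi n) / INR n) * 2 ^ n) eta)) 1.
Proof.
move=> heps hdelta [N1 hchi] hpi eta' eta'0 tau' tau'0.
(* All relative losses on the size add up to at most 5 eta. *)
pose eta := Rmin (1 / 20) (eta' / 5); pose tau := Rmin 1 (tau' / 2).
have heta : 0 < eta <= 1 / 20 /\ 5 * eta <= eta'.
  by rewrite /eta; have := Rmin_l (1 / 20) (eta' / 5); have := Rmin_r (1 / 20) (eta' / 5);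
    have := Rmin_glb_lt (1 / 20) (eta' / 5) 0 ltac:(lra) ltac:(lra); lra.
have htau : 0 < tau <= 1 /\ tau < tau'.
  by rewrite /tau; have := Rmin_l 1 (tau' / 2); have := Rmin_r 1 (tau' / 2);
    have := Rmin_glb_lt 1 (tau' / 2) 0 ltac:(lra) ltac:(lra); lra.
have [eta2 [heta2 [N2 hN2]]] := hpi eta (proj1 heta).
have small : 0 < eta ^ 2 * eta2 * tau.
  by apply: Rmult_lt_0_compat; [apply: Rmult_lt_0_compat; [apply: pow_lt|]|]; lra.
have small1 : eta ^ 2 * eta2 * tau <= 1.
  have sq (e : R) : 0 < e <= 1 / 20 -> e ^ 2 <= 1 by clear; nra.
  have h0 := sq eta (proj1 heta).
  have h1 : eta ^ 2 * eta2 <= 1 * 1 by apply: Rmult_le_compat; try lra; apply: pow_le; lra.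
  rewrite -[X in _ <= X]Rmult_1_r; apply: Rmult_le_compat; try lra.
  by apply: Rmult_le_pos; [apply: pow_le|]; lra.
pose B := 10 ^ 6 / (eta ^ 2 * eta2 * tau).
have hB1 : 1 <= B by apply: le_div_of; lra.
have hB : 10 ^ 6 <= B * (eta ^ 2 * eta2 * tau).
  by rewrite /B /Rdiv Rmult_assoc Rinv_l; lra.
(* chi^3 x is at least x^(3 delta), so y^12 = x^(12 g) stays below it. *)
pose g := Rmin (delta / 4) 1.
have hg : 0 < g <= 1 /\ 4 * g <= delta.
  by rewrite /g; have := Rmin_l (delta / 4) 1; have := Rmin_r (delta / 4) 1;
    have := Rmin_glb_lt (delta / 4) 1 0 ltac:(lra) ltac:(lra); lra.
have [N3 hN3] := growth (proj1 hg) hB1.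
exists (maxn N1 (maxn N2 N3)) => n hn.
have [x1 [By [yx ye]]] := hN3 n ltac:(move: hn; lia).
have [ce cd] := hchi n ltac:(move: hn; lia).
have cpos : 0 < chi n by apply: Rlt_le_trans cd; apply: exp_pos.
have [p1 [p2 [p3 p4]]] := hN2 n ltac:(move: hn; lia) cpos.
have y12 : Rpower (INR n) g ^ 12 <= chi n ^ 3 * INR n.
  apply: Rle_trans (_ : Rpower (INR n) (- (1 / 3) + delta) ^ 3 * INR n <= _); last first.
    apply: Rmult_le_compat_r; first lra.
    by apply: pow_incr; split => //; apply/Rlt_le/exp_pos.
  rewrite -!Rpower_pow; try exact: exp_pos.
  rewrite !Rpower_mult -[X in _ <= _ * X](@Rpower_1 (INR n)); last lra.
  rewrite -Rpower_plus; apply: Rle_Rpower; first lra.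
  have -> : INR 12 = 12 by rewrite /=; lra.
  have -> : INR 3 = 3 by rewrite /=; lra.
  lra.
have := @giant_core n (chi n) (pi n) (Rpower (INR n) g) eta eta2 eta' tau B (proj1 heta) (proj2 heta)
  heta2 (proj1 htau) hB By yx ye ltac:(lra) y12 p1 p2 p3 p4.
rewrite /R_dist => H; rewrite Rabs_left1; lra.
Qed.

End Limit.

(** * The survival probability *)

Section Survival.
Local Open Scope R_scope.

Lemma exp_strict_convex (t w : R) : 0 < t < 1 -> w <> 0 -> exp (t * w) < t * exp w + (1 - t).
Proof.
move=> ht w0.
have h1 : 1 + (1 - t) * w < exp ((1 - t) * w) by apply: exp_ineq1; nra.
have h2 : 1 + - (t * w) < exp (- (t * w)) by apply: exp_ineq1; nra.
have e0 := exp_pos (t * w).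
have E1 : exp w = exp (t * w) * exp ((1 - t) * w) by rewrite -exp_plus; congr exp; ring.
have E2 : exp (t * w) * exp (- (t * w)) = 1 by rewrite -exp_plus -exp_0; congr exp; ring.
have k1 := Rmult_lt_compat_l _ _ _ e0 h1; have k2 := Rmult_lt_compat_l _ _ _ e0 h2.
rewrite -E1 in k1; rewrite E2 in k2; nra.
Qed.

Section Alpha.
Variables (eps alpha : R).
Hypothesis heps : 0 < eps < 1 / 3.
Hypothesis halpha : Un_cv (gw_alive eps) alpha.

Lemma survival_fixpoint : 1 - alpha = exp (- ((1 + eps) * alpha)).
Proof.
have c1 : Un_cv (fun k => 1 - gw_alive eps k) (1 - alpha).
  by apply: CV_minus => //; move=> e e0; exists 0%N => n _; rewrite /R_dist Rminus_diag Rabs_R0.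
have c2 : Un_cv (fun k => 1 - gw_alive eps k.+1) (1 - alpha).
  move=> e e0; have [N hN] := c1 e e0; exists N => n hn; apply: hN; lia.
have cont : continuity_pt (fun t => exp (- ((1 + eps) * t))) alpha by reg.
have c3 := @continuity_seq _ _ _ cont halpha.
apply: (UL_sequence _ _ _ c2); move=> e e0; have [N hN] := c3 e e0; exists N => n hn.
have -> : 1 - gw_alive eps n.+1 = exp (- ((1 + eps) * gw_alive eps n)).
  have E z : 1 - (1 - z) = z by ring.
  rewrite /gw_alive /= E; set u := Nat.iter _ _ _.
  by rewrite /poisson_pgf; congr exp; ring.
exact: hN.
Qed.

(** The iterates of the generating function start at 0 and never pass 1 - eps/2. This singles out
    the positive root of the fixed-point equation, which 0 solves as well. *)
Lemma survival_lb : eps / 2 <= alpha.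
Proof.
have step u : u <= 1 - eps / 2 -> poisson_pgf eps u <= 1 - eps / 2.
  move=> hu; apply: Rle_trans (@exp_neg_le_quadratic (eps / 2) ltac:(lra)).
  have : (1 + eps) * (u - 1) <= (1 + eps) * (- (eps / 2)) by apply: Rmult_le_compat_l; lra.
  rewrite /poisson_pgf => h; apply: exp_le.
  have : (1 + eps) * (u - 1) <= - (eps / 2 + (eps / 2) ^ 2) by move: h heps; clear; nra.
  by [].
have H k : Nat.iter k (poisson_pgf eps) 0 <= 1 - eps / 2.
  by elim: k => [|k IH] /=; [lra|exact: step].
apply: (@Rle_cv_lim (fun _ : nat => eps / 2) (gw_alive eps)) halpha.
- move=> k; change (eps / 2 <= 1 - Nat.iter k (poisson_pgf eps) 0).
  by have := H k; lra.
- by move=> e e0; exists 0%N => n _; rewrite /R_dist Rminus_diag Rabs_R0.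
Qed.

(** Keeps (1 + 2 eta) alpha below 1 for eta <= 1/20. *)
Lemma survival_ub : alpha <= 8 / 9.
Proof.
have fx := survival_fixpoint; have lb := survival_lb.
have a1 : alpha < 1 by have := exp_pos (- ((1 + eps) * alpha)); lra.
have : exp (- (4 / 3)) <= exp (- ((1 + eps) * alpha)) by apply: exp_le; nra.
have e9 : exp (4 / 3) <= 9.
  rewrite (_ : 4 / 3 = 1 / 3 + 1); last lra.
  rewrite exp_plus (_ : 9 = 3 * 3); last lra.
  have e3 := exp_le_3; have e13 : exp (1 / 3) <= exp 1 by apply: exp_le; lra.
  apply: Rmult_le_compat; try lra; exact/Rlt_le/exp_pos.
have : / 9 <= exp (- (4 / 3)) by rewrite exp_Ropp; apply: Rinv_le_contravar => //; exact: exp_pos.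
lra.
Qed.

(* Strict convexity of exp separates (1 - eta) alpha and (1 + eta) alpha from the
   fixed point alpha, leaving room for eta2. *)
Lemma survival_window (eta : R) : 0 < eta <= 1 / 20 -> exists eta2, 0 < eta2 <= eta /\
  exp (- ((1 + (1 - eta2) * eps) * ((1 - eta) * alpha))) <= 1 - (1 - eta) * alpha /\
  1 - (1 + eta) * alpha <= exp (- ((1 + (1 + eta2) * eps) * ((1 + eta) * alpha))).
Proof.
move=> he.
have fx := survival_fixpoint; have lb := survival_lb; have ub := survival_ub.
set w := - ((1 + eps) * alpha) in fx.
have w0 : w < 0 by rewrite /w; nra.
set r := (1 - eta) * alpha; set r' := (1 + eta) * alpha.
have r0 : 0 < r by rewrite /r; nra.
have r'0 : 0 < r' < 1 by rewrite /r'; nra.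
have L : exp ((1 - eta) * w) < 1 - r.
  have := @exp_strict_convex (1 - eta) w ltac:(lra) ltac:(lra); rewrite -fx /r; lra.
have U : 1 - r' < exp ((1 + eta) * w).
  have := @exp_strict_convex (1 / (1 + eta)) ((1 + eta) * w) _ ltac:(nra).
  rewrite (_ : 1 / (1 + eta) * ((1 + eta) * w) = w); last by field; lra.
  rewrite -fx => H.
  have {}H : 1 - alpha < 1 / (1 + eta) * exp ((1 + eta) * w) + (1 - 1 / (1 + eta)).
    by apply: H; split; [apply: Rdiv_lt_0_compat; lra|apply: (Rmult_lt_reg_r (1 + eta)); [lra|rewrite /Rdiv Rmult_assoc Rinv_l; lra]].
  have := Rmult_lt_compat_r (1 + eta) _ _ ltac:(lra) H.
  rewrite Rmult_plus_distr_r (_ : 1 / (1 + eta) * exp ((1 + eta) * w) * (1 + eta) = exp ((1 + eta) * w)); last by field; lra.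
  rewrite (_ : (1 - 1 / (1 + eta)) * (1 + eta) = eta); last by field; lra.
  rewrite /r'; lra.
have eL := exp_pos ((1 - eta) * w); have eU := exp_pos ((1 + eta) * w).
(* The strict inequalities make these ratios exceed 1; eta2 is such that its effect on the exponents
   stays below their logarithms. *)
pose k := (1 - r) / exp ((1 - eta) * w); pose k' := exp ((1 + eta) * w) / (1 - r').
have k1 : 1 < k by apply: (Rmult_lt_reg_r (exp ((1 - eta) * w))) => //; rewrite /k /Rdiv Rmult_assoc Rinv_l; lra.
have k'1 : 1 < k' by apply: (Rmult_lt_reg_r (1 - r')); [lra|rewrite /k' /Rdiv Rmult_assoc Rinv_l; lra].
have lk : 0 < ln k by rewrite -ln_1; apply: ln_increasing; lra.
have lk' : 0 < ln k' by rewrite -ln_1; apply: ln_increasing; lra.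
have er : 0 < eps * r by nra.
have er' : 0 < eps * r' by nra.
pose eta2 := Rmin eta (Rmin (ln k / (eps * r)) (ln k' / (eps * r'))).
have h0 : 0 < eta2.
  by apply: Rmin_glb_lt; [lra|apply: Rmin_glb_lt; apply: Rdiv_lt_0_compat].
have h1 : eta2 <= eta by apply: Rmin_l.
have h2 : eta2 <= ln k / (eps * r) by apply: Rle_trans (Rmin_r _ _) (Rmin_l _ _).
have h3 : eta2 <= ln k' / (eps * r') by apply: Rle_trans (Rmin_r _ _) (Rmin_r _ _).
have {}h2 : eta2 * (eps * r) <= ln k.
  have := Rmult_le_compat_r (eps * r) _ _ (Rlt_le _ _ er) h2.
  by rewrite (_ : ln k / (eps * r) * (eps * r) = ln k) //; field; nra.
have {}h3 : eta2 * (eps * r') <= ln k'.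
  have := Rmult_le_compat_r (eps * r') _ _ (Rlt_le _ _ er') h3.
  by rewrite (_ : ln k' / (eps * r') * (eps * r') = ln k') //; field; nra.
exists eta2; split; first lra; split.
- have -> : - ((1 + (1 - eta2) * eps) * r) = (1 - eta) * w + eta2 * (eps * r) by rewrite /w /r; ring.
  rewrite exp_plus; apply: Rle_trans (_ : exp ((1 - eta) * w) * k <= _).
    apply: Rmult_le_compat_l; first lra.
    by rewrite -[X in _ <= X]exp_ln; [apply: exp_le|lra].
  by rewrite /k (_ : exp ((1 - eta) * w) * ((1 - r) / exp ((1 - eta) * w)) = 1 - r); [lra|field; lra].
have -> : - ((1 + (1 + eta2) * eps) * r') = (1 + eta) * w + - (eta2 * (eps * r')) by rewrite /w /r'; ring.
rewrite exp_plus; apply: mul_exp_le.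
apply: Rle_trans (_ : (1 - r') * k' <= _).
  apply: Rmult_le_compat_l; first lra.
  by rewrite -[X in _ <= X]exp_ln; [apply: exp_le|lra].
by rewrite /k' (_ : (1 - r') * (exp ((1 + eta) * w) / (1 - r')) = exp ((1 + eta) * w)); [lra|field; lra].
Qed.

End Alpha.

(** As - ln (1 - r) is r + r^2 / 2 up to a cubic term, the root is near r = 2 chi. On the lower side
    the cubic term costs r^2 <= 4 chi^2 <= eta chi / 2, which is the slack left by eta2 = eta /
    2. *)
Lemma near_critical_window (eta chi : R) : 0 < eta <= 1 / 20 -> 0 < chi <= eta / 8 ->
  exp (- ((1 + (1 - eta / 2) * chi) * ((1 - eta) * (2 * chi)))) <= 1 - (1 - eta) * (2 * chi) /\
  1 - (1 + eta) * (2 * chi) <= exp (- ((1 + (1 + eta / 2) * chi) * ((1 + eta) * (2 * chi)))).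
Proof.
move=> he hc; split.
  set r := (1 - eta) * (2 * chi).
  have r0 : 0 < r <= 2 * chi by rewrite /r; nra.
  apply: Rle_trans (@exp_neg_le_cubic r ltac:(lra)); apply: exp_le; apply: Ropp_le_contravar.
  have : r / 2 + r ^ 2 <= (1 - eta / 2) * chi.
    have : r ^ 2 <= (2 * chi) ^ 2 by apply: pow_incr; lra.
    rewrite /r; nra.
  nra.
set r := (1 + eta) * (2 * chi).
have r0 : 0 < r by rewrite /r; nra.
apply: Rle_trans (@one_sub_le_exp_quadratic r ltac:(lra)) _; apply: exp_le; apply: Ropp_le_contravar.
have : (1 + eta / 2) * chi <= r / 2 by rewrite /r; nra.
nra.
Qed.

End Survival.

Unset Implicit Arguments.
Open Scope R_scope.

Theorem theorem5p1 (eps delta alpha : R) (chi : nat -> R) :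
  0 < eps < 1/3 ->
  0 < delta ->
  (exists N : nat, forall n : nat, (N <= n)%coq_nat ->
      chi n <= eps /\ Rpower (INR n) (-(1/3) + delta) <= chi n) ->
  (* alpha(eps) = survival probability = lim_k P(Z_k > 0) *)
  Un_cv (gw_alive eps) alpha ->
  ((forall n : nat, chi n = eps) ->
     forall eta : R, 0 < eta ->
       Un_cv (fun n : nat =>
                prob n ((1 + chi n) / INR n)
                  (giant_event n (alpha * ((1 + eps) / INR n) * 2 ^ n) eta)) 1)
  /\
  (Un_cv chi 0 ->
     forall eta : R, 0 < eta ->
       Un_cv (fun n : nat =>
                prob n ((1 + chi n) / INR n)
                  (giant_event n (2 * chi n * ((1 + chi n) / INR n) * 2 ^ n) eta)) 1).
Proof.
move=> heps hdelta hchi halpha; split.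
- move=> chiE eta eta0.
  have H := @giant_limit eps delta chi (fun=> alpha) heps hdelta hchi _ eta eta0.
  have {}H : Un_cv (fun n : nat => prob n ((1 + chi n) / INR n)
      (giant_event n (alpha * ((1 + chi n) / INR n) * 2 ^ n) eta)) 1.
    apply: H => e he; have [e2 [he2 [hl hu]]] := survival_window heps halpha he.
    exists e2; split => //; exists 0%N => n _ _; rewrite chiE.
    have lb := survival_lb heps halpha; have ub := survival_ub heps halpha.
    by split; [lra|split; [nra|split]].
  by move=> tau tau0; have [N hN] := H tau tau0; exists N => n hn; have := hN n hn; rewrite !chiE.
move=> chi0 eta eta0.
apply: (@giant_limit eps delta chi (fun n => 2 * chi n) heps hdelta hchi) => // e he.
exists (e / 2); split; first lra.
have [N hN] := chi0 (e / 8) ltac:(lra).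
exists N => n hn cn.
have := hN n hn; rewrite /R_dist Rminus_0_r Rabs_right; last lra.
move=> c8.
have [w1 w2] := @near_critical_window e (chi n) he ltac:(lra).
by split; [lra|split; [nra|split]].
Qed.
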